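(* Let $(u^\star,\omega^\star)\in\mathcal V\times S$ be an eigenpair of $\mathcal T$, i.e. $u^\star\ne0$ and $\mathcal T(\omega^\star)u^\star=0$ in $\mathcal V^*$, where the eigenvalue $\omega^\star$ has (geometric and algebraic) multiplicity $1$, and let $y\in\mathcal V$ be such that $\mathcal P_{[y]}u^\star=1$. Then there exists $r>0$ such that $\mathcal T(\omega)$ is invertible for all $\omega\in D$ with $0<|\omega-\omega^\star|<r$ and the following holds. For every starting point $(u^0,\omega^0)\in E$ with $\|(u^0-u^\star,\omega^0-\omega^\star)\|_{\mathcal W}<r$, $\mathcal P_{[y]}u^0=1$, and $$\mathcal P_{[y]}\,\mathcal T(\omega^0)^{-1}\mathcal T'(\omega^0)u^0\ne0\quad\text{if }\omega^0\ne\omega^\star,$$ the Newton iteration $u^{j+1}:=u^j+s^j$, $\omega^{j+1}:=\omega^j+\nu^j$, where $(s^j,\nu^j)\in\mathcal V\times\mathbb C$ solves $$\begin{bmatrix}\mathcal T(\omega^j)&\mathcal T'(\omega^j)u^j\\ \mathcal P_{[y]}&0\end{bmatrix}\begin{bmatrix}s^j\\ \nu^j\end{bmatrix}=-\begin{bmatrix}\mathcal T(\omega^j)u^j\\0\end{bmatrix},\qquad j=0,1,2,\dots,$$ is well-defined and $(u^j,\omega^j)$ converges quadratically to $(u^\star,\omega^\star)$ in the norm $\|\cdot\|_{\mathcal W}$.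
   Context: Setting: $\Omega\subset\mathbb R^2$ is a bounded domain (Wigner–Seitz cell of a periodic lattice), decomposed as $\Omega=\Omega_1\cup\Omega_2$ into disjoint subdomains with indicator functions $\chi_1,\chi_2$; $\mathbf k\in\mathbb R^2$ is fixed, $\nabla_{\mathbf k}:=\nabla+i\mathbf k$. $\mathcal V:=H^1_{\rm per}(\Omega)$ and $\mathcal H:=L^2(\Omega)$ (complex, with standard norms, $(u,v)=\int_\Omega u\overline v\,dx$); $\mathcal V^*$ is the conjugate dual. $\alpha_1>0$ is a constant, and $\varepsilon_2$ is a real-valued analytic function on an open connected set $S\subset\mathbb R$ with $0<C_0\le|\varepsilon_2(\omega)|\le C_1<\infty$ and $\varepsilon_2(-\omega)=\varepsilon_2(\omega)$ on $S$. Define $\mathcal T(\omega):=\mathcal A-\mathcal B(\omega)\colon\mathcal V\to\mathcal V^*$ with $\langle\mathcal Au,v\rangle:=\int_\Omega\nabla_{\mathbf k}u\cdot\overline{\nabla_{\mathbf k}v}\,dx$ and $\langle\mathcal B(\omega)u,v\rangle:=\omega^2\int_\Omega(\alpha_1\chi_1+\varepsilon_2(\omega)\chi_2)u\overline v\,dx$. $\mathcal T$ is extended to a self-adjoint holomorphic operator-valued function on an open convex neighborhood $D\subset\mathbb C$ of $S$, symmetric with respect to the real axis, on which the spectrum of $\mathcal T$ consists of isolated eigenvalues of finite multiplicity; $\mathcal T'$ is the derivative in $\omega$. $\mathcal P_{[y]}\colon\mathcal V\to\mathbb C$ is the linear functional $\mathcal P_{[y]}u:=(u,y)$. $\mathcal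 W:=\mathcal V\times\mathbb C$ with $\|(u,\omega)\|_{\mathcal W}^2:=\|u\|_{\mathcal V}^2+|\omega|^2$. $E:=G\times D$ where $G\subset\mathcal V$ is an open convex set containing $u^\star$. Quadratic convergence means there is a constant $C$ with $\|(u^{j+1}-u^\star,\omega^{j+1}-\omega^\star)\|_{\mathcal W}\le C\|(u^{j}-u^\star,\omega^{j}-\omega^\star)\|_{\mathcal W}^2$ for all $j$. Algebraic multiplicity $1$ means that all Jordan chains of $\mathcal T$ at $\omega^\star$ have length $1$, equivalently $\mathcal T'(\omega^\star)u^\star\notin\operatorname{im}\mathcal T(\omega^\star)$. *)

(* Defs.v *)
From HB Require Import structures.
From mathcomp Require Import all_boot all_order all_algebra generic_quotient.
From mathcomp Require Import complex.
From mathcomp Require Import all_classical all_reals all_analysis.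
From mathcomp Require Import measurable_realfun.
From mathcomp Require Import ring lra.

Set Implicit Arguments.
Unset Strict Implicit.
Unset Printing Implicit Defensive.
Import Order.TTheory GRing.Theory Num.Theory.
Import numFieldNormedType.Exports.
Local Open Scope classical_set_scope.
Local Open Scope ring_scope.
Local Open Scope complex_scope.
Local Open Scope quotient_scope.

(* The library puts the norm topology on [K^o] for an abstract numFieldType K;
   this makes it available on the concrete type [R[i]]. *)
HB.instance Definition _ (R : realType) := NormedModule.copy R[i] (R[i]^o).

Notation plane R := (R * R)%type.

Section PeriodicFunctions.
Variable R : realType.
Implicit Types (a b e x : plane R).

Definition lattice a b : set (plane R) :=
  [set p | exists m n : int, p = a *~ m + b *~ n].

(* Squared Euclidean norm: the library norm on a product is the sup norm. *)
Definition sqnorm2 x : R := x.1 ^+ 2 + x.2 ^+ 2.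

(* The (open) Voronoi cell of the origin in the lattice Z a + Z b. *)
Definition wigner_seitz a b : set (plane R) :=
  [set x | forall p, lattice a b p -> p != 0 -> sqnorm2 x < sqnorm2 (x - p)].

Definition e1 : plane R := (1, 0).
Definition e2 : plane R := (0, 1).

(* C^n regularity; only the two coordinate directions are needed. *)
Fixpoint Ck (n : nat) (f : plane R -> R) : Prop :=
  continuous f /\
  if n is m.+1 then
    forall e, e = e1 \/ e = e2 ->
      (forall x, derivable f x e) /\ Ck m (fun x => 'D_e f x)
  else True.

Definition smooth (f : plane R -> R[i]) : Prop :=
  forall n, Ck n (fun x => complex.Re (f x)) /\ Ck n (fun x => complex.Im (f x)).

Definition periodic a b (f : plane R -> R[i]) : Prop :=
  forall x, f (x + a) = f x /\ f (x + b) = f x.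

Definition cpartial e (f : plane R -> R[i]) : plane R -> R[i] :=
  fun x => ('D_e (fun z => complex.Re (f z)) x) +i*
           ('D_e (fun z => complex.Im (f z)) x).

(* An element of H^1 is represented by the triple (u, d_1 u, d_2 u). *)
Definition jet : Type :=
  ((plane R -> R[i]) * (plane R -> R[i]) * (plane R -> R[i]))%type.
HB.instance Definition _ := GRing.Lmodule.on jet.

Definition jet_of (f : plane R -> R[i]) : jet :=
  (f, cpartial e1 f, cpartial e2 f).

Definition leb2 := (@lebesgue_measure R \x @lebesgue_measure R)%E.

Definition sqmod (z : R[i]) : R := complex.Re z ^+ 2 + complex.Im z ^+ 2.

Definition jet_sqmod (U : jet) (x : plane R) : R :=
  sqmod (U.1.1 x) + sqmod (U.1.2 x) + sqmod (U.2 x).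

(* The squared H^1 norm, int_Omega |u|^2 + |grad u|^2. *)
Definition jet_sqnorm a b (U : jet) : \bar R :=
  (\int[leb2]_(x in wigner_seitz a b) (jet_sqmod U x)%:E)%E.

Definition cmeasurable (D : set (plane R)) (f : plane R -> R[i]) : Prop :=
  measurable_fun D (fun x => complex.Re (f x)) /\
  measurable_fun D (fun x => complex.Im (f x)).

(* H^1_per(Omega) is the closure of the smooth lattice-periodic functions in
   the H^1(Omega) norm.  As an L^2 limit of classical gradients, the pair
   (U.1.2, U.2) of a member U is the weak gradient of the function U.1.1. *)
Definition is_H1per a b (U : jet) : Prop :=
  [/\ cmeasurable (wigner_seitz a b) U.1.1,
      cmeasurable (wigner_seitz a b) U.1.2,
      cmeasurable (wigner_seitz a b) U.2,
      (jet_sqnorm a b U < +oo)%E &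
      forall eps : R, 0 < eps -> exists f,
        [/\ smooth f, periodic a b f &
            (jet_sqnorm a b (U - jet_of f)%R < eps%:E)%E]].

End PeriodicFunctions.

Section Measurability.
Variable R : realType.

Lemma open_plane_measurable (U : set (plane R)) : open U -> measurable U.
Proof.
move=> oU.
pose rect (q : rat * rat * rat) : set (plane R) :=
  ball (ratr q.1.1 : R) (ratr q.2) `*` ball (ratr q.1.2 : R) (ratr q.2).
have -> : U = \bigcup_(q in [set q | rect q `<=` U]) rect q.
  apply/seteqP; split=> [[x y] Uxy|z [q qU /qU//]].
  move: oU; rewrite openE => /(_ _ Uxy); rewrite /interior /=.
  rewrite -nbhs_ballE => -[e /= e0 eU].
  have /rat_in_itvoo[r] : e / 4 < e / 2 by lra.
  have /rat_in_itvoo[p] : x - e / 4 < x + e / 4 by lra.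
  have /rat_in_itvoo[q] : y - e / 4 < y + e / 4 by lra.
  rewrite !in_itv /= => /andP[q1 q2] /andP[p1 p2] /andP[r1 r2].
  exists (p, q, r).
    move=> [u v] [/= bu bv]; apply: eU; split => /=.
      move: bu; rewrite /ball /= !ltr_norml => /andP[b1 b2].
      by apply/andP; split; lra.
    move: bv; rewrite /ball /= !ltr_norml => /andP[b1 b2].
    by apply/andP; split; lra.
  by split; rewrite /ball /= ltr_norml; apply/andP; split; lra.
rewrite bigcup_mkcond; apply: countable_bigcupT_measurable => //.
move=> q; case: ifP => // _.
by apply: measurableX; apply: open_measurable; exact: ball_open.
Qed.

Lemma continuous_plane_measurable (f : plane R -> R) :
  continuous f -> measurable_fun setT f.
Proof.
move=> /continuousP cf.
apply: (measurability _ (RGenOpens.measurableE R)).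
move=> _ [_ [a [b ->] <-]]; rewrite setTI; apply: open_plane_measurable.
exact/cf/interval_open.
Qed.

Lemma measurable_wigner_seitz (a b : plane R) : measurable (wigner_seitz a b).
Proof.
pose F (q : int * int) : set (plane R) := 
  let p := a *~ q.1 + b *~ q.2 in
  if p == 0 then setT else [set x | sqnorm2 x < sqnorm2 (x - p)].
have -> : wigner_seitz a b = \bigcap_q F q.
  apply/seteqP; split=> [x wx [m n] _|x Fx p [m [n pE]] p0].
    rewrite /F /=; case: ifPn => // p0.
    by apply: wx => //; exists m, n.
  by have := Fx (m, n) I; rewrite /F /= -pE (negbTE p0).
rewrite -[X in measurable X]setCK setC_bigcap; apply: measurableC.
apply: countable_bigcupT_measurable => //.
move=> q; apply: measurableC; rewrite /F /=; case: ifP => // _.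

set p := a *~ q.1 + b *~ q.2.
have m1 : measurable_fun setT (@fst R R) by exact: measurable_fst.
have m2 : measurable_fun setT (@snd R R) by exact: measurable_snd.
have mf : measurable_fun setT (fun x : plane R => sqnorm2 x).
  by apply: measurable_funD; apply: measurable_funX.
have mg : measurable_fun setT (fun x : plane R => sqnorm2 (x - p)).
  by apply: measurable_funD; apply: measurable_funX; apply: measurable_funB.
have := measurable_fun_ltr mf mg measurableT (_ : measurable [set true]).
by rewrite setTI; apply.
Qed.

End Measurability.

Section ComplexParts.
Variable R : realType.
Implicit Types c z w : R[i].

Lemma Re_lin c z w : complex.Re (c * z + w) =
  complex.Re c * complex.Re z - complex.Im c * complex.Im z + complex.Re w.
Proof. by case: c => ? ?; case: z => ? ?; case: w => ? ?. Qed.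

Lemma Im_lin c z w : complex.Im (c * z + w) =
  complex.Re c * complex.Im z + complex.Im c * complex.Re z + complex.Im w.
Proof. by case: c => ? ?; case: z => ? ?; case: w => ? ?. Qed.

End ComplexParts.

Section SmoothLinear.
Variable R : realType.
Implicit Types (f g : plane R -> R[i]).

Lemma Ck_lin n (s t : R) (f g : plane R -> R) : Ck n f -> Ck n g ->
  Ck n (fun x => s * f x + t * g x).
Proof.
elim: n f g => [|n IHn] f g /= [cf df] [cg dg].
  by split=> // x; apply: cvgD; apply: cvgZr; [exact: cf|exact: cg].
split; first by move=> x; apply: cvgD; apply: cvgZr; [exact: cf|exact: cg].
move=> e he; have [ef cdf] := df e he; have [eg cdg] := dg e he.
split=> [x|].
  by apply: derivableD; apply: derivableZ; [exact: ef|exact: eg].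
have -> : (fun x => 'D_e (fun x0 => s * f x0 + t * g x0) x) =
    (fun x => s * 'D_e f x + t * 'D_e g x).
  apply/funext => x.
  have -> : (fun x0 => s * f x0 + t * g x0) = (s *: f + t *: g) by [].
  rewrite deriveD; try by apply: derivableZ.
  by rewrite !deriveZ.
exact: IHn.
Qed.

Lemma smooth_lin c f g : smooth f -> smooth g -> smooth (c *: f + g).
Proof.
move=> sf sg n; have [rf jf] := sf n; have [rg jg] := sg n; split.
  have -> : (fun x => complex.Re ((c *: f + g) x)) = fun x =>
      1 * (complex.Re c * complex.Re (f x) + (- complex.Im c) * complex.Im (f x))
        + 1 * complex.Re (g x).
    by apply/funext => x; rewrite (Re_lin c (f x) (g x)); ring.
  by apply: Ck_lin => //; exact: Ck_lin.
have -> : (fun x => complex.Im ((c *: f + g) x)) = fun x =>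
    1 * (complex.Re c * complex.Im (f x) + complex.Im c * complex.Re (f x))
      + 1 * complex.Im (g x).
  by apply/funext => x; rewrite (Im_lin c (f x) (g x)); ring.
by apply: Ck_lin => //; exact: Ck_lin.
Qed.

Lemma derive_lin3 (s t : R) (f g h : plane R -> R) (x e : plane R) :
  derivable f x e -> derivable g x e -> derivable h x e ->
  'D_e ((s *: f + t *: g) + h) x = s * 'D_e f x + t * 'D_e g x + 'D_e h x.
Proof.
move=> df dg dh.
have dsf := @derivableZ _ _ _ f s x e df.
have dtg := @derivableZ _ _ _ g t x e dg.
have dD := derivableD dsf dtg.
by rewrite (deriveD dD dh) (deriveD dsf dtg) (deriveZ s df) (deriveZ t dg).
Qed.

Lemma cpartial_lin e c f g : e = e1 R \/ e = e2 R -> smooth f -> smooth g ->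
  cpartial e (c *: f + g) = c *: cpartial e f + cpartial e g.
Proof.
move=> he sf sg; apply/funext => x.
have [[_ /(_ e he)[rf _]] [_ /(_ e he)[jf _]]] := sf 1%N.
have [[_ /(_ e he)[rg _]] [_ /(_ e he)[jg _]]] := sg 1%N.
rewrite /cpartial /=.
have -> : (fun z => complex.Re ((c *: f + g) z)) =
  (complex.Re c *: (fun z => complex.Re (f z))
   + (- complex.Im c) *: (fun z => complex.Im (f z)))
   + (fun z => complex.Re (g z)).
  by apply/funext => z; rewrite (Re_lin c (f z) (g z)) -mulNr.
have -> : (fun z => complex.Im ((c *: f + g) z)) =
  (complex.Re c *: (fun z => complex.Im (f z))
   + complex.Im c *: (fun z => complex.Re (f z)))
   + (fun z => complex.Im (g z)).
  by apply/funext => z; rewrite (Im_lin c (f z) (g z)).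
rewrite (derive_lin3 _ _ (rf x) (jf x) (rg x)) (derive_lin3 _ _ (jf x) (rf x) (jg x)).
by apply/eqP; rewrite eq_complex Re_lin Im_lin /= mulNr !eqxx.
Qed.

Lemma jet_of_lin c f g : smooth f -> smooth g ->
  jet_of (c *: f + g) = c *: jet_of f + jet_of g.
Proof.
move=> sf sg; rewrite /jet_of !cpartial_lin //; first by right.
by left.
Qed.

Lemma periodic_lin a b c f g : periodic a b f -> periodic a b g ->
  periodic a b (c *: f + g).
Proof.
move=> pf pg x; have [fa fb] := pf x; have [ga gb] := pg x.
have E z : (c *: f + g) z = c * f z + g z by [].
by rewrite !E fa fb ga gb.
Qed.

End SmoothLinear.

Section SquareNorm.
Variable R : realType.
Implicit Types (z w c : R[i]).

Lemma sqmod_ge0 z : 0 <= sqmod z.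
Proof. by rewrite addr_ge0 // sqr_ge0. Qed.

Lemma sqmodM z w : sqmod (z * w) = sqmod z * sqmod w.
Proof. by case: z => ? ?; case: w => ? ?; rewrite /sqmod /=; ring. Qed.

Lemma sqmod_young (t : R) z w : 0 < t < 1 ->
  sqmod (z + w) <= t^-1 * sqmod z + (1 - t)^-1 * sqmod w.
Proof.
case: z => x y; case: w => u v /andP[t0 t1]; rewrite /sqmod /=.
have s0 : 0 < 1 - t by rewrite subr_gt0.
have key (p q : R) : (p + q) ^+ 2 <= t^-1 * p ^+ 2 + (1 - t)^-1 * q ^+ 2.
  rewrite -subr_ge0.
  have -> : t^-1 * p ^+ 2 + (1 - t)^-1 * q ^+ 2 - (p + q) ^+ 2 =
     ((1 - t) * p - t * q) ^+ 2 / (t * (1 - t)).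
    by field; rewrite !gt_eqF.
  by rewrite divr_ge0 ?sqr_ge0 ?mulr_ge0 // ltW.
by have := lerD (key x u) (key y v); rewrite !mulrDr addrACA.
Qed.

Variables a b : plane R.
Local Notation Om := (wigner_seitz a b).
Implicit Types (U V : jet R).

Definition jmeasurable (U : jet R) : Prop :=
  [/\ cmeasurable Om U.1.1, cmeasurable Om U.1.2 & cmeasurable Om U.2].

Lemma cmeasurable_lin c (f g : plane R -> R[i]) :
  cmeasurable Om f -> cmeasurable Om g -> cmeasurable Om (c *: f + g).
Proof.
move=> [rf jf] [rg jg]; split.
  rewrite (_ : (fun x => _) = (fun x =>
      (complex.Re c * complex.Re (f x) - complex.Im c * complex.Im (f x))
        + complex.Re (g x))); last first.
    by apply/funext => x; rewrite (Re_lin c (f x) (g x)).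
  by apply: measurable_funD => //; apply: measurable_funB; apply: measurable_funM.
rewrite (_ : (fun x => _) = (fun x =>
      (complex.Re c * complex.Im (f x) + complex.Im c * complex.Re (f x))
        + complex.Im (g x))); last first.
  by apply/funext => x; rewrite (Im_lin c (f x) (g x)).
by apply: measurable_funD => //; apply: measurable_funD; apply: measurable_funM.
Qed.

Lemma jmeasurable_lin c U V : jmeasurable U -> jmeasurable V ->
  jmeasurable (c *: U + V).
Proof. by move=> [? ? ?] [? ? ?]; split; exact: cmeasurable_lin. Qed.

Lemma measurable_sqmod (f : plane R -> R[i]) : cmeasurable Om f ->
  measurable_fun Om (fun x => sqmod (f x)).
Proof. by move=> [? ?]; apply: measurable_funD; apply: measurable_funX. Qed.

Lemma measurable_jet_sqmod U : jmeasurable U -> measurable_fun Om (jet_sqmod U).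
Proof.
move=> [? ? ?]; apply: measurable_funD; last exact: measurable_sqmod.
by apply: measurable_funD; exact: measurable_sqmod.
Qed.

Lemma jet_sqmod_ge0 U x : 0 <= jet_sqmod U x.
Proof.
exact: (addr_ge0 (addr_ge0 (sqmod_ge0 _) (sqmod_ge0 _)) (sqmod_ge0 _)).
Qed.

Lemma jet_sqnorm_ge0 U : (0 <= jet_sqnorm a b U)%E.
Proof. by apply: integral_ge0 => x _; rewrite lee_fin jet_sqmod_ge0. Qed.

Lemma jet_sqnormZ c U : jmeasurable U ->
  jet_sqnorm a b (c *: U) = ((sqmod c)%:E * jet_sqnorm a b U)%E.
Proof.
move=> mU; rewrite /jet_sqnorm -ge0_integralZl_EFin ?sqmod_ge0 //.
- by apply: eq_integral => x _; rewrite -EFinM /jet_sqmod /= !sqmodM !mulrDr.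
- exact: measurable_wigner_seitz.
- by move=> x _; rewrite lee_fin jet_sqmod_ge0.
- by apply/measurable_EFinP; exact: measurable_jet_sqmod.
Qed.

Lemma jet_sqnorm_young (t : R) U V : jmeasurable U -> jmeasurable V ->
  0 < t < 1 ->
  (jet_sqnorm a b (U + V)%R <=
   (t^-1)%:E * jet_sqnorm a b U + ((1 - t)^-1)%:E * jet_sqnorm a b V)%E.
Proof.
move=> mU mV t01; have /andP[t0 t1] := t01.
have mOm := measurable_wigner_seitz a b.
have T0 : 0 <= t^-1 by rewrite invr_ge0 ltW.
have S0 : 0 <= (1 - t)^-1 by rewrite invr_ge0 subr_ge0 ltW.
have mJ W : jmeasurable W -> measurable_fun Om (EFin \o jet_sqmod W).
  by move=> mW; apply/measurable_EFinP; exact: measurable_jet_sqmod.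
have J0 (W : jet R) (x : plane R) : (0 <= (jet_sqmod W x)%:E)%E.
  by rewrite lee_fin; exact: jet_sqmod_ge0.
rewrite /jet_sqnorm -!ge0_integralZl_EFin //; [|exact: mJ|exact: mJ].
rewrite -ge0_integralD //; first last.
- by apply: measurable_funeM; exact: mJ.
- by move=> x _; rewrite mule_ge0.
- by apply: measurable_funeM; exact: mJ.
- by move=> x _; rewrite mule_ge0.
apply: ge0_le_integral => //.
- by apply: mJ; rewrite -[U]scale1r; exact: jmeasurable_lin.
- by apply: emeasurable_funD; apply: measurable_funeM; exact: mJ.
move=> x _; rewrite -!EFinM -EFinD lee_fin /jet_sqmod /=.
have h f g := sqmod_young f g t01.
apply: le_trans (lerD (lerD (h _ _) (h _ _)) (h _ _)) _.
by rewrite le_eqVlt; apply/orP; left; apply/eqP; ring.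
Qed.

Lemma jmeasurable_jet_of (f : plane R -> R[i]) : smooth f ->
  jmeasurable (jet_of f).
Proof.
move=> sf.
have m0 (g : plane R -> R) : continuous g -> measurable_fun Om g.
  by move=> cg; apply: measurable_funTS; exact: continuous_plane_measurable.
have [[cr dr] [ci di]] := sf 1%N.
split; split; apply: m0 => //=.
- by have [_ []] := dr (e1 R) (or_introl erefl).
- by have [_ []] := di (e1 R) (or_introl erefl).
- by have [_ []] := dr (e2 R) (or_intror erefl).
- by have [_ []] := di (e2 R) (or_intror erefl).
Qed.

Lemma jet_of0 : jet_of (0 : plane R -> R[i]) = 0.
Proof.
have d0 e : cpartial e (0 : plane R -> R[i]) = 0.
  have -> : cpartial e (0 : plane R -> R[i]) = fun x =>
      ('D_e (cst 0 : plane R -> R) x) +i* ('D_e (cst 0 : plane R -> R) x) by [].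
  by apply/funext => x; rewrite derive_cst.
by rewrite /jet_of !d0.
Qed.

Lemma smooth0 : smooth (0 : plane R -> R[i]).
Proof.
suff h n : Ck n (cst 0 : plane R -> R) by [].
elim: n => [|n IHn] /=; first by split=> // x; exact: cvg_cst.
split=> [x|e _]; first exact: cvg_cst.
split=> [x|]; first exact: derivable_cst.
by rewrite (_ : (fun x => _) = cst 0) //; apply/funext => x; rewrite derive_cst.
Qed.

Lemma jet_sqnorm0 : jet_sqnorm a b 0 = 0%E.
Proof.
rewrite /jet_sqnorm (eq_integral (cst 0%E)) ?integral0 // => x _ /=.
by rewrite /jet_sqmod /sqmod /= !expr0n /= !addr0.
Qed.

Lemma is_H1per_submod : submod_closed [pred U | `[< is_H1per a b U >]].
Proof.
split.
  apply/asboolP; split.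
  - by split; exact: measurable_cst.
  - by split; exact: measurable_cst.
  - by split; exact: measurable_cst.
  - by rewrite jet_sqnorm0 ltry.
  move=> eps eps0; exists 0; split=> //; first exact: smooth0.
  by rewrite jet_of0 subr0 jet_sqnorm0 lte_fin.
move=> c U V /asboolP[U1 U2 U3 Uf Ua] /asboolP[V1 V2 V3 Vf Va].
have mU : jmeasurable U by [].
have mV : jmeasurable V by [].
have mcU : jmeasurable (c *: U).
  rewrite -[c *: U]addr0; apply: jmeasurable_lin => //.
have h01 : 0 < (2^-1 : R) < 1 by lra.
have [m1 m2 m3] := jmeasurable_lin c mU mV.
rewrite inE; split=> //.
  apply: le_lt_trans (jet_sqnorm_young mcU mV h01) _.
  rewrite jet_sqnormZ //.
  move: Uf Vf (jet_sqnorm_ge0 U) (jet_sqnorm_ge0 V).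
  case: (jet_sqnorm a b U) => [p| |] // _; case: (jet_sqnorm a b V) => [q| |] // _ _ _.
  by rewrite -!EFinM -EFinD ltry.
move=> eps eps0.
have d0 : 0 < eps / (4 * (sqmod c + 1)).
  by rewrite divr_gt0 // mulr_gt0 // ltr_wpDl ?sqmod_ge0.
have [f [sf pf fU]] := Ua _ d0.
have e40 : 0 < eps / 4 by rewrite divr_gt0.
have [g [sg pg gV]] := Va _ e40.
exists (c *: f + g); split; [exact: smooth_lin|exact: periodic_lin|].
rewrite jet_of_lin // opprD addrACA -scalerBr.
have mdiff W h : jmeasurable W -> smooth h -> jmeasurable (W - jet_of h).
  move=> mW sh; rewrite addrC -scaleN1r; apply: jmeasurable_lin => //.
  exact: jmeasurable_jet_of.
have mUf := mdiff _ _ mU sf; have mVg := mdiff _ _ mV sg.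
have mcUf : jmeasurable (c *: (U - jet_of f)).
  rewrite -[c *: _]addr0; apply: jmeasurable_lin => //.
apply: le_lt_trans (jet_sqnorm_young mcUf mVg h01) _.
rewrite jet_sqnormZ //.
move: fU gV (jet_sqnorm_ge0 (U - jet_of f)) (jet_sqnorm_ge0 (V - jet_of g)).
case: (jet_sqnorm a b (U - jet_of f)) => [p| |] //; rewrite lte_fin => pl.
case: (jet_sqnorm a b (V - jet_of g)) => [q| |] //; rewrite lte_fin => ql.
rewrite !lee_fin => p0 q0.
rewrite -!EFinM -EFinD lte_fin.
have : sqmod c * p <= eps / 4.
  have s0 := sqmod_ge0 c.
  have : (sqmod c + 1) * p <= eps / 4.
    rewrite mulrC -ler_pdivlMr; last by lra.
    by rewrite (le_trans (ltW pl)) // -mulrA invfM mulrA.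
  by rewrite mulrDl mul1r => h; apply: le_trans h; rewrite lerDl.
have h2 : (1 - 2^-1 : R)^-1 = 2 by field.
by rewrite invrK h2 => h; lra.
Qed.

End SquareNorm.

Section H1per.
Variables (R : realType) (a b : plane R).

Definition H1per_pred : {pred jet R} := [pred U | `[< is_H1per a b U >]].

HB.instance Definition _ :=
  GRing.isSubmodClosed.Build _ _ H1per_pred (is_H1per_submod a b).

Record preH1 := PreH1 { pre_jet :> jet R ; _ : pre_jet \in H1per_pred }.

HB.instance Definition _ := [isSub for pre_jet].
HB.instance Definition _ := [Choice of preH1 by <:].
HB.instance Definition _ := [SubChoice_isSubLmodule of preH1 by <:].

Definition preH1_norm (U : preH1) : R := Num.sqrt (fine (jet_sqnorm a b U)).

Implicit Types U V W : preH1.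

Lemma preH1P U : is_H1per a b U.
Proof. by case: U => U /= /asboolP. Qed.

Lemma preH1_measurable U : jmeasurable a b U.
Proof. by have [] := preH1P U. Qed.

Lemma preH1_fin U : jet_sqnorm a b U = (fine (jet_sqnorm a b U))%:E.
Proof.
have [_ _ _ Ufin _] := preH1P U.
by rewrite fineK // ge0_fin_numE // jet_sqnorm_ge0.
Qed.

Lemma preH1_norm_ge0 U : 0 <= preH1_norm U.
Proof. exact: sqrtr_ge0. Qed.

Lemma sqr_preH1_norm U : preH1_norm U ^+ 2 = fine (jet_sqnorm a b U).
Proof. by rewrite sqr_sqrtr // fine_ge0 // jet_sqnorm_ge0. Qed.

Lemma preH1_normZ (c : R[i]) U :
  preH1_norm (c *: U) = Num.sqrt (sqmod c) * preH1_norm U.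
Proof.
rewrite /preH1_norm -sqrtrM ?sqmod_ge0 //; congr Num.sqrt.
have -> : pre_jet (c *: U) = c *: pre_jet U by [].
rewrite jet_sqnormZ; last exact: preH1_measurable.
by rewrite preH1_fin -EFinM.
Qed.

Lemma preH1_normN U : preH1_norm (- U) = preH1_norm U.
Proof.
by rewrite -scaleN1r preH1_normZ /sqmod /= oppr0 expr0n addr0 sqrrN expr1n sqrtr1 mul1r.
Qed.

Lemma preH1_norm0 : preH1_norm 0 = 0.
Proof. by rewrite -(scale0r 0) preH1_normZ /sqmod /= expr0n addr0 sqrtr0 mul0r. Qed.

Lemma ler_preH1_normD U V :
  preH1_norm (U + V) <= preH1_norm U + preH1_norm V.
Proof.
have := preH1_norm_ge0 U; have := preH1_norm_ge0 V.
move: (preH1_norm U) (preH1_norm V) (sqr_preH1_norm U) (sqr_preH1_norm V).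
move=> p q pE qE q0 p0.
have young t : 0 < t < 1 ->
    preH1_norm (U + V) ^+ 2 <= t^-1 * p ^+ 2 + (1 - t)^-1 * q ^+ 2.
  move=> t01; have := jet_sqnorm_young (preH1_measurable U) (preH1_measurable V) t01.
  have -> : (pre_jet U + pre_jet V)%R = pre_jet (U + V)%R by [].
  rewrite preH1_fin (preH1_fin U) (preH1_fin V) -!EFinM -EFinD lee_fin.
  by rewrite -pE -qE -sqr_preH1_norm.
rewrite -(@ler_pXn2r _ 2) ?nnegrE ?preH1_norm_ge0 ?addr_ge0 //.
apply/ler_addgt0Pr => e e0.
have [d d0 dE] : exists2 d, 0 < d & (p + q) * (2 * d) <= e.
  exists (e / (2 * (p + q + 1))); first by rewrite divr_gt0 // mulr_gt0 //; lra.
  have -> : (p + q) * (2 * (e / (2 * (p + q + 1)))) = e * ((p + q) / (p + q + 1)).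
    by field; rewrite gt_eqF //; lra.
  by rewrite ger_pMr // ler_pdivrMr; lra.
pose S := p + q + 2 * d.
have S0 : 0 < S by rewrite /S; lra.
have t01 : 0 < (p + d) / S < 1.
  by rewrite divr_gt0 ?ltr_pdivrMr //= /S; lra.
apply: le_trans (young _ t01) _.
have -> : 1 - (p + d) / S = (q + d) / S.
  by rewrite /S; field; rewrite gt_eqF.
rewrite !invf_div.
have h (x : R) : 0 <= x -> S / (x + d) * x ^+ 2 <= S * x.
  move=> x0; rewrite mulrAC -mulrA ler_pM2l // -mulrA ler_piMr //.
  by rewrite ler_pdivrMr; lra.
have := lerD (h _ p0) (h _ q0).
move=> /le_trans; apply.
by rewrite -mulrDr {1}/S expr2; lra.
Qed.

Lemma preH1_distC U V : preH1_norm (U - V) = preH1_norm (V - U).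
Proof. by rewrite -preH1_normN opprB. Qed.

Lemma preH1_dist_triangle V U W :
  preH1_norm (U - W) <= preH1_norm (U - V) + preH1_norm (V - W).
Proof. by rewrite -(subrKA V); exact: ler_preH1_normD. Qed.

(* A null H^1 distance amounts to almost-everywhere equality on Omega. *)
Definition preH1_eq U V : bool := preH1_norm (U - V) == 0.

Lemma preH1_eq_refl : reflexive preH1_eq.
Proof. by move=> U; rewrite /preH1_eq subrr preH1_norm0. Qed.

Lemma preH1_eq_sym : symmetric preH1_eq.
Proof. by move=> U V; rewrite /preH1_eq preH1_distC. Qed.

Lemma preH1_eq_trans : transitive preH1_eq.
Proof.
move=> V U W /eqP UV /eqP VW; rewrite /preH1_eq eq_le preH1_norm_ge0 andbT.
by rewrite (le_trans (preH1_dist_triangle V U W)) // UV VW addr0.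
Qed.

Canonical preH1_equiv := EquivRel preH1_eq preH1_eq_refl preH1_eq_sym preH1_eq_trans.

Definition H1per : Type := {eq_quot preH1_eq}.
HB.instance Definition _ := Choice.on H1per.
HB.instance Definition _ := EqQuotient.on H1per.

Local Notation cls := (\pi_H1per).

Lemma H1perP U V : (cls U = cls V) <-> preH1_norm (U - V) = 0.
Proof.
split; first by move/eqmodP => /eqP.
by move=> h; apply/eqmodP/eqP.
Qed.

Lemma repr_cls U : preH1_norm (repr (cls U) - U) = 0.
Proof. by apply/H1perP; rewrite reprK. Qed.

Definition H1add (u v : H1per) : H1per := cls (repr u + repr v).
Definition H1opp (u : H1per) : H1per := cls (- repr u).
Definition H1scale (c : R[i]) (u : H1per) : H1per := cls (c *: repr u).
Definition H1norm (u : H1per) : R := preH1_norm (repr u).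

Lemma preH1_norm_eq U V : preH1_norm (U - V) = 0 -> preH1_norm U = preH1_norm V.
Proof.
move=> h; apply/le_anti/andP; split.
  by have := ler_preH1_normD (U - V) V; rewrite subrK h add0r.
by have := ler_preH1_normD (V - U) U; rewrite subrK preH1_distC h add0r.
Qed.

Lemma H1addE U V : H1add (cls U) (cls V) = cls (U + V).
Proof.
apply/H1perP/le_anti; rewrite preH1_norm_ge0 andbT opprD addrACA.
by rewrite (le_trans (ler_preH1_normD _ _)) // !repr_cls addr0.
Qed.

Lemma H1oppE U : H1opp (cls U) = cls (- U).
Proof. by apply/H1perP; rewrite -opprD preH1_normN; exact: repr_cls. Qed.

Lemma H1scaleE c U : H1scale c (cls U) = cls (c *: U).
Proof. by apply/H1perP; rewrite -scalerBr preH1_normZ repr_cls mulr0. Qed.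

Lemma H1normE U : H1norm (cls U) = preH1_norm U.
Proof. by apply: preH1_norm_eq; exact: repr_cls. Qed.

Lemma clsP (P : H1per -> Prop) : (forall U, P (cls U)) -> forall u, P u.
Proof. by move=> h u; rewrite -[u]reprK. Qed.

Lemma H1addA : associative H1add.
Proof. by elim/clsP => U; elim/clsP => V; elim/clsP => W; rewrite !H1addE addrA. Qed.
Lemma H1addC : commutative H1add.
Proof. by elim/clsP => U; elim/clsP => V; rewrite !H1addE addrC. Qed.
Lemma H1add0 : left_id (cls 0) H1add.
Proof. by elim/clsP => U; rewrite H1addE add0r. Qed.
Lemma H1addN : left_inverse (cls 0) H1opp H1add.
Proof. by elim/clsP => U; rewrite H1oppE H1addE addNr. Qed.

HB.instance Definition _ := GRing.isZmodule.Build H1per H1addA H1addC H1add0 H1addN.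

Lemma H1scaleA c d u : H1scale c (H1scale d u) = H1scale (c * d) u.
Proof. by elim/clsP: u => U; rewrite !H1scaleE scalerA. Qed.
Lemma H1scale1 : left_id 1 H1scale.
Proof. by elim/clsP => U; rewrite H1scaleE scale1r. Qed.
Lemma H1scaleDr : right_distributive H1scale +%R.
Proof. 
move=> c; elim/clsP => U; elim/clsP => V.
rewrite -[cls U + cls V]/(H1add _ _) -[RHS]/(H1add _ _) H1addE !H1scaleE.
by rewrite H1addE -scalerDr.
Qed.
Lemma H1scaleDl u : {morph H1scale^~ u : c d / c + d}.
Proof. by elim/clsP: u => U c d; rewrite -[RHS]/(H1add _ _) !H1scaleE H1addE scalerDl. Qed.

HB.instance Definition _ := GRing.Zmodule_isLmodule.Build R[i] H1per
  H1scaleA H1scale1 H1scaleDr H1scaleDl.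

Lemma ler_H1normD u v : (H1norm (u + v)%R)%:C <= (H1norm u)%:C + (H1norm v)%:C.
Proof.
elim/clsP: u => U; elim/clsP: v => V.
rewrite -[cls U + cls V]/(H1add _ _) H1addE !H1normE -rmorphD /= lecR.
exact: ler_preH1_normD.
Qed.

Lemma H1normZ (c : R[i]) u : (H1norm (c *: u))%:C = `|c| * (H1norm u)%:C.
Proof.
elim/clsP: u => U; rewrite -[c *: cls U]/(H1scale _ _) H1scaleE !H1normE.
by rewrite preH1_normZ normc_def -rmorphM.
Qed.

Lemma H1norm_eq0 u : (H1norm u)%:C = 0 -> u = 0.
Proof.
elim/clsP: u => U [] ; rewrite H1normE => h.
by apply/H1perP; rewrite subr0.
Qed.

(* As [H1per] is a module over [R[i]], its library norm [`|u|] is the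
   complex number [(H1norm u)%:C]. *)
HB.instance Definition _ := Lmodule_isNormed.Build R[i] H1per
  ler_H1normD H1normZ H1norm_eq0.

End H1per.

Section Forms.
Variables (R : realType) (a b : plane R).
Local Notation Om := (wigner_seitz a b).
Local Notation V := (H1per a b).

(* The function and its partial derivatives, on a representative of the class. *)
Definition fn (u : V) : plane R -> R[i] := (pre_jet (repr u)).1.1.
Definition dx1 (u : V) : plane R -> R[i] := (pre_jet (repr u)).1.2.
Definition dx2 (u : V) : plane R -> R[i] := (pre_jet (repr u)).2.

Definition cintegral (f : plane R -> R[i]) : R[i] :=
  (\int[@leb2 R]_(x in Om) complex.Re (f x)) +i*
  (\int[@leb2 R]_(x in Om) complex.Im (f x)).

Definition L2dot (u v : V) : R[i] := cintegral (fun x => fn u x * (fn v x)^*).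

Definition P_ (y u : V) : R[i] := L2dot u y.

Definition grad_k1 (k : plane R) (u : V) : plane R -> R[i] :=
  fun x => dx1 u x + 'i * k.1%:C * fn u x.
Definition grad_k2 (k : plane R) (u : V) : plane R -> R[i] :=
  fun x => dx2 u x + 'i * k.2%:C * fn u x.

(* An operator F : V -> V^* is represented by F u v = <F u, v>; V^* consists
   of antilinear functionals. *)
Definition opA (k : plane R) (u v : V) : R[i] :=
  cintegral (fun x => grad_k1 k u x * (grad_k1 k v x)^*
                    + grad_k2 k u x * (grad_k2 k v x)^*).

Definition opB (alpha1 : R) (eps2 : R -> R) (Om1 Om2 : set (plane R))
    (w : R) (u v : V) : R[i] :=
  (w ^+ 2)%:C *
  cintegral (fun x => (alpha1 * \1_Om1 x + eps2 w * \1_Om2 x)%:C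
                      * fn u x * (fn v x)^*).

End Forms.

Section OperatorFunctions.
Variables (R : realType) (V : normedModType R[i]).
Implicit Types (A : V -> V -> R[i]) (F : R[i] -> V -> V -> R[i]) (D : set R[i]).

Definition antilinear (f : V -> R[i]) : Prop :=
  forall c v w, f (c *: v + w) = c^* * f v + f w.

Definition in_dual (f : V -> R[i]) : Prop :=
  antilinear f /\ exists M : R, forall v, `|f v| <= M%:C * `|v|.

Definition bounded_op A : Prop :=
  [/\ forall c u w v, A (c *: u + w) v = c * A u v + A w v,
      forall u, antilinear (A u) &
      exists M : R, forall u v, `|A u v| <= M%:C * `|u| * `|v| ].

Definition op_ker A : set V := [set u | forall v, A u v = 0].

(* Bijective onto the dual with bounded inverse: the premise on K says that
   the dual norm of A u is at most K. *)
Definition op_invertible A : Prop :=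
  (forall f, in_dual f -> exists! u, A u = f) /\
  exists M : R, forall (u : V) (K : R), 0 <= K ->
    (forall v, `|A u v| <= K%:C * `|v|) -> `|u| <= (M * K)%:C.

(* Total inverse; the value 0 is only used where f has no preimage. *)
Definition op_inv A (f : V -> R[i]) : V := xget 0 [set u | A u = f].

(* Complex derivative for the operator norm of L(V, V^* ). *)
Definition op_derive F (z : R[i]) A : Prop :=
  bounded_op A /\
  forall e : R, 0 < e -> \forall h \near (0 : R[i]), forall u v,
    `|F (z + h) u v - F z u v - h * A u v| <= e%:C * `|h| * `|u| * `|v|.

Definition holomorphic_op D F : Prop :=
  (forall z, D z -> bounded_op (F z)) /\
  (forall z, D z -> exists A, op_derive F z A).

Definition self_adjoint D F : Prop :=
  forall z, D z -> forall u v, F z^* u v = (F z v u)^*.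

Definition spectrum D F : set R[i] := [set z | D z /\ ~ op_invertible (F z)].

Definition eigenvalue_op D F : set R[i] :=
  [set z | D z /\ exists2 u, u != 0 & op_ker (F z) u].

Definition isolated_in (X : set R[i]) (z : R[i]) : Prop :=
  exists2 r : R, 0 < r & forall z', X z' -> `|z' - z| < r%:C -> z' = z.

Definition finite_dim (K : set V) : Prop :=
  exists n (e : 'I_n -> V), forall u, K u ->
    exists c : 'I_n -> R[i], u = \sum_(i < n) c i *: e i.

Definition discrete_spectrum D F : Prop :=
  forall z, spectrum D F z ->
    [/\ eigenvalue_op D F z, isolated_in (spectrum D F) z &
        finite_dim (op_ker (F z))].

Definition geometric_multiplicity_one F (z : R[i]) : Prop :=
  exists2 u, u != 0 & op_ker (F z) = [set c *: u | c in [set: R[i]]].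

(* x 0, ..., x (m-1) is a Jordan chain of F at z:
   sum_(l <= j) F^(l)(z) x_(j-l) / l! = 0 for all j < m, and x 0 <> 0.
   [dF l] is the l-th derivative of F on D. *)
Definition jordan_chain D F (z : R[i]) (m : nat) (x : nat -> V) : Prop :=
  [/\ (0 < m)%N, x 0%N != 0 &
      exists dF : nat -> R[i] -> V -> V -> R[i],
      [/\ dF 0%N = F,
          forall l, (l.+1 < m)%N -> forall z', D z' ->
            op_derive (dF l) z' (dF l.+1 z') &
          forall j, (j < m)%N -> forall v,
            \sum_(l < j.+1) (l`!%:R)^-1 * dF l z (x (j - l)%N) v = 0]].

Definition algebraic_multiplicity_one D F (z : R[i]) : Prop :=
  forall m x, jordan_chain D F z m x -> m = 1%N.

End OperatorFunctions.

Section Newton.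
Variables (R : realType) (a b : plane R).
Local Notation V := (H1per a b).

(* [`|w|] is itself a complex number, hence the real part. *)
Definition W_norm (u : V) (w : R[i]) : R :=
  Num.sqrt (H1norm u ^+ 2 + complex.Re (`|w| ^+ 2)).

Definition newton_system (T T' : R[i] -> V -> V -> R[i]) (y : V)
    (u : V) (w : R[i]) (s : V) (nu : R[i]) : Prop :=
  (forall v, T w s v + nu * T' w u v = - T w u v) /\ P_ y s = 0.

Definition converges_quadratically (u : nat -> V) (w : nat -> R[i])
    (ulim : V) (wlim : R[i]) : Prop :=
  W_norm (u j - ulim) (w j - wlim) @[j --> \oo] --> (0 : R) /\
  exists C : R, forall j,
    W_norm (u j.+1 - ulim) (w j.+1 - wlim)
      <= C * W_norm (u j - ulim) (w j - wlim) ^+ 2.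

End Newton.

Definition real_analytic (R : realType) (S : set R) (f : R -> R) : Prop :=
  forall x, S x -> exists c : nat -> R,
    \forall h \near (0 : R), pseries c h @ \oo --> f (x + h).

(* Main.v *)
Require Import Defs.
From HB Require Import structures.
From mathcomp Require Import all_boot all_order all_algebra.
From mathcomp Require Import generic_quotient complex.
From mathcomp Require Import all_classical all_reals all_analysis.
From mathcomp Require Import measurable_realfun ring lra.

Set Implicit Arguments.
Unset Strict Implicit.
Unset Printing Implicit Defensive.
Import Order.TTheory GRing.Theory Num.Theory.
Import numFieldNormedType.Exports.
Local Open Scope classical_set_scope.
Local Open Scope ring_scope.
Local Open Scope complex_scope.

(* Write J(u, w) for the bordered operator of the Newton step. A step maps the
   error x_j to x_{j+1} with J x_{j+1} = Taylor remainder, so the theorem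
   reduces to two facts near the eigenpair (us, ws).

   (i) The remainder is quadratic, uniformly in operator norm. This follows from
   the Cauchy estimate |f'(a)| <= 2 M / r for a complex differentiable f with
   |f| <= M on a disc of radius r, applied to w |-> T(w) u v and to its
   differences. The estimate itself is Goursat's theorem for the form
   f(z) dz / (z - a) in logarithmic polar coordinates a + exp(s + i t), where
   circles become the sides of rectangles.

   (ii) J is bounded below. In T(ws) - T(w1), with w1 in S close to ws and T(w1)
   invertible, the form A cancels and what remains is bounded in L2. By the
   Poincare inequality on the convex pieces that a grid cuts out of the convex
   cell, the L2 norm is at most a small multiple of the H1 norm plus finitely
   many functionals. These are removed one at a time by a completeness argument,
   which uses that J(us, ws) is injective (multiplicity one). V is complete since
   T(w1) identifies it with its dual, so no Riesz-Fischer theorem is needed.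

   Solvability of a step at w = ws is explicit, by (s, nu) = (us - u, 0); at
   w <> ws it comes from the invertibility of T(w) and the injectivity of J. *)

(** * Complex differentiation and the Cauchy estimate *)

(** Fact (i) cannot be read off Taylor's formula: [T'] is given point by point, and neither its
    continuity nor a second derivative is among the data, so bounds uniform in the arguments must
    come from holomorphy alone. They do, because the Cauchy estimate is linear in M, and M is here a
    multiple of |u| |v|: scalar estimates become operator-norm estimates. For (ii) the classical
    road is Fredholm theory: J is a compact perturbation of an invertible operator, so injectivity
    implies invertibility. Here compactness takes the form of an inequality, L2 norm at most e times
    the H1 norm plus finitely many functionals, and only a lower bound is drawn from it. A lower
    bound is stable under small changes of (u, w), so it holds at every iterate with one constant;
    it yields uniqueness of the step, the error estimate and, off the eigenvalue, the nonvanishing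
    of the denominator in an explicit solution. The auxiliary w1 is needed because T(ws) itself is
    not invertible: isolation of the spectrum supplies w1, and the bounded inverse of T(w1) plays
    the part that coercivity plays for elliptic forms. *)

Section ComplexModulus.
Variable R : realType.
Implicit Types z w : R[i].

Local Notation normc := (@Normc.normc R).

Lemma normcE z : `|z| = (normc z)%:C.
Proof. by []. Qed.

Lemma normc_ge0 z : 0 <= normc z.
Proof. by case: z => x y; exact: sqrtr_ge0. Qed.

Lemma normcD z w : normc (z + w) <= normc z + normc w.
Proof. by rewrite -lecR rmorphD /= -!normcE ler_normD. Qed.

Lemma normcN z : normc (- z) = normc z.
Proof. by apply: complexI; rewrite -!normcE normrN. Qed.

Lemma normc_distC z w : normc (z - w) = normc (w - z).
Proof. by rewrite -normcN opprB. Qed.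

Lemma normc_real (x : R) : normc x%:C = `|x|.
Proof. by rewrite /= expr0n addr0 sqrtr_sqr. Qed.

Lemma normc_Re z : `|complex.Re z| <= normc z.
Proof.
case: z => x y /=; rewrite -sqrtr_sqr ler_wsqrtr //.
by rewrite lerDl sqr_ge0.
Qed.

Lemma normc_Im z : `|complex.Im z| <= normc z.
Proof.
case: z => x y /=; rewrite -sqrtr_sqr ler_wsqrtr //.
by rewrite lerDr sqr_ge0.
Qed.

Lemma normc_le_sum z : normc z <= `|complex.Re z| + `|complex.Im z|.
Proof.
case: z => x y; have -> : x +i* y = x%:C + (0 +i* y).
  by apply/eqP; rewrite eq_complex /= add0r addr0 !eqxx.
apply: le_trans (normcD _ _) _; rewrite normc_real /=.
by rewrite expr0n add0r sqrtr_sqr addr0 add0r.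
Qed.

Lemma normc_gt0 z : (0 < normc z) = (z != 0).
Proof. by rewrite -ltcR -normcE normr_gt0. Qed.

(** A unimodular factor makes the modulus a real part: estimates obtained for real parts, by real
    integrals or the real mean value theorem, then hold for moduli. *)
Lemma exists_rotation z : exists2 c, normc c = 1 & c * z = (normc z)%:C.
Proof.
have [->|z0] := eqVneq z 0.
  by exists 1; rewrite ?Normc.normc1 // mulr0 Normc.normc0.
have n0 : (normc z)%:C != 0 by rewrite -normcE normr_eq0.
exists ((normc z)%:C / z); last by rewrite divfK.
rewrite Normc.normcM Normc.normcV normc_real ger0_norm ?normc_ge0 //.
by rewrite divff // gt_eqF // normc_gt0.
Qed.

End ComplexModulus.

Section ComplexDerivative.
Variable R : realType.
Implicit Types (f g : R[i] -> R[i]) (z w d : R[i]).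
Local Notation normc := (@Normc.normc R).

(** Frechet form, without a quotient: [h = 0] is no exception, and [op_derive] at fixed arguments
    has this shape. *)
Definition cderiv f z d := forall e : R, 0 < e ->
  exists2 del : R, 0 < del & forall h, normc h < del ->
    normc (f (z + h) - f z - h * d) <= e * normc h.

Lemma cderiv_cont f z d : cderiv f z d -> forall e : R, 0 < e ->
  exists2 del : R, 0 < del & forall h, normc h < del -> normc (f (z + h) - f z) <= e.
Proof.
move=> fd e e0; have [del del0 H] := fd 1 ltr01.
have nd := normc_ge0 d.
exists (Num.min del (e / (1 + normc d))).
  by rewrite lt_min del0 divr_gt0 //; lra.
move=> h; rewrite lt_min => /andP[/H hd he].
rewrite -(subrK (h * d) (f (z + h) - f z)).
apply: le_trans (normcD _ _) _; rewrite Normc.normcM.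
have -> : e = (1 + normc d) * (e / (1 + normc d)) by field; rewrite gt_eqF //; lra.
apply: le_trans (lerD hd (lexx _)) _.
by rewrite [normc h * _]mulrC -mulrDl ler_pM2l ?ltW //; lra.
Qed.

Lemma cderivM f g z d d' : cderiv f z d -> cderiv g z d' ->
  cderiv (fun w => f w * g w) z (d * g z + f z * d').
Proof.
move=> fd gd e e0.
have nd := normc_ge0 d; have nf := normc_ge0 (f z); have ng := normc_ge0 (g z).
have [d1 d10 H1] := fd (e / 3 / (normc (g z) + 1)) ltac:(rewrite !divr_gt0 //; lra).
have [d2 d20 H2] := gd (e / 3 / (normc (f z) + 1)) ltac:(rewrite !divr_gt0 //; lra).
have [d3 d30 H3] := cderiv_cont gd ltr01.
have [d4 d40 H4] := cderiv_cont gd (e := e / 3 / (normc d + 1)) ltac:(rewrite !divr_gt0 //; lra).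
exists (Num.min (Num.min d1 d2) (Num.min d3 d4)); first by rewrite !lt_min d10 d20 d30.
move=> h; rewrite !lt_min => /andP[/andP[/H1 h1 /H2 h2] /andP[/H3 h3 /H4 h4]].
have hn := normc_ge0 h.
have -> : f (z + h) * g (z + h) - f z * g z - h * (d * g z + f z * d') =
  (f (z + h) - f z - h * d) * g (z + h) + h * d * (g (z + h) - g z)
  + f z * (g (z + h) - g z - h * d') by ring.
apply: le_trans (normcD _ _) _; apply: le_trans (lerD (normcD _ _) (lexx _)) _.
rewrite !Normc.normcM.
have gb : normc (g (z + h)) <= normc (g z) + 1.
  rewrite -{1}(subrK (g z) (g (z + h))).
  by apply: le_trans (normcD _ _) _; rewrite addrC lerD2l.
have A1 := ler_pM (normc_ge0 _) (normc_ge0 _) h1 gb.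
have A2 := ler_wpM2l (mulr_ge0 hn nd) h4.
have A3 := ler_wpM2l nf h2.
have E1 : e / 3 / (normc (g z) + 1) * normc h * (normc (g z) + 1) = e / 3 * normc h.
  by field; rewrite gt_eqF //; lra.
have E2 : normc h * normc d * (e / 3 / (normc d + 1)) <= e / 3 * normc h.
  have -> : e / 3 * normc h = normc h * (normc d + 1) * (e / 3 / (normc d + 1)).
    by field; rewrite gt_eqF //; lra.
  by rewrite ler_pM2r ?divr_gt0 //; [rewrite ler_wpM2l //|]; lra.
have E3 : normc (f z) * (e / 3 / (normc (f z) + 1) * normc h) <= e / 3 * normc h.
  rewrite mulrA ler_wpM2r // mulrA ler_pdivrMr; nra.
have -> : e * normc h = e / 3 * normc h + e / 3 * normc h + e / 3 * normc h by field.
move: A1; rewrite E1 => A1.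
by apply: lerD; [apply: lerD => //|]; [exact: le_trans A2 E2|exact: le_trans A3 E3].
Qed.

Lemma cderiv_cst c z : cderiv (fun=> c) z 0.
Proof.
move=> e e0; exists 1 => // h _.
by rewrite mulr0 subr0 subrr Normc.normc0 mulr_ge0 ?normc_ge0 // ltW.
Qed.

Lemma cderivD f g z d d' : cderiv f z d -> cderiv g z d' ->
  cderiv (fun w => f w + g w) z (d + d').
Proof.
move=> fd gd e e0; have e2 : 0 < e / 2 by lra.
have [d1 d10 H1] := fd _ e2; have [d2 d20 H2] := gd _ e2.
exists (Num.min d1 d2); first by rewrite lt_min d10.
move=> h; rewrite lt_min => /andP[/H1 h1 /H2 h2].
have -> : f (z + h) + g (z + h) - (f z + g z) - h * (d + d') =
  (f (z + h) - f z - h * d) + (g (z + h) - g z - h * d') by ring.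
by apply: le_trans (normcD _ _) _; apply: le_trans (lerD h1 h2) _; lra.
Qed.

Lemma cderivZ f z d c : cderiv f z d -> cderiv (fun w => c * f w) z (c * d).
Proof. by move=> /(cderivM (cderiv_cst c z)); rewrite mul0r add0r. Qed.

Lemma cderiv_id z : cderiv id z 1.
Proof.
move=> e e0; exists 1 => // h _.
by rewrite mulr1 /= addrAC addrK subrr Normc.normc0 mulr_ge0 ?normc_ge0 // ltW.
Qed.

Lemma cderivV z : z != 0 -> cderiv (fun w => w^-1) z (- z ^- 2).
Proof.
move=> z0 e e0; have nz : 0 < normc z by rewrite normc_gt0.
exists (Num.min (normc z / 2) (e * normc z ^+ 3 / 2)).
  by rewrite lt_min !divr_gt0 // mulr_gt0 // exprn_gt0.
move=> h; rewrite lt_min => /andP[hz he].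
have zh : normc z / 2 <= normc (z + h).
  have := normcD (z + h) (- h); rewrite addrK normcN; lra.
have zh0 : z + h != 0 by rewrite -normc_gt0; lra.
have -> : (z + h)^-1 - z^-1 - h * - z ^- 2 = h * h / (z * z * (z + h)).
  by field; rewrite zh0 z0.
rewrite !Normc.normcM !Normc.normcV !Normc.normcM -mulrA [leRHS]mulrC.
rewrite ler_wpM2l ?normc_ge0 //.
rewrite ler_pdivrMr; last by rewrite !mulr_gt0 // normc_gt0.
apply: le_trans (ltW he) _.
have -> : e * normc z ^+ 3 / 2 = e * (normc z * normc z * (normc z / 2)) by rewrite !exprS; ring.
by rewrite ler_pM2l // ler_wpM2l // mulr_ge0 // ltW.
Qed.

Lemma cderiv_ext f g z d (r : R) : 0 < r ->
  (forall w, normc (w - z) < r -> f w = g w) -> cderiv f z d -> cderiv g z d.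
Proof.
move=> r0 fg fd e e0; have [del del0 H] := fd e e0.
exists (Num.min r del); first by rewrite lt_min r0.
move=> h; rewrite lt_min => /andP[hr /H].
by rewrite !fg // ?subrr ?Normc.normc0 // addrAC subrr add0r.
Qed.

End ComplexDerivative.

Section RealDerivative.
Variable R : realType.
Implicit Types (f g : R -> R) (x d : R).

Lemma is_derive1P f x d : is_derive x 1 f d <->
  forall e : R, 0 < e -> exists2 del : R, 0 < del & forall h, `|h| < del ->
    `|f (x + h) - f x - h * d| <= e * `|h|.
Proof.
have E h : h != 0 -> d - h^-1 * (f (h * 1 + x) - f x) =
    - (h^-1 * (f (x + h) - f x - h * d)).
  by move=> h0; rewrite mulr1 (addrC h) [in RHS]mulrBr mulKf // opprB.
split=> [[fx fd] e e0|H].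
  have /cvgrPdist_le /(_ e e0) : h^-1 *: (f (h *: 1 + x) - f x) @[h --> 0^'] --> d.
    by rewrite -fd; exact: fx.
  rewrite /dnbhs /within /= -nbhs_ballE => -[del /= del0 H].
  exists del => // h hd; have [->|h0] := eqVneq h 0.
    by rewrite addr0 subrr mul0r subr0 normr0 mulr0.
  have := H h; rewrite /ball /= sub0r normrN => /(_ hd h0).
  rewrite /GRing.scale /= E // normrN normrM normfV.
  by rewrite mulrC ler_pdivrMr ?normr_gt0 // .
have C : h^-1 *: (f (h *: 1 + x) - f x) @[h --> 0^'] --> d.
  apply/cvgrPdist_le => e e0; have [del del0 {}H] := H e e0.
  rewrite /dnbhs /within /= -nbhs_ballE; exists del => //= h.
  rewrite /ball /= sub0r normrN => /H hd h0.
  rewrite /GRing.scale /= E // normrN normrM normfV.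
  by rewrite mulrC ler_pdivrMr ?normr_gt0.
split; first by apply/cvg_ex; exists d.
exact/cvg_lim.
Qed.

End RealDerivative.

(** * Primitives of continuous functions on the line *)

Section Primitive.
Variable R : realType.
Implicit Types (f g : R -> R) (L a b : R).

(** The base point [L] is kept strictly to the left of every segment in use, so the derivative is
    two-sided even at a left end; an integral over a segment is a difference of two values. *)
Definition primitive L f (x : R) : R :=
  \int[@lebesgue_measure R]_(t in [set` `[L, x]]) (f t).

Lemma is_derive_primitive L f x : continuous f -> L < x ->
  is_derive x 1 (primitive L f) (f x).
Proof.
move=> cf Lx.
have xx1 : x < x + 1 by rewrite ltrDl.
have fi : (@lebesgue_measure R).-integrable `[L, x + 1] (EFin \o f).
  apply: continuous_compact_integrable; first exact: segment_compact.
  exact: continuous_subspaceT.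
have [d1 d2] := continuous_FTC1_closed xx1 fi Lx (cf x).
by rewrite -d2 derive1E; split.
Qed.

Opaque primitive.

(** The mean value theorem for the primitive minus the antiderivative of the affine function. Here
    [c] is the centre of expansion; [q = 0] serves to estimate averages over circles. *)
Lemma primitive_approx L f a b (p q c e : R) : continuous f -> L < a -> a <= b ->
  (forall x, a <= x <= b -> `|f x - (p + q * (x - c))| <= e) ->
  `|primitive L f b - primitive L f a
     - (p * (b - a) + q / 2 * ((b - c) ^+ 2 - (a - c) ^+ 2))| <= e * (b - a).
Proof.
move=> cf La ab H.
pose G x := primitive L f x - (p * x + q / 2 * (x - c) ^+ 2).
have dG x : L < x -> is_derive x 1 G (f x - (p + q * (x - c))).
  move=> Lx; have h := is_derive_primitive cf Lx.
  have h1 : is_derive x 1 (fun x : R => p * x + q / 2 * (x - c) ^+ 2) (p + q * (x - c)).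
    have hc := is_deriveB (is_derive_id x 1) (is_derive_cst c x 1).
    have hq := is_deriveD (is_deriveZ p (is_derive_id x 1)) (is_deriveZ (q / 2) (is_deriveX 2 hc)).
    apply: is_derive_eq hq _.
    rewrite /GRing.scale /= -[(id - cst c) x]/(x - c).
    by rewrite subr0 expr1 !mulr1; field.
  exact: is_deriveB h h1.
have [] := @MVT_segment R G (fun x => f x - (p + q * (x - c))) a b ab.
- by move=> x /[!in_itv] /= /andP[ax _]; apply: dG; exact: lt_trans ax.
- apply: continuous_in_subspaceT => x /[!inE] /= /[!in_itv] /= /andP[ax _].
  apply: differentiable_continuous; apply/derivable1_diffP.
  by have [] := dG x (lt_le_trans La ax).
move=> x /[!in_itv] /= /H hx; rewrite /G => E.
have -> : primitive L f b - primitive L f a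
     - (p * (b - a) + q / 2 * ((b - c) ^+ 2 - (a - c) ^+ 2)) =
  (f x - (p + q * (x - c))) * (b - a) by rewrite -E; ring.
by rewrite normrM [`|b - a|]ger0_norm ?subr_ge0 // ler_wpM2r // subr_ge0.
Qed.

End Primitive.

(** * Logarithmic polar coordinates *)

Section PolarMap.
Variable R : realType.
Local Notation normc := (@Normc.normc R).

Definition polar (s t : R) : R[i] := (expR s * cos t) +i* (expR s * sin t).

Lemma polarD s s' t t' : polar (s + s') (t + t') = polar s t * polar s' t'.
Proof.
apply/eqP; rewrite eq_complex /= expRD cosD sinD.
by apply/andP; split; apply/eqP; ring.
Qed.

Lemma normc_polar s t : normc (polar s t) = expR s.
Proof.
rewrite /= !exprMn -mulrDr cos2Dsin2 mulr1 sqrtr_sqr.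
by rewrite ger0_norm // expR_ge0.
Qed.

Lemma polar2pi s : polar s (pi *+ 2) = polar s 0.
Proof. by rewrite /polar cos2pi sin2pi cos0 sin0. Qed.

(** This is the derivative of exp at 0 in real terms; the functional equation [polarD] carries it to
    every other point in [polar_chain]. *)
Lemma polar_derive0 (e : R) : 0 < e -> exists2 del : R, 0 < del &
  forall s t, `|s| < del -> `|t| < del ->
    normc (polar s t - 1 - (s +i* t)) <= e * (`|s| + `|t|).
Proof.
move=> e0; have e8 : 0 < Num.min 1 (e / 8) by rewrite lt_min ltr01 divr_gt0.
have le1 : Num.min 1 (e / 8) <= 1 by rewrite ge_min lexx.
have le2 : Num.min 1 (e / 8) <= e / 8 by rewrite ge_min lexx orbT.
move: (Num.min _ _) e8 le1 le2 => d d0 d1 d8.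
have [x x0 X] := (is_derive1P _ _ _).1 (@is_derive_expR R 0) d d0.
have [y y0 Y] := (is_derive1P _ _ _).1 (@is_derive_sin R 0) d d0.
have [z z0 Z] := (is_derive1P _ _ _).1 (@is_derive_cos R 0) d d0.
exists (Num.min (Num.min x y) (Num.min z (Num.min 1 (e / 8)))).
  by rewrite !lt_min x0 y0 z0 divr_gt0 //= ltr01.
move=> s t; rewrite !lt_min.
move=> /andP[/andP[/X + _] /andP[_ /andP[s1 se]]] /andP[/andP[_ /Y +] /andP[/Z + /andP[t1 te]]].
rewrite !add0r expR0 sin0 cos0 oppr0 mulr0 !mulr1 !(subr0, addr0).
move=> hx hy hz; set A := (polar s t - 1 - _).
have -> : A = ((expR s - 1 - s) * cos t + (1 + s) * (cos t - 1)) +i*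
              ((expR s - 1 - s) * sin t + (1 + s) * (sin t - t) + s * t).
  by apply/eqP; rewrite eq_complex /=; apply/andP; split; apply/eqP; ring.
apply: le_trans (normc_le_sum _) _ => /=.
have cb : `|cos t| <= 1 by rewrite ler_norml cos_geN1 cos_le1.
have sb : `|sin t| <= 1 by rewrite ler_norml sin_geN1 sin_le1.
have s2 : `|1 + s| <= 2 by apply: le_trans (ler_normD _ _) _; rewrite normr1; lra.
have B1 : `|(expR s - 1 - s) * cos t| <= d * `|s|.
  by rewrite normrM -[leRHS]mulr1 ler_pM.
have B2 : `|(expR s - 1 - s) * sin t| <= d * `|s|.
  by rewrite normrM -[leRHS]mulr1 ler_pM.
have B3 : `|(1 + s) * (cos t - 1)| <= 2 * (d * `|t|) by rewrite normrM ler_pM.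
have B4 : `|(1 + s) * (sin t - t)| <= 2 * (d * `|t|) by rewrite normrM ler_pM.
have B5 : `|s * t| <= e / 8 * `|t| by rewrite normrM ler_wpM2r // ltW.
have C1 : d * `|s| <= e / 8 * `|s| by rewrite ler_wpM2r.
have C2 : d * `|t| <= e / 8 * `|t| by rewrite ler_wpM2r.
have := ler_normD ((expR s - 1 - s) * cos t) ((1 + s) * (cos t - 1)).
have := ler_normD ((expR s - 1 - s) * sin t + (1 + s) * (sin t - t)) (s * t).
have := ler_normD ((expR s - 1 - s) * sin t) ((1 + s) * (sin t - t)).
have := mulr_ge0 (ltW e0) (normr_ge0 s); have := mulr_ge0 (ltW e0) (normr_ge0 t).
lra.
Qed.

End PolarMap.

(** * Goursat's theorem for differential forms on rectangles *)

Section Goursat.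
Variable R : realType.

Lemma nested_intervals (x w : nat -> R) :
  (forall n, 0 <= w n) -> (forall n, x n <= x n.+1) ->
  (forall n, x n.+1 + w n.+1 <= x n + w n) ->
  exists c, forall n, x n <= c <= x n + w n.
Proof.
move=> w0 xx xw.
have mono n k : x n <= x (n + k)%N.
  by elim: k => [|k IH]; rewrite ?addn0 // addnS; exact: le_trans IH (xx _).
have anti n k : x (n + k)%N + w (n + k)%N <= x n + w n.
  by elim: k => [|k IH]; rewrite ?addn0 // addnS; exact: le_trans (xw _) IH.
have cross n k : x n <= x k + w k.
  have [nk|kn] := leqP n k.
    rewrite -(subnKC nk); apply: le_trans (mono n (k - n)%N) _.
    by rewrite lerDl.
  rewrite -(subnKC (ltnW kn)); apply: le_trans (anti k (n - k)%N).
  by rewrite lerDl.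
exists (sup (range x)) => n; apply/andP; split.
  apply: ub_le_sup; last by exists n.
  by exists (x 0%N + w 0%N) => _ [k _ <-].
by apply: ge_sup; [exists (x 0%N), 0%N|move=> _ [k _ <-]].
Qed.

Variables (P Q : R -> R -> R) (Ls Lt : R).
Hypothesis cP : forall t, continuous (P^~ t).
Hypothesis cQ : forall s, continuous (Q s).

(* The integral of the form [P ds + Q dt] around the rectangle
   [x, x + l] x [y, y + m], each side being evaluated by a primitive. *)
Definition circulation (x y l m : R) : R :=
  (primitive Ls (P^~ y) (x + l) - primitive Ls (P^~ y) x)
  + (primitive Lt (Q (x + l)) (y + m) - primitive Lt (Q (x + l)) y)
  - (primitive Ls (P^~ (y + m)) (x + l) - primitive Ls (P^~ (y + m)) x)
  - (primitive Lt (Q x) (y + m) - primitive Lt (Q x) y).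

Lemma circulation_split x y l m :
  circulation x y (l + l) (m + m) =
  circulation x y l m + circulation (x + l) y l m
  + circulation x (y + m) l m + circulation (x + l) (y + m) l m.
Proof. by rewrite /circulation !addrA; move: (primitive Ls) (primitive Lt) => I J; ring. Qed.

(** By [circulation_split] the four quadrants add up to the whole, so they cannot all lie below a
    quarter of it. *)
Lemma circulation_quadrant x y l m : exists q : R * R,
  [/\ q.1 = x \/ q.1 = x + l, q.2 = y \/ q.2 = y + m &
      `|circulation x y (l + l) (m + m)| <= 4 * `|circulation q.1 q.2 l m|].
Proof.
apply: contrapT => /forallNP H.
have h (q : R * R) : q.1 = x \/ q.1 = x + l -> q.2 = y \/ q.2 = y + m ->
    4 * `|circulation q.1 q.2 l m| < `|circulation x y (l + l) (m + m)|.
  move=> q1 q2; rewrite ltNge; apply/negP => q3.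
  by apply: (H q); split.
have h1 := h (x, y) (or_introl erefl) (or_introl erefl).
have h2 := h (x + l, y) (or_intror erefl) (or_introl erefl).
have h3 := h (x, y + m) (or_introl erefl) (or_intror erefl).
have h4 := h (x + l, y + m) (or_intror erefl) (or_intror erefl).
move: h1 h2 h3 h4; rewrite /= circulation_split.
set A := circulation x y l m; set B := circulation (x + l) y l m.
set C := circulation x (y + m) l m; set D := circulation (x + l) (y + m) l m.
have := ler_normD (A + B + C) D; have := ler_normD (A + B) C; have := ler_normD A B.
lra.
Qed.

(** The affine parts make up a closed form, since the same [b] is the [t]-slope of [P] and the
    [s]-slope of [Q]; their circulation vanishes and [e] times the perimeter is left. *)
Lemma circulation_small (x y l m s t p q a b d e : R) : Ls < x -> Lt < y ->
  0 <= l -> 0 <= m ->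
  (forall s' t', x <= s' <= x + l -> y <= t' <= y + m ->
    `|P s' t' - (p + a * (s' - s) + b * (t' - t))| <= e /\
    `|Q s' t' - (q + b * (s' - s) + d * (t' - t))| <= e) ->
  `|circulation x y l m| <= e * (2 * (l + m)).
Proof.
move=> Lx Ly l0 m0 H.
have xl : x <= x + l by rewrite lerDl.
have ym : y <= y + m by rewrite lerDl.
have h1 := @primitive_approx R Ls (P^~ y) x (x + l) (p + b * (y - t)) a s e (@cP y) Lx xl.
have h2 := @primitive_approx R Ls (P^~ (y + m)) x (x + l) (p + b * (y + m - t)) a s e
  (@cP _) Lx xl.
have h3 := @primitive_approx R Lt (Q x) y (y + m) (q + b * (x - s)) d t e (@cQ x) Ly ym.
have h4 := @primitive_approx R Lt (Q (x + l)) y (y + m) (q + b * (x + l - s)) d t e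
  (@cQ _) Ly ym.
have {}h1 := h1 (fun z zi => ltac:(have [+ _] := H z y zi ltac:(by rewrite lexx); by rewrite addrAC)).
have {}h2 := h2 (fun z zi => ltac:(have [+ _] := H z (y + m) zi ltac:(by rewrite lexx andbT); by rewrite addrAC)).
have {}h3 := h3 (fun z zi => ltac:(by have [_ +] := H x z ltac:(by rewrite lexx) zi)).
have {}h4 := h4 (fun z zi => ltac:(by have [_ +] := H (x + l) z ltac:(by rewrite lexx andbT) zi)).
rewrite /circulation; move: h1 h2 h3 h4.
set A := _ - primitive Ls (P^~ y) x; set B := _ - primitive Ls (P^~ (y + m)) x.
set C := _ - primitive Lt (Q x) y; set D := _ - primitive Lt (Q (x + l)) y.
set A' := (_ * _ + _); set B' := (_ * _ + _); set C' := (_ * _ + _); set D' := (_ * _ + _).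
move=> h1 h2 h3 h4.
have E : A + D - B - C = (A - A') + (D - D') - (B - B') - (C - C').
  by rewrite /A' /B' /C' /D'; ring.
rewrite {}E; move: h1 h2 h3 h4; move: (A - A') (B - B') (C - C') (D - D') => a1 b1 c1 d1 h1 h2 h3 h4.
have := ler_normB (a1 + d1 - b1) c1; have := ler_normB (a1 + d1) b1; have := ler_normD a1 d1.
lra.
Qed.

(** Repeated bisection: the chosen rectangle of level [n] carries at least the fraction 4^-n of the
    circulation, while near the common point differentiability bounds it by an arbitrarily small
    multiple of 4^-n. Continuity of the partial derivatives is nowhere assumed, in keeping with what
    is known of [T']. *)
Lemma goursat x0 y0 l m : Ls < x0 -> Lt < y0 -> 0 < l -> 0 < m ->
  (forall s t, x0 <= s <= x0 + l -> y0 <= t <= y0 + m ->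
    exists a b d : R, forall e : R, 0 < e -> exists2 del : R, 0 < del &
    forall s' t', x0 <= s' <= x0 + l -> y0 <= t' <= y0 + m ->
      `|s' - s| < del -> `|t' - t| < del ->
      `|P s' t' - (P s t + a * (s' - s) + b * (t' - t))| <= e * (`|s' - s| + `|t' - t|) /\
      `|Q s' t' - (Q s t + b * (s' - s) + d * (t' - t))| <= e * (`|s' - s| + `|t' - t|)) ->
  circulation x0 y0 l m = 0.
Proof.
move=> Lx Ly l0 m0 H.
pose w n : R := l / 2 ^+ n; pose h n : R := m / 2 ^+ n.
have p2 n : 0 < 2 ^+ n :> R by rewrite exprn_gt0.
have w0 n : 0 < w n by rewrite divr_gt0.
have h0 n : 0 < h n by rewrite divr_gt0.
have wS n : w n = w n.+1 + w n.+1 by rewrite /w exprS; field; rewrite gt_eqF.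
have hS n : h n = h n.+1 + h n.+1 by rewrite /h exprS; field; rewrite gt_eqF.
have [f fP] := choice (fun np : nat * (R * R) =>
  circulation_quadrant np.2.1 np.2.2 (w np.1.+1) (h np.1.+1)).
pose z := fix z n := if n is k.+1 then f (k, z k) else (x0, y0).
have zP n := fP (n, z n).
have [c cP'] : exists c, forall n, (z n).1 <= c <= (z n).1 + w n.
  apply: nested_intervals => n; [by rewrite ltW| |].
    by have /= [+ _ _] := zP n; have := w0 n.+1; lra.
  by have /= [+ _ _] := zP n; have := w0 n.+1; rewrite (wS n); lra.
have [d dP'] : exists d, forall n, (z n).2 <= d <= (z n).2 + h n.
  apply: nested_intervals => n; [by rewrite ltW| |].
    by have /= [_ + _] := zP n; have := h0 n.+1; lra.
  by have /= [_ + _] := zP n; have := h0 n.+1; rewrite (hS n); lra.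
have zx n : x0 <= (z n).1 /\ (z n).1 + w n <= x0 + l.
  elim: n => [|n [IH1 IH2]]; first by rewrite /= /w expr0 divr1.
  by have /= [+ _ _] := zP n; have := w0 n.+1; move: IH2; rewrite (wS n); lra.
have zy n : y0 <= (z n).2 /\ (z n).2 + h n <= y0 + m.
  elim: n => [|n [IH1 IH2]]; first by rewrite /= /h expr0 divr1.
  by have /= [_ + _] := zP n; have := h0 n.+1; move: IH2; rewrite (hS n); lra.
have growth n : `|circulation x0 y0 l m| <=
    4 ^+ n * `|circulation (z n).1 (z n).2 (w n) (h n)|.
  elim: n => [|n IH]; first by rewrite expr0 mul1r /w /h expr0 !divr1.
  apply: le_trans IH _; rewrite exprSr -mulrA ler_wpM2l ?exprn_ge0 //.
  by rewrite (wS n) (hS n); have [_ _] := zP n.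
have ci : x0 <= c <= x0 + l by have := cP' 0%N; rewrite /= /w expr0 divr1.
have di : y0 <= d <= y0 + m by have := dP' 0%N; rewrite /= /h expr0 divr1.
have [a [b [d' Hd]]] := H c d ci di.
apply/normr0_eq0/le_anti; rewrite normr_ge0 andbT.
apply/ler_addgt0Pr => e' e'0; rewrite add0r.
(* With this [e] the final product [4 ^+ n * e * 2 * (w n + h n) ^+ 2] equals [e'], because
   [w n + h n] is [(l + m) / 2 ^+ n]. *)
pose e := e' / (2 * (l + m) ^+ 2).
have e0 : 0 < e by rewrite divr_gt0 // mulr_gt0 // exprn_gt0 // addr_gt0.
have [del del0 {}Hd] := Hd e e0.
have [n nd] : exists n, (l + m) / 2 ^+ n < del.
  have [n nP] : exists n : nat, (l + m) / del < n%:R.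
    exists (Num.bound ((l + m) / del)); apply: archi_boundP.
    by rewrite ltW // divr_gt0 // addr_gt0.
  exists n; rewrite ltr_pdivrMr // mulrC -ltr_pdivrMr //.
  apply: lt_le_trans nP _; rewrite -natrX ler_nat.
  exact/ltnW/ltn_expl.
have wd : w n + h n < del by rewrite /w /h -mulrDl.
have [zx1 zx2] := zx n; have [zy1 zy2] := zy n.
have /andP[c1 c2] := cP' n; have /andP[d1 d2] := dP' n.
have wn := w0 n; have hn := h0 n.
have small : `|circulation (z n).1 (z n).2 (w n) (h n)| <=
    e * (w n + h n) * (2 * (w n + h n)).
  move: (z n).1 (z n).2 (w n) (h n) wd zx1 zx2 zy1 zy2 c1 c2 d1 d2 wn hn.
  clear -cP cQ e0 Hd Lx Ly.
  move=> x1 y1 w h wd zx1 zx2 zy1 zy2 c1 c2 d1 d2 wn hn.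
  apply: (@circulation_small _ _ _ _ c d (P c d) (Q c d) a b d'); [lra..|].
  move=> s' t' /andP[s1 s2] /andP[t1 t2].
  have sc : `|s' - c| <= w by rewrite ler_norml; apply/andP; split; lra.
  have td : `|t' - d| <= h by rewrite ler_norml; apply/andP; split; lra.
  have [|||| H1 H2] := Hd s' t'; [by apply/andP; split; lra..|lra|lra|].
  have bnd : e * (`|s' - c| + `|t' - d|) <= e * (w + h).
    by rewrite ler_wpM2l ?lerD // ltW.
  by split; [exact: le_trans H1 bnd|exact: le_trans H2 bnd].
apply: le_trans (growth n) _.
apply: le_trans (ler_wpM2l (exprn_ge0 n (ltW _)) small) _ => //.
rewrite le_eqVlt; apply/orP; left; apply/eqP.
have -> : (4 : R) ^+ n = 2 ^+ n * 2 ^+ n by rewrite -exprMn; congr (_ ^+ _); ring.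
rewrite /e /w /h; field.
by rewrite !gt_eqF // addr_gt0.
Qed.

End Goursat.

(** * Mean values over circles and the Cauchy estimate *)

Section CauchyEstimate.
Variable R : realType.
Local Notation normc := (@Normc.normc R).

Lemma polar_small (e : R) : 0 < e -> exists2 del : R, 0 < del &
  forall s t, `|s| < del -> `|t| < del -> normc (polar s t - 1) <= e.
Proof.
move=> e0; have [del del0 H] := @polar_derive0 R 1 ltr01.
exists (Num.min del (e / 4)); first by rewrite lt_min del0 divr_gt0.
move=> s t; rewrite !lt_min => /andP[sd se] /andP[td te].
have := H s t sd td; rewrite mul1r => h.
rewrite -(subrK (s +i* t) (polar s t - 1)).
apply: le_trans (normcD _ _) _; apply: le_trans (lerD h (normc_le_sum _)) _ => /=.
lra.
Qed.

Lemma polar_cont s t (e : R) : 0 < e -> exists2 del : R, 0 < del &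
  forall s' t', `|s' - s| < del -> `|t' - t| < del ->
    normc (polar s' t' - polar s t) < e.
Proof.
move=> e0; have e1 : 0 < e / expR s / 2 by rewrite !divr_gt0 ?expR_gt0.
have [del del0 H] := polar_small e1; exists del => // s' t' /H h /h {}h.
rewrite -{1}(subrKC s s') -{1}(subrKC t t') polarD -{2}[polar s t]mulr1 -mulrBr.
rewrite Normc.normcM normc_polar mulrC -ltr_pdivlMr ?expR_gt0 //.
by apply: le_lt_trans h _; rewrite ltr_pdivrMr // ltr_pMr ?divr_gt0 ?expR_gt0 // ltr1n.
Qed.

Lemma polar_chain g s t d (e : R) : cderiv g (polar s t) d -> 0 < e ->
  exists2 del : R, 0 < del & forall s' t', `|s' - s| < del -> `|t' - t| < del ->
    normc (g (polar s' t') - g (polar s t) - d * polar s t * ((s' - s) +i* (t' - t)))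
      <= e * (`|s' - s| + `|t' - t|).
Proof.
move=> gd e0; set z := polar s t.
have nz : 0 < normc z by rewrite normc_polar expR_gt0.
have nd := normc_ge0 d.
(* Since [e2 <= 1], the displacement of [polar] is at most [normc z * (2 * N)]; hence the 4 here and
   the 2 in [e2], so that each of the two error terms is at most [e / 2 * N]. *)
pose e1 := e / (4 * normc z); have e10 : 0 < e1 by rewrite divr_gt0 // mulr_gt0.
pose e2 := Num.min 1 (e / (2 * (normc d * normc z + 1))).
have dz : 0 <= normc d * normc z by rewrite mulr_ge0 // ltW.
have e20 : 0 < e2 by rewrite lt_min ltr01 divr_gt0 // mulr_gt0 //; lra.
have [d1 d10 H1] := gd e1 e10.
have [d2 d20 H2] := polar_derive0 e20.
have [d3 d30 H3] := polar_cont s t d10.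
exists (Num.min d2 d3); first by rewrite lt_min d20.
move=> s' t'; rewrite !lt_min => /andP[s2 s3] /andP[t2 t3].
have {}H2 := H2 _ _ s2 t2; have {}H3 := H3 _ _ s3 t3.
set w := (s' - s) +i* (t' - t) in H2 *.
pose N : R := `|s' - s| + `|t' - t|; rewrite -/N in H2 *.
have wN : normc w <= N by exact: normc_le_sum.
have N0 : 0 <= N by rewrite addr_ge0.
have E : polar s' t' - z = z * (polar (s' - s) (t' - t) - 1).
  by rewrite mulrBr mulr1 -polarD !subrKC.
have hN : normc (polar s' t' - z) <= normc z * (2 * N).
  rewrite E Normc.normcM ler_wpM2l ?(ltW nz) //.
  rewrite -(subrK w (_ - 1)); apply: le_trans (normcD _ _) _.
  have : e2 * N <= N by rewrite ler_piMl // ge_min lexx.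
  lra.
have := H1 _ H3; rewrite (subrKC z) => {}H1.
have -> : g (polar s' t') - g z - d * z * w =
  (g (polar s' t') - g z - (polar s' t' - z) * d) +
  d * z * (polar (s' - s) (t' - t) - 1 - w) by rewrite E; ring.
apply: le_trans (normcD _ _) _; rewrite !Normc.normcM.
have A : e1 * normc (polar s' t' - z) <= e / 2 * N.
  apply: le_trans (ler_wpM2l (ltW e10) hN) _.
  by rewrite le_eqVlt; apply/orP; left; apply/eqP; rewrite /e1; field; rewrite gt_eqF.
have B : normc d * normc z * (e2 * N) <= e / 2 * N.
  rewrite mulrA ler_wpM2r //.
  have h : e2 <= e / (2 * (normc d * normc z + 1)) by rewrite ge_min lexx orbT.
  apply: le_trans (ler_wpM2l dz h) _.
  rewrite invfM mulrA mulrCA mulrA ler_pdivrMr ?ltr_wpDl //.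
  rewrite mulrDr mulr1; have : 0 < e / 2 by rewrite divr_gt0.
  by move: (normc d * normc z) dz => q q0 ?; nra.
have := ler_wpM2l dz H2.
by move=> h; apply: le_trans (lerD (le_trans H1 A) (le_trans h B)) _; lra.
Qed.

Lemma le_dist_min (s s' c : R) : `|Num.min s' c - Num.min s c| <= `|s' - s|.
Proof.
have h1 := ler_norm (s' - s); have h2 := ler_norm (- (s' - s)).
rewrite normrN in h2.
by case: (leP s' c) => a; case: (leP s c) => b;
  rewrite ler_norml; apply/andP; split; lra.
Qed.

(** The integral of Re g over the circle of radius exp s does not depend on s. This is Goursat for
    Im (g dz / z), which in logarithmic polar coordinates is [P ds + Q dt] with P = Im F and Q = Re
    F. On tiny circles the integral is close to 2 pi times the central value. At the centre only
    continuity is assumed, so that a difference quotient can be inserted. *)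
Lemma center_le_circle (g : R[i] -> R[i]) (g' : R[i] -> R[i]) (rho r k : R) :
  0 < r < rho ->
  (forall z, 0 < normc z < rho -> cderiv g z (g' z)) ->
  (forall e : R, 0 < e -> exists2 del : R, 0 < del &
     forall z, normc z < del -> normc (g z - g 0) <= e) ->
  (forall z, normc z = r -> normc (g z) <= k) ->
  complex.Re (g 0) <= k.
Proof.
move=> /andP[r0 rrho] gd g0 gk.
pose s1 := ln r; have es1 : expR s1 = r by rewrite lnK // posrE.
(* Freezing [s] beyond [s1] keeps the argument inside the disc, which makes [P] and [Q] continuous
   on the whole line, as the section on rectangles demands; on the rectangle itself nothing
   changes. *)
pose F s t := g (polar (Num.min s s1) t).
have Fin s t : 0 < normc (polar (Num.min s s1) t) < rho.
  rewrite normc_polar expR_gt0; apply: le_lt_trans rrho.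
  by rewrite -es1 ler_expR ge_min lexx orbT.
have Fcont s t (e : R) : 0 < e -> exists2 del : R, 0 < del & forall s' t',
    `|s' - s| < del -> `|t' - t| < del -> normc (F s' t' - F s t) <= e.
  move=> e0; have [d1 d10 H1] := cderiv_cont (gd _ (Fin s t)) e0.
  have [d2 d20 H2] := polar_cont (Num.min s s1) t d10.
  exists d2 => // s' t' hs ht; rewrite /F.
  have := H1 _ (H2 _ _ (le_lt_trans (le_dist_min _ _ _) hs) ht).
  by rewrite subrKC.
pose P s t := complex.Im (F s t); pose Q s t := complex.Re (F s t).
have cP t : continuous (P^~ t).
  move=> s; apply/cvgrPdist_le => e e0; have [del del0 H] := Fcont s t e e0.
  apply/nbhs_ballP; exists del => //= s'; rewrite /ball /= distrC => hs.
  have := H s' t hs; rewrite subrr normr0 => /(_ del0); apply: le_trans.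
  by rewrite distrC; apply: le_trans (normc_Im _); rewrite raddfB.
have cQ s : continuous (Q s).
  move=> t; apply/cvgrPdist_le => e e0; have [del del0 H] := Fcont s t e e0.
  apply/nbhs_ballP; exists del => //= t'; rewrite /ball /= distrC => ht.
  have := H s t'; rewrite subrr normr0 => /(_ del0 ht); apply: le_trans.
  by rewrite distrC; apply: le_trans (normc_Re _); rewrite raddfB.
apply/ler_addgt0Pr => e e0.
have [del del0 H0] := g0 e e0.
(* The inner circle: to the left of [s1], and of radius at most [del / 2], where [g] is within [e]
   of its central value. *)
pose s0 := Num.min (s1 - 1) (ln (del / 2)).
have s01 : s0 < s1 by rewrite /s0 gt_min; apply/orP; left; lra.
have p2 : 0 < pi *+ 2 :> R by rewrite mulrn_wgt0 // pi_gt0.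
have L1 : s0 - 1 < s0 by lra.
have L2 : -1 < 0 :> R by rewrite ltrN10.
have circ0 : circulation P Q (s0 - 1) (-1) s0 0 (s1 - s0) (pi *+ 2) = 0.
  apply: goursat => //; first by rewrite subr_gt0.
  move=> s t; rewrite subrKC => /andP[_ ss1] _.
  have ms : Num.min s s1 = s by apply/min_idPl.
  have [] := andP (Fin s t); rewrite ms => n0 nr.
  set z := polar s t in n0 nr *.
  have gz := gd z; rewrite n0 nr in gz; have {}gz := gz isT.
  (* Cauchy-Riemann: [F] has the differential [g' z * z] times (ds + i dt), whose imaginary and real
     parts share the coefficient Re (g' z * z). *)
  exists (complex.Im (g' z * z)), (complex.Re (g' z * z)), (- complex.Im (g' z * z)).
  move=> e' e'0; have [d1 d10 H] := polar_chain gz e'0.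
  exists d1 => // s' t' /andP[_ ss'] _ hs ht.
  have {}H := H s' t' hs ht.
  have FE : F s' t' = g (polar s' t') by rewrite /F (min_idPl ss').
  have FE0 : F s t = g z by rewrite /F ms.
  rewrite /P /Q FE FE0; split; apply: le_trans H.
    apply: le_trans (normc_Im _); rewrite le_eqVlt; apply/orP; left; apply/eqP.
    congr `|_|; case: (g (polar s' t')) => a1 b1; case: (g z) => a2 b2.
    by case: (g' z * z) => a3 b3 /=; ring.
  apply: le_trans (normc_Re _); rewrite le_eqVlt; apply/orP; left; apply/eqP.
  congr `|_|; case: (g (polar s' t')) => a1 b1; case: (g z) => a2 b2.
  by case: (g' z * z) => a3 b3 /=; ring.
move: circ0; rewrite /circulation subrKC add0r.
(* By periodicity the sides [t = 0] and [t = 2 pi] cancel, which leaves the two circles. *)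
have -> : P^~ (pi *+ 2) = P^~ 0.
  by apply/funext => s; rewrite /P /F polar2pi.
set A := _ - primitive (s0 - 1) _ _.
move=> circ0.
have E : primitive (-1) (Q s1) (pi *+ 2) - primitive (-1) (Q s1) 0 =
  primitive (-1) (Q s0) (pi *+ 2) - primitive (-1) (Q s0) 0.
  by move: circ0; rewrite [A + _]addrC addrK => /subr0_eq.
have h1 := @primitive_approx R (-1) (Q s1) 0 (pi *+ 2) 0 0 0 k (@cQ _) L2 (ltW p2).
have h0 := @primitive_approx R (-1) (Q s0) 0 (pi *+ 2) (complex.Re (g 0)) 0 0 e
  (@cQ _) L2 (ltW p2).
have {}h1 : `|primitive (-1) (Q s1) (pi *+ 2) - primitive (-1) (Q s1) 0| <= k * (pi *+ 2).
  have := h1 _; rewrite !(mul0r, addr0, subr0); apply => x _.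
  rewrite !(mul0r, addr0, subr0); apply: le_trans (normc_Re _) _.
  by apply: gk; rewrite normc_polar minxx.
have {}h0 : `|primitive (-1) (Q s0) (pi *+ 2) - primitive (-1) (Q s0) 0
    - complex.Re (g 0) * (pi *+ 2)| <= e * (pi *+ 2).
  have := h0 _; rewrite !(mul0r, addr0, subr0); apply => x _.
  rewrite !(mul0r, addr0, subr0) -raddfB; apply: le_trans (normc_Re _) _.
  apply: H0; rewrite normc_polar (min_idPl (ltW s01)).
  apply: (@le_lt_trans _ _ (del / 2)); last by move: del0; clear; lra.
  by rewrite -[leRHS]lnK ?posrE ?divr_gt0 // ler_expR ge_min lexx orbT.
move: h1; rewrite E; move: (_ - primitive _ (Q s0) 0) h0 => J h0 h1.
rewrite -(ler_pM2r p2) mulrDl.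
have := ler_norm J; have := ler_norm (- (J - complex.Re (g 0) * (pi *+ 2))).
move: h0 h1; rewrite normrN; clear; lra.
Qed.

Lemma normc_center_le_circle (g g' : R[i] -> R[i]) (rho r k : R) :
  0 < r < rho ->
  (forall z, 0 < normc z < rho -> cderiv g z (g' z)) ->
  (forall e : R, 0 < e -> exists2 del : R, 0 < del &
     forall z, normc z < del -> normc (g z - g 0) <= e) ->
  (forall z, normc z = r -> normc (g z) <= k) ->
  normc (g 0) <= k.
Proof.
move=> rr gd g0 gk; have [c c1 cg] := exists_rotation (g 0).
rewrite -[leLHS]/(complex.Re (normc (g 0))%:C) -cg.
apply: (@center_le_circle (fun z => c * g z) (fun z => c * g' z) rho r k rr).
- by move=> z /gd; exact: cderivZ.
- move=> e /g0 [del del0 H]; exists del => // z /H.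
  by rewrite -mulrBr Normc.normcM c1 mul1r.
- by move=> z /gk; rewrite Normc.normcM c1 mul1r.
Qed.

(** The difference quotient of [f] at [a], completed by [f' a], is continuous at the centre and at
    most [2 * M / r] on the circle; the 2 comes from estimating [f (a + h)] and [f a] separately. *)
Lemma cauchy_estimate (f f' : R[i] -> R[i]) a (rho r M : R) : 0 < r < rho ->
  (forall h, normc h < rho -> cderiv f (a + h) (f' (a + h))) ->
  (forall h, normc h < rho -> normc (f (a + h)) <= M) ->
  normc (f' a) <= 2 * M / r.
Proof.
move=> rr fd fM; have /andP[r0 rrho] := rr.
have rho0 := lt_trans r0 rrho.
pose g h := if h == 0 then f' a else (f (a + h) - f a) / h.
pose g' h := f' (a + h) * h^-1 + (f (a + h) - f a) * (- h ^- 2).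
have n0 : normc (0 : R[i]) = 0 by exact: Normc.normc0.
have f0 : cderiv f a (f' a) by have := fd 0; rewrite n0 addr0; exact.
have -> : f' a = g 0 by rewrite /g eqxx.
apply: (@normc_center_le_circle g g' rho r) => //.
- move=> z /andP[]; rewrite normc_gt0 => z0 zrho.
  apply: (@cderiv_ext R (fun h => (f (a + h) - f a) * h^-1) _ _ _ (normc z)).
  + by rewrite normc_gt0.
  + move=> w wz; rewrite /g; case: eqP => // w0.
    by move: wz; rewrite w0 sub0r normcN ltxx.
  + apply: cderivM; last exact: cderivV.
    move=> e e0; have [del del0 H] := fd z zrho e e0; exists del => // h /H.
    by rewrite addrA opprB addrA subrK.
- move=> e e0; have [del del0 H] := f0 e e0; exists del => // z zd.
  rewrite /g eqxx; case: eqP => [_|/eqP z0]; first by rewrite subrr n0 ltW.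
  have -> : (f (a + z) - f a) / z - f' a = (f (a + z) - f a - z * f' a) / z by field.
  rewrite Normc.normcM Normc.normcV ler_pdivrMr ?normc_gt0 //; exact: H.
- move=> z zr; have z0 : z != 0 by rewrite -normc_gt0 zr.
  rewrite /g (negbTE z0) Normc.normcM Normc.normcV zr ler_pM2r ?invr_gt0 //.
  have -> : 2 * M = M + M by ring.
  apply: le_trans (normcD _ _) _; rewrite normcN.
  apply: lerD; first by apply: fM; rewrite zr.
  by have := fM 0; rewrite addr0 n0; exact.
Qed.

Lemma mean_value_cderiv (f f' : R[i] -> R[i]) (z w : R[i]) (L : R) :
  (forall t : R, 0 <= t <= 1 -> cderiv f (w + t%:C * (z - w)) (f' (w + t%:C * (z - w)))) ->
  (forall t : R, 0 <= t <= 1 -> normc (f' (w + t%:C * (z - w))) <= L) ->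
  normc (f z - f w) <= L * normc (z - w).
Proof.
move=> fd fL; have [c c1 cf] := exists_rotation (f z - f w).
pose q (t : R) : R[i] := w + t%:C * (z - w).
pose psi t := complex.Re (c * f (q t)).
pose psi' t := complex.Re (c * (f' (q t) * (z - w))).
have nzw := normc_ge0 (z - w).
have dpsi (t : R) : 0 <= t <= 1 -> is_derive t 1 psi (psi' t).
  move=> /fd ft; apply/is_derive1P => e e0.
  have e1 : 0 < e / (normc (z - w) + 1) by rewrite divr_gt0 //; lra.
  have [del del0 H] := ft _ e1.
  exists (del / (normc (z - w) + 1)); first by rewrite divr_gt0 //; lra.
  move=> h hd; have := H (h%:C * (z - w)).
  rewrite Normc.normcM normc_real.
  have hd1 : `|h| * normc (z - w) < del.
    apply: le_lt_trans (_ : `|h| * (normc (z - w) + 1) < _).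
      by rewrite ler_wpM2l // lerDl.
    by rewrite -ltr_pdivlMr //; lra.
  move=> /(_ hd1) {}H.
  have qE : q (t + h) = q t + h%:C * (z - w) by rewrite /q rmorphD /= mulrDl addrA.
  have -> : psi (t + h) - psi t - h * psi' t =
    complex.Re (c * (f (q t + h%:C * (z - w)) - f (q t) - h%:C * (z - w) * f' (q t))).
    rewrite /psi /psi' qE; case: (c) => c2 c3; case: (f (_ + _)) => a1 a2.
    case: (f (q t)) => a3 a4; case: (f' (q t)) => a5 a6; case: (z - w) => a7 a8 /=.
    by ring.
  apply: le_trans (normc_Re _) _; rewrite Normc.normcM c1 mul1r.
  apply: le_trans H _; rewrite [leRHS]mulrC mulrCA ler_wpM2l //.
  by rewrite mulrAC ler_pdivrMr; nra.
have [||x xi] := @MVT_segment R psi psi' 0 1 ler01.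
- move=> t /[!in_itv] /= /andP[t0 t1]; apply: dpsi; by rewrite !ltW.
- apply: continuous_in_subspaceT => t /[!inE] /= /[!in_itv] /= ti.
  by apply: differentiable_continuous; apply/derivable1_diffP; have [] := dpsi t ti.
rewrite subr0 mulr1 => E; move: xi; rewrite in_itv /= => xi.
have q1 : q 1 = z by rewrite /q mul1r subrKC.
have q0 : q 0 = w by rewrite /q mul0r addr0.
have <- : psi 1 - psi 0 = normc (f z - f w).
  by rewrite /psi q1 q0 -raddfB -mulrBr cf.
rewrite E; apply: le_trans (ler_norm _) _; apply: le_trans (normc_Re _) _.
rewrite !Normc.normcM c1 mul1r ler_wpM2r //; exact: fL.
Qed.

Lemma normc_segment (z w : R[i]) (t r : R) : normc z < r -> normc w < r -> 0 <= t <= 1 ->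
  normc (w + t%:C * (z - w)) < r.
Proof.
move=> zr wr /andP[t0 t1].
have -> : w + t%:C * (z - w) = (1 - t)%:C * w + t%:C * z by rewrite rmorphB /=; ring.
apply: le_lt_trans (normcD _ _) _.
rewrite !Normc.normcM !normc_real !ger0_norm ?subr_ge0 //.
have := normc_ge0 z; have := normc_ge0 w.
have [->|t10] := eqVneq t 1; first by nra.
have : t < 1 by rewrite lt_neqAle t10. 
nra.
Qed.

(** The Cauchy estimate used twice. Radius [rho / 4] bounds [f'] by [8 * M / rho] on the disc of
    radius [rho / 2], so [f] is Lipschitz there; radius [rho / 8], for the difference of [f] and its
    translate by [b - a], then gives 2 * 8 * 8 = 128. *)
Lemma cderiv_lipschitz (f f' : R[i] -> R[i]) (rho M : R) : 0 < rho ->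
  (forall z, normc z < rho -> cderiv f z (f' z)) ->
  (forall z, normc z < rho -> normc (f z) <= M) ->
  (forall a b, normc a < rho / 4 -> normc b < rho / 4 ->
    normc (f' a - f' b) <= 128 * M / rho ^+ 2 * normc (a - b)).
Proof.
move=> rho0 fd fM.
have f'M a : normc a < rho / 2 -> normc (f' a) <= 8 * M / rho.
  move=> a2; have h4 : 0 < rho / 4 < rho / 2 by lra.
  have := @cauchy_estimate f f' a (rho / 2) (rho / 4) M h4.
  have -> : 2 * M / (rho / 4) = 8 * M / rho by field; rewrite gt_eqF.
  by apply=> h h2; [apply: fd|apply: fM]; apply: le_lt_trans (normcD _ _) _; lra.
have lip z w : normc z < rho / 2 -> normc w < rho / 2 ->
    normc (f z - f w) <= 8 * M / rho * normc (z - w).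
  move=> z2 w2; apply: (@mean_value_cderiv f f') => t t01.
    by apply: fd; have := normc_segment z2 w2 t01; lra.
  by apply: f'M; exact: normc_segment.
move=> a b a4 b4; have h8 : 0 < rho / 8 < rho / 4 by lra.
pose g z := f z + -1 * f (z + (b - a)); pose g' z := f' z + -1 * f' (z + (b - a)).
have -> : f' a - f' b = g' a by rewrite /g' mulN1r subrKC.
have -> : 128 * M / rho ^+ 2 * normc (a - b) =
  2 * (8 * M / rho * normc (a - b)) / (rho / 8) by field; rewrite gt_eqF.
apply: (@cauchy_estimate g g' a (rho / 4)) => // h h4.
  apply: cderivD; first by apply: fd; apply: le_lt_trans (normcD _ _) _; lra.
  apply: cderivZ => e e0.
  have : normc (a + h + (b - a)) < rho.
    by rewrite addrC addrA subrK; apply: le_lt_trans (normcD _ _) _; lra.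
  move=> /fd /(_ e e0) [del del0 H]; exists del => // k /H.
  by rewrite [a + h + k + _]addrAC.
rewrite /g mulN1r; apply: le_trans (lip _ _ _ _) _.
- by apply: le_lt_trans (normcD _ _) _; lra.
- by rewrite addrC addrA subrK; apply: le_lt_trans (normcD _ _) _; lra.
- by rewrite opprD addNKr opprB.
Qed.

End CauchyEstimate.

(** * Bordered operators and Newton's iteration *)

Section RealNorm.
Variables (R : realType) (V : normedModType R[i]).
Implicit Types (u v : V) (z : R[i]).
Local Notation normc := (@Normc.normc R).

(** The norm of [V] takes values in [R[i]]. Being nonnegative it is real, and [rnorm] moves it to
    [R], where the ordered-field tactics apply. *)
Definition rnorm v : R := complex.Re `|v|.

Lemma rnormE v : `|v| = (rnorm v)%:C.
Proof.
have := normr_ge0 v; rewrite /rnorm lecE; case: `|v| => x y /= /andP[/eqP -> _].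
by [].
Qed.

Lemma rnorm_ge0 v : 0 <= rnorm v.
Proof. by rewrite -ler0c -rnormE. Qed.

Lemma rnormD u v : rnorm (u + v) <= rnorm u + rnorm v.
Proof. by rewrite -lecR rmorphD /= -!rnormE ler_normD. Qed.

Lemma rnormN v : rnorm (- v) = rnorm v.
Proof. by rewrite /rnorm normrN. Qed.

Lemma rnormZ z v : rnorm (z *: v) = normc z * rnorm v.
Proof. by apply: complexI; rewrite -rnormE normrZ rmorphM /= -rnormE. Qed.

Lemma rnorm0 : rnorm 0 = 0.
Proof. by rewrite /rnorm normr0. Qed.

Lemma rnorm_eq0 v : rnorm v = 0 -> v = 0.
Proof. by move=> v0; apply/normr0_eq0; rewrite rnormE v0. Qed.

Lemma rnorm_eq0_or_gt0 v : rnorm v = 0 \/ 0 < rnorm v.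
Proof.
have := rnorm_ge0 v; rewrite le_eqVlt => /orP[/eqP|]; first by left.
by right.
Qed.

Lemma op_boundE (x : R[i]) (M : R) u v :
  (`|x| <= M%:C * `|u| * `|v|) = (normc x <= M * rnorm u * rnorm v).
Proof. by rewrite normcE !rnormE -!rmorphM lecR. Qed.

Lemma dual_boundE (x : R[i]) (M : R) v :
  (`|x| <= M%:C * `|v|) = (normc x <= M * rnorm v).
Proof. by rewrite normcE rnormE -rmorphM lecR. Qed.

Lemma nbhs_normcP z (A : set R[i]) :
  nbhs z A <-> exists2 e : R, 0 < e & forall w, normc (w - z) < e -> A w.
Proof.
rewrite -nbhs_ballE; split=> [[e /= e0 H]|[e e0 H]].
  have eE : e = (complex.Re e)%:C.
    by move: e0; rewrite ltcE; case: (e) => a1 b1 /= /andP[/eqP -> _].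
  exists (complex.Re e); first by rewrite -ltcR -eE.
  move=> w wz; apply: H; rewrite /ball /= eE distrC normcE ltcR //.
exists e%:C => /=; first by rewrite ltcR.
by move=> w; rewrite /ball /= distrC normcE ltcR; exact: H.
Qed.

End RealNorm.

Section Cauchy.
Variable R : realType.
Local Notation normc := (@Normc.normc R).

Lemma real_cauchy (x : nat -> R) :
  (forall e : R, 0 < e -> exists N, forall m n, (N <= m)%N -> (N <= n)%N ->
     `|x m - x n| <= e) ->
  exists l, forall e : R, 0 < e -> exists N, forall n, (N <= n)%N -> `|x n - l| <= e.
Proof.
move=> H; have : cvg (x @ \oo).
  apply/cauchy_cvgP/cauchy_exP => e e0.
  have [N NP] := H (e / 2) ltac:(by rewrite divr_gt0).
  exists (x N); exists N => // n /= nN; rewrite /ball /=.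
  apply: le_lt_trans (NP _ _ (leqnn N) nN) _.
  by rewrite ltr_pdivrMr // ltr_pMr // ltr1n.
move=> /cvg_ex[l /cvgrPdist_le xl]; exists l => e /xl [N _ NP]; exists N => n nN.
by rewrite distrC; exact: NP.
Qed.

Lemma complex_cauchy (x : nat -> R[i]) :
  (forall e : R, 0 < e -> exists N, forall m n, (N <= m)%N -> (N <= n)%N ->
     normc (x m - x n) <= e) ->
  exists l, forall e : R, 0 < e -> exists N, forall n, (N <= n)%N -> normc (x n - l) <= e.
Proof.
move=> H.
have [a aP] : exists a, forall e : R, 0 < e -> exists N, forall n, (N <= n)%N ->
    `|complex.Re (x n) - a| <= e.
  apply: (@real_cauchy (fun n => complex.Re (x n))) => e /H [N NP].
  by exists N => m n mN nN; apply: le_trans (NP m n mN nN); rewrite -raddfB normc_Re.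
have [b bP] : exists b, forall e : R, 0 < e -> exists N, forall n, (N <= n)%N ->
    `|complex.Im (x n) - b| <= e.
  apply: (@real_cauchy (fun n => complex.Im (x n))) => e /H [N NP].
  by exists N => m n mN nN; apply: le_trans (NP m n mN nN); rewrite -raddfB normc_Im.
exists (a +i* b) => e e0; have e2 : 0 < e / 2 by rewrite divr_gt0.
have [N1 h1] := aP _ e2; have [N2 h2] := bP _ e2.
exists (maxn N1 N2) => n; rewrite geq_max => /andP[/h1 {}h1 /h2 {}h2].
apply: le_trans (normc_le_sum _) _; rewrite !raddfB /=; lra.
Qed.

End Cauchy.

(** * Removing finitely many functionals from a lower bound *)

Section FiniteCodimension.
Variables (R : realType) (X : lmodType R[i]).

Definition seminorm (p : X -> R) : Prop :=
  [/\ forall x, 0 <= p x, forall x y, p (x - y) <= p x + p y &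
      forall (t : R) x, p (t%:C *: x) = `|t| * p x].

(** Only real homogeneity: the functionals to be removed are integrals of real and imaginary parts
    on a complex space. *)
Definition rlinear (l : X -> R) : Prop :=
  (forall x y, l (x - y) = l x - l y) /\ forall (t : R) x, l (t%:C *: x) = t * l x.

Definition dominated (n p : X -> R) : Prop := exists B : R, forall x, p x <= B * n x.

Variable n : X -> R.
Hypothesis n_seminorm : seminorm n.
Hypothesis n_complete : forall x : nat -> X,
  (forall e : R, 0 < e -> exists N, forall i j, (N <= i)%N -> (N <= j)%N ->
     n (x i - x j) <= e) ->
  exists l, forall e : R, 0 < e -> exists N, forall i, (N <= i)%N -> n (x i - l) <= e.

(** If [l] were not bounded by [p], normalising would give [x k] with [l (x k) = 1] and [p (x k)]
    tending to 0. Their differences are annihilated by [l], so the estimate makes the sequence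
    Cauchy for [n]; its limit has [p = 0] and [l = 1], which is excluded. *)
Lemma strip_functional (p l : X -> R) : seminorm p -> dominated n p ->
  rlinear l -> dominated n (fun x => `|l x|) ->
  (forall x, p x = 0 -> l x = 0) ->
  dominated (fun x => p x + `|l x|) n -> dominated p n.
Proof.
move=> [p0 pB pZ] [Bp pn] [lB lZ] [Bl ln] pl [C0 est0].
have [n0 nB nZ] := n_seminorm.
have [C [C1 est]] : exists C : R, 0 < C /\ forall x, n x <= C * (p x + `|l x|).
  exists (`|C0| + 1); split; first by rewrite ltr_wpDl.
  move=> x; apply: le_trans (est0 x) _; rewrite ler_wpM2r ?addr_ge0 //.
  by have := ler_norm C0; lra.
suff [c cP] : exists c : R, forall x, `|l x| <= c * p x.
  exists (C * (1 + c)) => x; apply: le_trans (est x) _.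
  by rewrite -mulrA mulrDl mul1r ler_pM2l // lerD2l.
apply: contrapT => /forallNP H.
have {}H (k : nat) : exists x, l x = 1 /\ p x <= k.+1%:R^-1.
  have /existsNP [x /negP] := H k.+1%:R; rewrite -ltNge => hx.
  have lx0 : 0 < `|l x| by apply: le_lt_trans hx; rewrite mulr_ge0.
  have lx : l x != 0 by rewrite -normr_gt0.
  exists ((l x)^-1%:C *: x); rewrite lZ pZ mulVf //; split=> //.
  rewrite normfV mulrC ler_pdivrMr // -[leRHS]mulrC ler_pdivlMr ?ltr0Sn //.
  by rewrite mulrC ltW.
have [x xP] := choice H.
have small (e : R) : 0 < e -> exists N, forall i, (N <= i)%N -> p (x i) <= e.
  move=> e0; exists (Num.bound e^-1) => i iN.
  have [_ /le_trans] := xP i; apply; rewrite -[leRHS]invrK lef_pV2 ?posrE ?invr_gt0 //.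
  have := archi_boundP (_ : 0 <= e^-1); rewrite invr_ge0 => /(_ (ltW e0)) /ltW /le_trans.
  by apply; rewrite ler_nat ltnW.
have [a aP] : exists a, forall e : R, 0 < e -> exists N, forall i, (N <= i)%N ->
    n (x i - a) <= e.
  apply: n_complete => e e0.
  have e2 : 0 < e / C / 2 by rewrite !divr_gt0.
  have [N NP] := small _ e2; exists N => i j iN jN.
  apply: le_trans (est _) _; rewrite lB !(proj1 (xP _)) subrr normr0 addr0.
  rewrite mulrC -ler_pdivlMr //; apply: le_trans (pB _ _) _.
  by have := NP i iN; have := NP j jN; lra.
have pa : p a = 0.
  apply/le_anti; rewrite p0 andbT; apply/ler_addgt0Pr => e e0; rewrite add0r.
  have e2 : 0 < e / 2 by rewrite divr_gt0.
  have e3 : 0 < e / 2 / (`|Bp| + 1) by rewrite divr_gt0 // ltr_wpDl.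
  have [N1 h1] := small _ e2; have [N2 h2] := aP _ e3.
  have {}h1 := h1 (maxn N1 N2) (leq_maxl _ _).
  have {}h2 := h2 (maxn N1 N2) (leq_maxr _ _).
  set i := maxn _ _ in h1 h2.
  have -> : a = x i - (x i - a) by rewrite subKr.
  apply: le_trans (pB _ _) _.
  suff : p (x i - a) <= e / 2 by lra.
  apply: le_trans (pn _) _; have := n0 (x i - a); have := ler_norm Bp; have := normr_ge0 Bp.
  move: h2; rewrite ler_pdivlMr ?ltr_wpDl //; nra.
have la : l a = 1.
  apply/eqP; rewrite -subr_eq0 -normr_eq0 eq_le normr_ge0 andbT.
  apply/ler_addgt0Pr => e e0; rewrite add0r.
  have e3 : 0 < e / (`|Bl| + 1) by rewrite divr_gt0 // ltr_wpDl.
  have [N2 h2] := aP _ e3; have {}h2 := h2 N2 (leqnn _).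
  rewrite distrC -(proj1 (xP N2)) -lB.
  apply: le_trans (ln _) _; have := n0 (x N2 - a); have := ler_norm Bl.
  have := normr_ge0 Bl; move: h2; rewrite ler_pdivlMr ?ltr_wpDl //; nra.
by have := pl a pa; rewrite la => /eqP; rewrite oner_eq0.
Qed.

(** The induction varies the seminorm: the tail of the list is removed for [p + |l|], which is
    definite as well, and [l] itself comes last. *)
Lemma strip_functionals (ls : seq (X -> R)) (p : X -> R) : seminorm p -> dominated n p ->
  (forall x, p x = 0 -> x = 0) ->
  (forall i, (i < size ls)%N -> rlinear (nth (fun=> 0) ls i) /\
     dominated n (fun x => `|nth (fun=> 0) ls i x|)) ->
  dominated (fun x => p x + \sum_(l <- ls) `|l x|) n -> dominated p n.
Proof.
elim: ls p => [|l ls IH] p sp np pd lsP est.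
  by have [C CP] := est; exists C => x; have := CP x; rewrite big_nil addr0.
have [p0 pB pZ] := sp; have [Bp pn] := np.
have [[lB lZ] [Bl ln]] : rlinear l /\ dominated n (fun x => `|l x|) := lsP 0%N isT.
apply: (@strip_functional _ l) => //; first by exists Bl.
- by move=> x /pd ->; have := lB 0 0; rewrite !subrr.
apply: IH.
- split=> [x|x y|t x]; first by rewrite addr_ge0.
  + rewrite lB; have := pB x y; have := ler_normB (l x) (l y); lra.
  + by rewrite pZ lZ normrM mulrDr.
- by exists (Bp + Bl) => x; rewrite mulrDl lerD.
- move=> x h; apply: pd; apply/le_anti; rewrite p0 andbT -h lerDl //.
- by move=> i ils; exact: (lsP i.+1).
- have [C CP] := est; exists C => x; apply: le_trans (CP x) _.
  by rewrite big_cons addrA.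
Qed.

End FiniteCodimension.

Section DualNorm.
Variables (R : realType) (V : normedModType R[i]).
Local Notation normc := (@Normc.normc R).
Implicit Types f g : V -> R[i].

Definition bounded_functional f := exists K : R, forall v, normc (f v) <= K * rnorm v.

(** Null vectors enter with quotient 0, through [invr0]. The value is meaningful for bounded
    functionals only. *)
Definition dual_norm f : R := sup [set normc (f v) / rnorm v | v in [set: V]].

Lemma dual_norm_le f K : 0 <= K -> (forall v, normc (f v) <= K * rnorm v) ->
  dual_norm f <= K.
Proof.
move=> K0 H; apply: ge_sup; first by exists (normc (f 0) / rnorm (0 : V)), 0.
move=> _ [v _ <-]; have [->|v0] := rnorm_eq0_or_gt0 v.
  by rewrite invr0 mulr0.
by rewrite ler_pdivrMr.
Qed.

Lemma dual_normP f v : bounded_functional f -> normc (f v) <= dual_norm f * rnorm v.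
Proof.
move=> [K H]; have [v0|v0] := rnorm_eq0_or_gt0 v.
  by have := H v; rewrite v0 !mulr0.
rewrite -ler_pdivrMr //; apply: ub_le_sup; last by exists v.
exists `|K| => _ [w _ <-]; have [->|w0] := rnorm_eq0_or_gt0 w.
  by rewrite invr0 mulr0.
rewrite ler_pdivrMr //; apply: le_trans (H w) _.
by rewrite ler_wpM2r ?ler_norm // ltW.
Qed.

Lemma dual_norm_ge0 f : bounded_functional f -> 0 <= dual_norm f.
Proof.
move=> [K H]; apply: (@le_trans _ _ (normc (f 0) / rnorm (0 : V))).
  by rewrite divr_ge0 ?normc_ge0 ?rnorm_ge0.
apply: ub_le_sup; last by exists 0.
exists `|K| => _ [w _ <-]; have [->|w0] := rnorm_eq0_or_gt0 w.
  by rewrite invr0 mulr0.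
rewrite ler_pdivrMr //; apply: le_trans (H w) _.
by rewrite ler_wpM2r ?ler_norm // ltW.
Qed.

End DualNorm.

(** * Local Taylor estimates in operator norm *)

Section Newton.
Variables (R : realType) (V : normedModType R[i]).
Local Notation normc := (@Normc.normc R).
Variables (D : set R[i]) (T T' : R[i] -> V -> V -> R[i]).
Hypothesis D_open : open D.
Hypothesis T'_def : forall z, D z -> op_derive T z (T' z).
Hypothesis T_bounded : forall z, D z -> bounded_op (T z).

Lemma bounded_op_bound (A : V -> V -> R[i]) : bounded_op A ->
  exists M : R, 0 <= M /\ forall u v, normc (A u v) <= M * rnorm u * rnorm v.
Proof.
move=> [_ _ [M MP]]; exists `|M|; split=> // u v.
have := MP u v; rewrite op_boundE => /le_trans; apply.
by rewrite ler_wpM2r ?rnorm_ge0 // ler_wpM2r ?rnorm_ge0 // ler_norm.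
Qed.

Lemma op_deriveP z A : op_derive T z A -> forall e : R, 0 < e ->
  exists2 del : R, 0 < del & forall h, normc h < del -> forall u v,
    normc (T (z + h) u v - T z u v - h * A u v) <= e * normc h * rnorm u * rnorm v.
Proof.
move=> [_ H] e e0; have /nbhs_normcP[del del0 {}H] := H e e0.
exists del => // h hd u v.
by have := H h; rewrite subr0 => /(_ hd u v); rewrite !normcE !rnormE -!rmorphM lecR.
Qed.

Lemma open_normcP ws : D ws -> exists2 e : R, 0 < e & forall w, normc (w - ws) < e -> D w.
Proof.
move=> Dws; have /nbhs_normcP[e e0 H] : nbhs ws D by apply: open_nbhs_nbhs; split.
by exists e.
Qed.

Lemma op_cderiv z u v : D z -> cderiv (fun w => T w u v) z (T' z u v).
Proof.
move=> Dz e e0; have u0 := rnorm_ge0 u; have v0 := rnorm_ge0 v.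
have q0 : 0 < rnorm u * rnorm v + 1 by rewrite ltr_wpDl // mulr_ge0.
have [del del0 H] := op_deriveP (T'_def Dz) (divr_gt0 e0 q0).
exists del => // h /H {}H; apply: le_trans (H u v) _.
have -> : e / (rnorm u * rnorm v + 1) * normc h * rnorm u * rnorm v =
  e * normc h * (rnorm u * rnorm v / (rnorm u * rnorm v + 1)).
  by field; rewrite gt_eqF.
rewrite ler_piMr ?mulr_ge0 ?normc_ge0 ?(ltW e0) //.
by rewrite ler_pdivrMr // mul1r lerDl.
Qed.

(** The derivative at the single point [ws] already bounds [T] in operator norm on a disc. The
    scalar function [T w u v] is thus at most [B * rnorm u * rnorm v], and as [cderiv_lipschitz] is
    linear in its bound, the resulting [L] is free of [u] and [v]. *)
Lemma op_locally_smooth ws : D ws -> exists rho L : R,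
  [/\ 0 < rho, 0 <= L, forall z, normc (z - ws) < rho -> D z,
   forall z z', normc (z - ws) < rho -> normc (z' - ws) < rho -> forall u v,
     normc (T' z u v - T' z' u v) <= L * normc (z - z') * rnorm u * rnorm v &
   forall z z', normc (z - ws) < rho -> normc (z' - ws) < rho -> forall u v,
     normc (T z u v - T z' u v - (z - z') * T' z' u v)
       <= L * normc (z - z') ^+ 2 * rnorm u * rnorm v].
Proof.
move=> Dws.
have [r1 r10 H1] := open_normcP Dws.
have [r2 r20 H2] := op_deriveP (T'_def Dws) ltr01.
have [M [M0 MP]] := bounded_op_bound (T_bounded Dws).
have [M' [M'0 M'P]] := bounded_op_bound (T'_def Dws).1.
pose rho := Num.min (Num.min r1 r2) 1.
have rho0 : 0 < rho by rewrite !lt_min r10 r20 ltr01.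
have rhoD h : normc h < rho -> D (ws + h).
  by rewrite !lt_min => /andP[/andP[hr _] _]; apply: H1; rewrite addrAC subrr add0r.
(* [T ws], the linear term and the remainder (taken with [e = 1]) contribute [M], [M'] and 1,
   because [normc h < rho <= 1]. *)
pose B := M + M' + 1.
have TB h u v : normc h < rho -> normc (T (ws + h) u v) <= B * rnorm u * rnorm v.
  rewrite !lt_min => /andP[/andP[_ /H2 hr] h1].
  have E : T (ws + h) u v = (T (ws + h) u v - T ws u v - h * T' ws u v)
    + T ws u v + h * T' ws u v by ring.
  rewrite E; apply: le_trans (normcD _ _) _; apply: le_trans (lerD (normcD _ _) (lexx _)) _.
  have A1 := hr u v; have A2 := MP u v; have A3 := M'P u v.
  have u0 := rnorm_ge0 u; have v0 := rnorm_ge0 v; have n0 := normc_ge0 h.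
  rewrite Normc.normcM.
  have q0 : 0 <= rnorm u * rnorm v by rewrite mulr_ge0.
  move: A1 A2 A3; rewrite /B -!mulrA !mul1r; move: (rnorm u * rnorm v) q0 => q q0 A1 A2 A3.
  have A4 : normc h * normc (T' ws u v) <= M' * q.
    by apply: le_trans (ler_wpM2l n0 A3) _; rewrite ler_piMl ?mulr_ge0 // ltW.
  have A5 : normc h * q <= q by rewrite ler_piMl // ltW.
  by apply: le_trans (lerD (lerD A1 A2) A4) _; nra.
pose L := 128 * B / rho ^+ 2.
have B0 : 0 <= B by rewrite /B; lra.
have L0 : 0 <= L by rewrite divr_ge0 ?mulr_ge0 ?exprn_ge0 // ltW.
have q4 : 0 < rho / 4 by rewrite divr_gt0.
have sub z : normc (z - ws) < rho / 4 -> D z.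
  by move=> h; rewrite -(subrKC ws z); apply: rhoD; lra.
have lip z z' : normc (z - ws) < rho / 4 -> normc (z' - ws) < rho / 4 -> forall u v,
     normc (T' z u v - T' z' u v) <= L * normc (z - z') * rnorm u * rnorm v.
  move=> hz hz' u v.
  have /= := @cderiv_lipschitz R (fun h => T (ws + h) u v) (fun h => T' (ws + h) u v)
    rho (B * rnorm u * rnorm v) rho0 _ (fun h => @TB h u v) (z - ws) (z' - ws) hz hz'.
  rewrite !subrKC opprB addrA subrK => h; apply: le_trans (h _) _ => {h}.
    move=> h' /rhoD /(@op_cderiv _ u v) hd e /hd [del del0 hd']; exists del => // k /hd'.
    by rewrite addrA.
  by rewrite le_eqVlt; apply/orP; left; apply/eqP; rewrite /L; ring.
exists (rho / 4), L; split=> // z z' hz hz' u v.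
have seg (t : R) : 0 <= t <= 1 -> normc (z' + t%:C * (z - z') - ws) < rho / 4.
  move=> t01; have := normc_segment hz hz' t01.
  rewrite (_ : z - ws - (z' - ws) = z - z'); last by ring.
  by rewrite (_ : z' - ws + t%:C * (z - z') = z' + t%:C * (z - z') - ws); last by ring.
(* Subtracting the tangent at [z'] leaves the derivative [T' x - T' z'], of size
   [L * normc (z - z')] on the segment; [x * 0] is what the product rule produces. *)
have := @mean_value_cderiv R (fun x => T x u v + x * - T' z' u v)
  (fun x => T' x u v + 1 * - T' z' u v + x * 0) z z'
  (L * normc (z - z') * rnorm u * rnorm v).
rewrite (_ : T z u v + _ - _ = T z u v - T z' u v - (z - z') * T' z' u v); last by ring.
move=> h; apply: le_trans (h _ _) _ => {h}.
- move=> t t01; rewrite -addrA; apply: cderivD; first exact/op_cderiv/sub/seg.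
  by apply: cderivM; [exact: cderiv_id|exact: cderiv_cst].
- move=> t t01; rewrite mulr0 addr0 mul1r; apply: le_trans (lip _ _ (seg t t01) hz' u v) _.
  rewrite ler_wpM2r ?rnorm_ge0 // ler_wpM2r ?rnorm_ge0 // ler_wpM2l //.
  rewrite addrC addKr Normc.normcM normc_real; have /andP[t0 t1] := t01.
  by rewrite ger0_norm // ler_piMl ?normc_ge0.
by rewrite le_eqVlt; apply/orP; left; apply/eqP; ring.
Qed.

End Newton.

(** * Completeness and the lower bound for the bordered operator *)

Section LowerBound.
Variables (R : realType) (V : normedModType R[i]).
Local Notation normc := (@Normc.normc R).

Definition norm_complete : Prop := forall x : nat -> V,
  (forall e : R, 0 < e -> exists N, forall i j, (N <= i)%N -> (N <= j)%N ->
     rnorm (x i - x j) <= e) ->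
  exists l, forall e : R, 0 < e -> exists N, forall i, (N <= i)%N -> rnorm (x i - l) <= e.

(** The functionals [A (x n)] converge pointwise, and their limit is antilinear and bounded, hence
    equals [A u] for some [u]. The convergence of the images holds even in the dual norm, so the
    bounded inverse carries it back to [x]. *)
Lemma op_invertible_complete (A : V -> V -> R[i]) : bounded_op A -> op_invertible A ->
  norm_complete.
Proof.
move=> Ab [surj [M MP]] x xc.
have [M1 [M10 M1P]] := bounded_op_bound Ab; have [AL Aanti _] := Ab.
have AB u w v : A (u - w) v = A u v - A w v.
  by rewrite addrC -scaleN1r AL mulN1r addrC.
have lim v : exists l, forall e : R, 0 < e -> exists N, forall n, (N <= n)%N ->
    normc (A (x n) v - l) <= e.
  apply: complex_cauchy => e e0; have v0 := rnorm_ge0 v.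
  have q0 : 0 < M1 * rnorm v + 1 by rewrite ltr_wpDl // mulr_ge0.
  have [N NP] := xc _ (divr_gt0 e0 q0); exists N => m n mN nN.
  rewrite -AB; apply: le_trans (M1P _ _) _.
  have := NP m n mN nN; rewrite ler_pdivlMr //; have := rnorm_ge0 (x m - x n).
  by rewrite mulrAC; move: (M1 * rnorm v) => q; nra.
have [f fP] := choice lim.
have limU v l : (forall e : R, 0 < e -> exists N, forall n, (N <= n)%N ->
    normc (A (x n) v - l) <= e) -> f v = l.
  move=> H; apply/eqP; rewrite -subr_eq0 -normr_eq0 normcE.
  suff -> : normc (f v - l) = 0 by [].
  apply/le_anti; rewrite normc_ge0 andbT; apply/ler_addgt0Pr => e e0; rewrite add0r.
  have e2 : 0 < e / 2 by rewrite divr_gt0.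
  have [N1 h1] := H _ e2; have [N2 h2] := fP v _ e2.
  have {}h1 := h1 (maxn N1 N2) (leq_maxl _ _).
  have {}h2 := h2 (maxn N1 N2) (leq_maxr _ _).
  rewrite -(subrKA (A (x (maxn N1 N2)) v)); apply: le_trans (normcD _ _) _.
  rewrite normc_distC; lra.
have [N0 N0P] := xc 1 ltr01.
have fB v : normc (f v) <= M1 * (rnorm (x N0) + 1) * rnorm v.
  apply/ler_addgt0Pr => e e0; have [N1 h1] := fP v _ e0.
  have {}h1 := h1 (maxn N0 N1) (leq_maxr _ _).
  have h0 := N0P (maxn N0 N1) N0 (leq_maxl _ _) (leqnn _).
  set n := maxn _ _ in h1 h0.
  rewrite -(subKr (A (x n) v) (f v)); apply: le_trans (normcD _ _) _.
  rewrite normcN; apply: lerD => //; apply: le_trans (M1P _ _) _.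
  rewrite ler_wpM2r ?rnorm_ge0 // ler_wpM2l //.
  by rewrite -(subrK (x N0) (x n)); apply: le_trans (rnormD _ _) _; rewrite addrC lerD2l.
have fdual : in_dual f.
  split; last first.
    by exists (M1 * (rnorm (x N0) + 1)) => v; rewrite dual_boundE.
  move=> c v w; apply: limU => e e0.
  have cq : 0 < normc c^* + 1 by rewrite ltr_wpDl // normc_ge0.
  have [N1 h1] := fP v (e / 2 / (normc c^* + 1)) ltac:(by rewrite !divr_gt0).
  have [N2 h2] := fP w (e / 2) ltac:(by rewrite divr_gt0).
  exists (maxn N1 N2) => n; rewrite geq_max => /andP[/h1 {}h1 /h2 {}h2].
  rewrite Aanti; have -> : c^* * A (x n) v + A (x n) w - (c^* * f v + f w) =
    c^* * (A (x n) v - f v) + (A (x n) w - f w) by ring.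
  apply: le_trans (normcD _ _) _; rewrite Normc.normcM.
  move: h1; rewrite ler_pdivlMr // => h1.
  have := normc_ge0 (A (x n) v - f v); have := normc_ge0 c^*; nra.
have [u [Au _]] := surj f fdual.
exists u => e e0.
have q0 : 0 < `|M| * M1 + 1 by rewrite ltr_wpDl // mulr_ge0.
have e1 : 0 < e / (`|M| * M1 + 1) by rewrite divr_gt0.
have [N NP] := xc _ e1; exists N => i iN.
have K0 : 0 <= M1 * (e / (`|M| * M1 + 1)) by rewrite mulr_ge0 // ltW.
have := MP (x i - u) _ K0; rewrite rnormE lecR => h; apply: le_trans (h _) _ => {h}.
  move=> v; rewrite dual_boundE AB Au; apply/ler_addgt0Pr => e' e'0.
  have [N1 h1] := fP v _ e'0.
  have {}h1 := h1 (maxn N N1) (leq_maxr _ _).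
  have h0 := NP i (maxn N N1) iN (leq_maxl _ _).
  rewrite -(subrKA (A (x (maxn N N1)) v)); apply: le_trans (normcD _ _) _.
  apply: lerD => //; rewrite -AB; apply: le_trans (M1P _ _) _.
  by rewrite ler_wpM2r ?rnorm_ge0 // ler_wpM2l.
apply: le_trans (ler_wpM2r K0 (ler_norm M)) _.
have -> : `|M| * (M1 * (e / (`|M| * M1 + 1))) = e * (`|M| * M1 / (`|M| * M1 + 1)).
  by field; rewrite gt_eqF.
rewrite ler_piMr ?(ltW e0) //.
by rewrite ler_pdivrMr // mul1r lerDl.
Qed.

Definition bounded_rlinear (l : V -> R) : Prop :=
  rlinear l /\ dominated (@rnorm R V) (fun x => `|l x|).

(** On pairs [(s, nu)] let [p] be the dual norm of the bordered functional plus the modulus of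
    [P s]. Injectivity says that [p] is definite; the estimate for [A] bounds the product norm by
    [p] and finitely many functionals, and [strip_functionals] removes these. *)
Lemma bordered_lower_bound (A : V -> V -> R[i]) (g P : V -> R[i])
    (ls : seq (V -> R)) (C0 : R) :
  norm_complete -> bounded_op A -> in_dual g ->
  (forall c u w, P (c *: u + w) = c * P u + P w) ->
  (exists B : R, forall u, normc (P u) <= B * rnorm u) ->
  (forall i, (i < size ls)%N -> bounded_rlinear (nth (fun=> 0) ls i)) ->
  (forall u K, 0 <= K -> (forall v, normc (A u v) <= K * rnorm v) ->
     rnorm u <= C0 * (K + \sum_(l <- ls) `|l u|)) ->
  (forall s nu, (forall v, A s v + nu * g v = 0) -> P s = 0 -> s = 0 /\ nu = 0) ->
  exists C : R, 0 < C /\ forall s nu K, 0 <= K ->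
    (forall v, normc (A s v + nu * g v) <= K * rnorm v) -> P s = 0 ->
    rnorm s + normc nu <= C * K.
Proof.
move=> Vc Ab [_ [Mg Mgb]] PL [BP BPP] lsP est inj.
have [M1 [M10 M1P]] := bounded_op_bound Ab; have [AL _ _] := Ab.
have AB u w v : A (u - w) v = A u v - A w v.
  by rewrite addrC -scaleN1r AL mulN1r addrC.
have AZ c u v : A (c *: u) v = c * A u v.
  by have := AL c u 0 v; have := AB 0 0 v; rewrite !subrr addr0 => ->; rewrite addr0.
have PB u w : P (u - w) = P u - P w by rewrite addrC -scaleN1r PL mulN1r addrC.
have PZ c u : P (c *: u) = c * P u.
  by have := PL c u 0; have := PB 0 0; rewrite !subrr addr0 => ->; rewrite addr0.
have gB v : normc (g v) <= `|Mg| * rnorm v.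
  have := Mgb v; rewrite dual_boundE => /le_trans; apply.
  by rewrite ler_wpM2r ?rnorm_ge0 // ler_norm.
pose X : lmodType R[i] := (V * R[i]^o)%type.
pose n (x : X) : R := rnorm x.1 + normc x.2.
pose J (x : X) v : R[i] := A x.1 v + x.2 * g v.
have Jb (x : X) : bounded_functional (J x).
  exists (M1 * rnorm x.1 + normc x.2 * `|Mg|) => v; rewrite mulrDl.
  apply: le_trans (normcD _ _) _; rewrite Normc.normcM lerD //.
  by rewrite -mulrA ler_wpM2l ?normc_ge0.
pose p (x : X) : R := dual_norm (J x) + normc (P x.1).
have n0 x : 0 <= n x by rewrite addr_ge0 ?rnorm_ge0 ?normc_ge0.
have Jsub x y v : J (x - y) v = J x v - J y v.
  by rewrite /J /= AB; ring.
have JZ (t : R) x v : J (t%:C *: x) v = t%:C * J x v.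
  by rewrite /J /= AZ /GRing.scale /= ; ring.
have n_semi : seminorm n.
  split=> // [x y|t x].
    rewrite /n /=; have := rnormD x.1 (- y.1); have := normcD x.2 (- y.2).
    rewrite rnormN normcN; lra.
  by rewrite /n /= rnormZ normc_real [_ *: x.2]/(t%:C * x.2) Normc.normcM normc_real mulrDr.
have n_compl (x : nat -> X) :
    (forall e : R, 0 < e -> exists N, forall i j, (N <= i)%N -> (N <= j)%N ->
     n (x i - x j) <= e) ->
    exists l, forall e : R, 0 < e -> exists N, forall i, (N <= i)%N -> n (x i - l) <= e.
  move=> xc.
  have [a aP] : exists l, forall e : R, 0 < e -> exists N, forall i, (N <= i)%N ->
      rnorm ((x i).1 - l) <= e.
    apply: Vc => e /xc [N NP]; exists N => i j iN jN.
    by apply: le_trans (NP i j iN jN); rewrite /n lerDl normc_ge0.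
  have [b bP] : exists l, forall e : R, 0 < e -> exists N, forall i, (N <= i)%N ->
      normc ((x i).2 - l) <= e.
    apply: (@complex_cauchy R (fun i => (x i).2)) => e /xc [N NP]; exists N => i j iN jN.
    by apply: le_trans (NP i j iN jN); rewrite /n lerDr rnorm_ge0.
  exists (a, b) => e e0; have e2 : 0 < e / 2 by rewrite divr_gt0.
  have [N1 h1] := aP _ e2; have [N2 h2] := bP _ e2.
  exists (maxn N1 N2) => i; rewrite geq_max => /andP[/h1 {}h1 /h2 {}h2].
  rewrite /n /=; lra.
have dn0 x : 0 <= dual_norm (J x) by exact: dual_norm_ge0.
have p_semi : seminorm p.
  split=> [x|x y|t x]; first by rewrite addr_ge0 ?normc_ge0.
    rewrite /p PB; have := normcD (P x.1) (- P y.1); rewrite normcN.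
    suff : dual_norm (J (x - y)) <= dual_norm (J x) + dual_norm (J y) by lra.
    apply: dual_norm_le; first by rewrite addr_ge0.
    move=> v; rewrite Jsub mulrDl; apply: le_trans (normcD _ _) _.
    by rewrite normcN lerD // dual_normP.
  rewrite /p PZ Normc.normcM normc_real mulrDr; congr (_ + _).
  have scal (c : R) y : dual_norm (J (c%:C *: y)) <= `|c| * dual_norm (J y).
    apply: dual_norm_le; first by rewrite mulr_ge0.
    move=> v; rewrite JZ Normc.normcM normc_real -mulrA ler_wpM2l // dual_normP //.
  apply/le_anti; rewrite scal /=.
  have [->|t0] := eqVneq t 0; first by rewrite normr0 mul0r.
  have := scal t^-1 (t%:C *: x); rewrite scalerA -rmorphM mulVf // scale1r normfV.
  by rewrite ler_pdivlMl ?normr_gt0.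
have p_dom : dominated n p.
  exists (M1 + `|Mg| + `|BP|) => x.
  have h : dual_norm (J x) <= M1 * rnorm x.1 + normc x.2 * `|Mg|.
    apply: dual_norm_le; first by rewrite addr_ge0 // mulr_ge0 ?rnorm_ge0 ?normc_ge0.
    move=> v; rewrite mulrDl; apply: le_trans (normcD _ _) _; rewrite Normc.normcM lerD //.
    by rewrite -mulrA ler_wpM2l ?normc_ge0.
  have h2 := BPP x.1; rewrite /p /n.
  have := rnorm_ge0 x.1; have := normc_ge0 x.2; have := normr_ge0 Mg.
  have := normr_ge0 BP; have := ler_norm BP.
  by move: (rnorm x.1) (normc x.2) h h2 => r1 r2 h h2 ? ? ? ? ?; nra.
have p_def x : p x = 0 -> x = 0.
  move=> px; have d0 : dual_norm (J x) = 0.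
    by apply/le_anti; rewrite dn0 andbT -px /p lerDl normc_ge0.
  have P0 : normc (P x.1) = 0.
    by apply/le_anti; rewrite normc_ge0 andbT -px /p lerDr.
  have [||x1 x2] := inj x.1 x.2; last by rewrite [x]surjective_pairing x1 x2.
    move=> v; apply/Normc.eq0_normc/le_anti; rewrite normc_ge0 andbT.
    by have := dual_normP v (Jb x); rewrite d0 mul0r.
  exact: Normc.eq0_normc.
(* The estimate [est] speaks of [A] alone. Passing from [A s] to [A s + nu * g] costs a multiple of
   the modulus of [nu], which is paid for by its two real coordinates. *)
pose ms : seq (X -> R) := (fun x : X => complex.Re x.2) :: (fun x : X => complex.Im x.2)
   :: map (fun l (x : X) => l x.1) ls.
have [||B BP2] := @strip_functionals R X n n_semi n_compl ms p p_semi p_dom p_def.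
- move=> [|[|i]] /=.
  + move=> _; split; first split.
    * by move=> x y; rewrite raddfB.
    * move=> t x; have -> : (t%:C *: x).2 = t%:C * x.2 by [].
      by case: (x.2) => a b /=; ring.
    by exists 1 => x; rewrite mul1r; apply: le_trans (normc_Re _) _; rewrite lerDr rnorm_ge0.
  + move=> _; split; first split.
    * by move=> x y; rewrite raddfB.
    * move=> t x; have -> : (t%:C *: x).2 = t%:C * x.2 by [].
      by case: (x.2) => a b /=; ring.
    by exists 1 => x; rewrite mul1r; apply: le_trans (normc_Im _) _; rewrite lerDr rnorm_ge0.
  + rewrite size_map !ltnS => ils.
    have -> : nth (fun=> 0) [seq (fun x : X => l x.1) | l <- ls] i =
        fun x : X => nth (fun=> 0) ls i x.1.
      by rewrite (nth_map (fun=> 0)).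
    have [[lB lZ] [Bl BlP]] := lsP i ils.
    split; first by split=> [x y|t x]; [rewrite lB|rewrite lZ].
    exists `|Bl| => x; apply: le_trans (BlP _) _.
    apply: le_trans (ler_wpM2r (rnorm_ge0 _) (ler_norm Bl)) _.
    by rewrite ler_wpM2l // lerDl normc_ge0.
- exists (`|C0| * (1 + `|Mg|) + 1) => x; rewrite !big_cons big_map.
  set S := \sum_(l <- ls) _.
  have S0 : 0 <= S by exact: sumr_ge0.
  have K0 : 0 <= dual_norm (J x) + normc x.2 * `|Mg|.
    by rewrite addr_ge0 // mulr_ge0 // normc_ge0.
  have h : rnorm x.1 <= `|C0| * (dual_norm (J x) + normc x.2 * `|Mg| + S).
    apply: le_trans (est x.1 _ K0 _) _; last first.
      by rewrite ler_wpM2r ?ler_norm // addr_ge0.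
    move=> v; have -> : A x.1 v = J x v - x.2 * g v by rewrite /J addrK.
    apply: le_trans (normcD _ _) _; rewrite normcN Normc.normcM mulrDl.
    by rewrite lerD ?dual_normP // -mulrA ler_wpM2l ?normc_ge0.
  have h2 := normc_le_sum x.2.
  rewrite /p /n; have := dn0 x; have := normc_ge0 (P x.1); have := normc_ge0 x.2.
  have := normr_ge0 C0; have := normr_ge0 Mg.
  move: (dual_norm _) (normc (P _)) (normc x.2) (`|C0|) (`|Mg|) h h2 S0.
  move: (`|complex.Re _|) (`|complex.Im _|) => r1 r2 d q m c g' h h2 S0 g0 c0 m0 q0 d0.
  have e1 : m * g' <= (r1 + r2) * g' by rewrite ler_wpM2r.
  have hW : d + m * g' + S <= (1 + g') * (d + q + (r1 + (r2 + S))).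
    have : 0 <= g' * (d + q + S) by rewrite mulr_ge0 ?addr_ge0.
    have : 0 <= r1 + r2 by exact: le_trans h2.
    by nra.
  have hr : r1 + r2 <= d + q + (r1 + (r2 + S)) by lra.
  apply: le_trans (lerD (le_trans h (ler_wpM2l c0 hW)) (le_trans h2 hr)) _.
  by rewrite [leRHS]mulrDl mul1r mulrA.
exists (`|B| + 1); split; first by rewrite ltr_wpDl.
move=> s nu K K0 H Ps.
have := BP2 (s, nu); rewrite /p /n /= Ps Normc.normc0 addr0 => /le_trans; apply.
have d1 : dual_norm (J (s, nu)) <= K by exact: dual_norm_le.
have d2 := dn0 (s, nu).
have := ler_norm B; have := normr_ge0 B; move: (dual_norm _) d1 d2 => d; nra.
Qed.

End LowerBound.

(** * Newton's iteration near a simple eigenpair *)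

Section NewtonIteration.
Variables (R : realType) (V : normedModType R[i]).
Local Notation normc := (@Normc.normc R).
Variables (D : set R[i]) (T T' : R[i] -> V -> V -> R[i]) (P : V -> R[i]).
Variables (us : V) (ws : R[i]) (G : set V).

Definition newton_eq (u : V) (w : R[i]) (s : V) (nu : R[i]) : Prop :=
  (forall v, T w s v + nu * T' w u v = - T w u v) /\ P s = 0.

Definition pair_dist (u : V) (w : R[i]) : R := rnorm (u - us) + normc (w - ws).

Hypothesis D_open : open D.
Hypothesis T'_def : forall z, D z -> op_derive T z (T' z).
Hypothesis T_bounded : forall z, D z -> bounded_op (T z).
Hypothesis D_ws : D ws.
Hypothesis eigenpair : forall v, T ws us v = 0.
Hypothesis P_linear : forall c u w, P (c *: u + w) = c * P u + P w.
Hypothesis P_us : P us = 1.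
Hypothesis G_open : open G.
Hypothesis G_us : G us.
Variables (C1 r1 : R).
Hypothesis C1_gt0 : 0 < C1.
Hypothesis r1_gt0 : 0 < r1.
Hypothesis lower_bound : forall s nu K, 0 <= K ->
    (forall v, normc (T ws s v + nu * T' ws us v) <= K * rnorm v) -> P s = 0 ->
    rnorm s + normc nu <= C1 * K.
Hypothesis T_invertible : forall z, D z -> 0 < normc (z - ws) < r1 -> op_invertible (T z).

Let PB u w : P (u - w) = P u - P w.
Proof. by rewrite addrC -scaleN1r P_linear mulN1r addrC. Qed.

Let P0 : P 0 = 0.
Proof. by have := PB 0 0; rewrite !subrr. Qed.

Let PD u w : P (u + w) = P u + P w.
Proof. by rewrite -[u]scale1r P_linear mul1r scale1r. Qed.

Let PZ c u : P (c *: u) = c * P u.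
Proof. by have := P_linear c u 0; rewrite P0 !addr0. Qed.

Lemma open_rnorm : exists2 e : R, 0 < e & forall u, rnorm (u - us) < e -> G u.
Proof.
have : nbhs us G by apply: open_nbhs_nbhs; split.
rewrite -nbhs_ballE => -[e /= e0 H].
have eE : e = (complex.Re e)%:C.
  by move: e0; rewrite ltcE; case: (e) => a1 b1 /= /andP[/eqP -> _].
exists (complex.Re e); first by rewrite -ltcR -eE.
by move=> u hu; apply: H; rewrite -ball_normE /= eE distrC rnormE ltcR.
Qed.

(** At distance [d] from the eigenpair the bordered operator has changed by at most [B * d] in norm,
    so half of the unknown is absorbed and the constant [C1] doubles. *)
Lemma newton_lower_bound : exists r B : R, [/\ 0 < r, 0 <= B,
  forall w, normc (w - ws) < r -> D w,
  forall u w, pair_dist u w < r -> forall s nu K, 0 <= K ->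
    (forall v, normc (T w s v + nu * T' w u v) <= K * rnorm v) -> P s = 0 ->
    rnorm s + normc nu <= 2 * C1 * K &
  forall u w, pair_dist u w < r -> forall v,
    normc (- T w us v + (w - ws) * T' w u v) <= B * pair_dist u w ^+ 2 * rnorm v].
Proof.
have [rho [L [rho0 L0 rhoD lip rem]]] := op_locally_smooth D_open T'_def T_bounded D_ws.
have T'b z : D z -> bounded_op (T' z) by move=> /T'_def [].
have [M [M0 MP]] := bounded_op_bound (T'b ws D_ws).
have U0 := rnorm_ge0 us; set U := rnorm us in U0.
have T'lin z : D z -> forall c u w v, T' z (c *: u + w) v = c * T' z u v + T' z w v.
  by move=> /T'b [].
have T'B z : D z -> forall u w v, T' z (u - w) v = T' z u v - T' z w v.
  by move=> /T'lin H u w v; rewrite addrC -scaleN1r H mulN1r addrC.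
(* Covers both uses: the change of the bordered operator ([M + L] from [s], [M + L * (U + 1)] from
   [nu]) and the Taylor remainder ([M + L + L * U]). *)
pose B := 2 * M + L * (U + 2).
have B0 : 0 <= B by rewrite addr_ge0 ?mulr_ge0 // ?addr_ge0.
(* The bound [d <= 1] turns squares of [d] into [d], and the last entry yields
   [C1 * B * d <= 1 / 2]. *)
pose r := Num.min (Num.min rho 1) (2 * C1 * (B + 1))^-1.
have r0 : 0 < r.
  rewrite !lt_min rho0 ltr01 invr_gt0 !mulr_gt0 //; lra.
have ws0 : normc (ws - ws) < rho by rewrite subrr Normc.normc0.
have rP u w : pair_dist u w < r -> [/\ normc (w - ws) < rho, pair_dist u w <= 1 &
    2 * C1 * (B + 1) * pair_dist u w <= 1].
  rewrite !lt_min => /andP[/andP[h1 h2] h3]; split; last 2 first.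
  - exact: ltW.
  - by rewrite mulrC -ler_pdivlMr ?div1r ?(ltW h3) // !mulr_gt0 //; lra.
  - by apply: le_lt_trans h1; rewrite lerDr rnorm_ge0.
have T'bound z u v : normc (z - ws) < rho -> normc (z - ws) <= 1 ->
    normc (T' z u v) <= (M + L) * rnorm u * rnorm v.
  move=> hz hz1; rewrite -(subrK (T' ws u v) (T' z u v)).
  apply: le_trans (normcD _ _) _; have h1 := lip z ws hz ws0 u v; have h2 := MP u v.
  apply: le_trans (lerD h1 h2) _; rewrite !mulrDl addrC lerD2l.
  by rewrite ler_wpM2r ?rnorm_ge0 // ler_wpM2r ?rnorm_ge0 // ler_piMr.
exists r, B; split=> //.
- by move=> w; rewrite !lt_min => /andP[/andP[h1 _] _]; apply: rhoD.
- move=> u w /rP[hw d1 dr] s nu K K0 H Ps.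
  set d := pair_dist u w in d1 dr.
  have [du dw] : rnorm (u - us) <= d /\ normc (w - ws) <= d.
    by rewrite /d /pair_dist lerDl lerDr rnorm_ge0 normc_ge0.
  have d0 : 0 <= d by rewrite addr_ge0 ?rnorm_ge0 ?normc_ge0.
  set x := rnorm s + normc nu.
  have x0 : 0 <= x by rewrite addr_ge0 ?rnorm_ge0 ?normc_ge0.
  have s0 := rnorm_ge0 s; have nu0 := normc_ge0 nu.
  suff : x <= C1 * (K + B * d * x).
    have h : C1 * B * d <= 1 / 2.
      have : 0 <= C1 * d by rewrite mulr_ge0 // ltW.
      by move: dr; lra.
    have h2 := ler_wpM2r x0 h.
    by rewrite mulrDr => h3; nra.
  apply: lower_bound => //; first by rewrite addr_ge0 ?mulr_ge0.
  move=> v; have v0 := rnorm_ge0 v.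
  have -> : T ws s v + nu * T' ws us v = (T w s v + nu * T' w u v)
     - (T w s v - T ws s v - (w - ws) * T' ws s v) - (w - ws) * T' ws s v
     - nu * (T' w u v - T' ws u v) - nu * T' ws (u - us) v.
    by rewrite (T'B ws D_ws); ring.
  have a1 := H v; have a2 := rem w ws hw ws0 s v; have a3 := MP s v.
  have a4 := lip w ws hw ws0 u v; have a5 := MP (u - us) v.
  have q0 : 0 <= rnorm s * rnorm v by rewrite mulr_ge0.
  have b2 : L * normc (w - ws) ^+ 2 * rnorm s * rnorm v <= L * d * (rnorm s * rnorm v).
    rewrite -mulrA ler_wpM2r // ler_wpM2l // expr2.
    by apply: (le_trans _ dw); rewrite ler_piMr ?normc_ge0 // (le_trans dw d1).
  have b3 : normc (w - ws) * normc (T' ws s v) <= d * (M * (rnorm s * rnorm v)).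
    by rewrite ler_pM ?normc_ge0 // mulrA.
  have uU : rnorm u <= U + 1.
    by rewrite -(subrK us u); apply: le_trans (rnormD _ _) _; rewrite addrC lerD2l; lra.
  have b4 : normc nu * normc (T' w u v - T' ws u v) <= normc nu * (L * d * (U + 1) * rnorm v).
    rewrite ler_wpM2l //; apply: le_trans a4 _; rewrite ler_wpM2r //.
    by rewrite ler_pM ?rnorm_ge0 // ?mulr_ge0 ?normc_ge0 // ler_wpM2l.
  have b5 : normc nu * normc (T' ws (u - us) v) <= normc nu * (M * d * rnorm v).
    rewrite ler_wpM2l //; apply: le_trans a5 _; rewrite ler_wpM2r //.
    by rewrite ler_wpM2l.
  have tri (p q : R[i]) : normc (p - q) <= normc p + normc q.
    by apply: le_trans (normcD _ _) _; rewrite normcN.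
  apply: le_trans (tri _ _) _; apply: le_trans (lerD (tri _ _) (lexx _)) _.
  apply: le_trans (lerD (lerD (tri _ _) (lexx _)) (lexx _)) _.
  apply: le_trans (lerD (lerD (lerD (tri _ _) (lexx _)) (lexx _)) (lexx _)) _.
  rewrite !Normc.normcM.
  have -> : (K + B * d * x) * rnorm v = K * rnorm v + (L * d * (rnorm s * rnorm v)
    + d * (M * (rnorm s * rnorm v)) + normc nu * (L * d * (U + 1) * rnorm v)
    + normc nu * (M * d * rnorm v)) + (M * d * (x * rnorm v) + L * (U + 1) * d * (rnorm s * rnorm v)
     + L * d * (normc nu * rnorm v) ).
    by rewrite /B /x; ring.
  have c1 : 0 <= M * d * (x * rnorm v) by rewrite !mulr_ge0.
  have U1 : 0 <= U + 1 by lra.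
  have c2 : 0 <= L * (U + 1) * d * (rnorm s * rnorm v) by rewrite !mulr_ge0.
  have c3 : 0 <= L * d * (normc nu * rnorm v) by rewrite !mulr_ge0.
  lra.
- move=> u w /rP[hw d1 dr] v; have v0 := rnorm_ge0 v.
  set d := pair_dist u w in d1 dr *.
  have [du dw] : rnorm (u - us) <= d /\ normc (w - ws) <= d.
    by rewrite /d /pair_dist lerDl lerDr rnorm_ge0 normc_ge0.
  have d0 : 0 <= d by rewrite addr_ge0 ?rnorm_ge0 ?normc_ge0.
  have Dw := rhoD _ hw.
  (* Taylor's formula is centred at [w], where the Newton step takes its derivative; exchanging [us]
     for [u] under [T'] is an error of second order too. *)
  have -> : - T w us v + (w - ws) * T' w u v =
    (T ws us v - T w us v - (ws - w) * T' w us v) + (w - ws) * T' w (u - us) v.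
    by rewrite eigenpair (T'B w Dw); ring.
  apply: le_trans (normcD _ _) _; rewrite Normc.normcM.
  have a1 := rem ws w ws0 hw us v; have a2 := T'bound w (u - us) v hw (le_trans dw d1).
  have b1 : L * normc (ws - w) ^+ 2 * rnorm us * rnorm v <= L * d ^+ 2 * U * rnorm v.
    rewrite ler_wpM2r // ler_wpM2r // ler_wpM2l // normc_distC ler_sqr ?nnegrE ?normc_ge0 //.
  have b2 : normc (w - ws) * normc (T' w (u - us) v) <= d * ((M + L) * d * rnorm v).
    rewrite ler_pM ?normc_ge0 //; apply: le_trans a2 _.
    by rewrite ler_wpM2r // ler_wpM2l // addr_ge0.
  apply: le_trans (lerD (le_trans a1 b1) b2) _.
  have -> : B * d ^+ 2 * rnorm v = L * d ^+ 2 * U * rnorm v + d * ((M + L) * d * rnorm v)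
    + (M + L) * d ^+ 2 * rnorm v by rewrite /B; ring.
  have ML : 0 <= M + L by lra.
  by rewrite lerDl; apply: mulr_ge0 => //; apply: mulr_ge0 => //; exact: exprn_ge0.
Qed.

Lemma newton_step : exists r C : R, [/\ 0 < r, 0 < C & forall u w,
  pair_dist u w < r -> P u = 1 ->
  [/\ G u /\ D w, exists s nu, newton_eq u w s nu,
    forall s nu s' nu', newton_eq u w s nu -> newton_eq u w s' nu' -> s' = s /\ nu' = nu &
    forall s nu, newton_eq u w s nu ->
      pair_dist (u + s) (w + nu) <= C * pair_dist u w ^+ 2]].
Proof.
have [r2 [B [r20 B0 r2D lb err]]] := newton_lower_bound.
have [r3 r30 r3G] := open_rnorm.
exists (Num.min (Num.min r1 r2) r3), (2 * C1 * B + 1); split.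
- by rewrite !lt_min r1_gt0 r20.
- by rewrite ltr_wpDl // !mulr_ge0 // ltW.
move=> u w; rewrite !lt_min => /andP[/andP[dr1 dr2] dr3] Pu.
have wd : normc (w - ws) <= pair_dist u w by rewrite lerDr rnorm_ge0.
have Dw : D w by apply: r2D; exact: le_lt_trans dr2.
have Tb := T_bounded Dw; have T'b := (T'_def Dw).1.
have TL := let: And3 h _ _ := Tb in h.
have TB x y v : T w (x - y) v = T w x v - T w y v.
  by rewrite addrC -scaleN1r TL mulN1r addrC.
have T0 v : T w 0 v = 0 by have := TB 0 0 v; rewrite !subrr.
have TZ c x v : T w (c *: x) v = c * T w x v.
  by have := TL c x 0 v; rewrite T0 !addr0.
have inj s nu : (forall v, T w s v + nu * T' w u v = 0) -> P s = 0 -> s = 0 /\ nu = 0.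
  move=> H Ps; have := lb u w dr2 s nu 0 (lexx _) _ Ps.
  rewrite mulr0 => h.
  have {}h : rnorm s + normc nu <= 0.
    by apply: h => v; rewrite H Normc.normc0 mul0r.
  have := rnorm_ge0 s; have := normc_ge0 nu => n0 s0.
  by split; [apply: rnorm_eq0|apply: Normc.eq0_normc]; lra.
split.
- by split=> //; apply: r3G; apply: le_lt_trans dr3; rewrite lerDl normc_ge0.
- have [->|wws] := eqVneq w ws.
    exists (us - u), 0; split; last by rewrite PB P_us Pu subrr.
    have [TwL _ _] := T_bounded D_ws.
    move=> v; rewrite mul0r addr0 addrC -scaleN1r TwL.
    by rewrite eigenpair addr0 mulN1r.
  have [|surj _] := T_invertible Dw.
    by rewrite normc_gt0 subr_eq0 wws; exact: le_lt_trans dr1.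
  have [_ T'anti [M' M'P]] := T'b.
  have gdual : in_dual (T' w u).
    split; first exact: T'anti.
    exists (M' * rnorm u) => v; have := M'P u v.
    by rewrite op_boundE dual_boundE.
  have [a [Ta _]] := surj _ gdual.
  (* Otherwise [(a, -1)] would be a nonzero kernel element of the bordered operator at [(u, w)]. *)
  have Pa : P a != 0.
    apply/eqP => Pa; have [|_ /eqP] := inj a (-1) _ Pa.
      by move=> v; rewrite Ta mulN1r subrr.
    by rewrite oppr_eq0 oner_eq0.
  (* The step equation says [T w (u + s) = - nu * T' w u], so [u + s] is [- nu] times [a], and
     [P (u + s) = 1] determines [nu]. *)
  exists ((P a)^-1 *: a - u), (- (P a)^-1); split; last first.
    by rewrite PB PZ Pu mulVf // subrr.
  by move=> v; rewrite TB TZ Ta; ring.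
- move=> s nu s' nu' [H Ps] [H' Ps'].
  have [||h1 h2] := inj (s' - s) (nu' - nu).
  + move=> v; rewrite TB mulrBl.
    have -> : T w s' v - T w s v + (nu' * T' w u v - nu * T' w u v) =
      (T w s' v + nu' * T' w u v) - (T w s v + nu * T' w u v) by ring.
    by rewrite H H' subrr.
  + by rewrite PB Ps Ps' subrr.
  by split; apply/eqP; rewrite -subr_eq0 ?h1 ?h2.
- move=> s nu [H Ps].
  have d0 : 0 <= pair_dist u w by rewrite addr_ge0 ?rnorm_ge0 ?normc_ge0.
  have K0 : 0 <= B * pair_dist u w ^+ 2 by rewrite mulr_ge0 // exprn_ge0.
  have := lb u w dr2 (u + s - us) (w + nu - ws) _ K0.
  rewrite -[rnorm _ + _]/(pair_dist (u + s) (w + nu)) => h.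
  apply: le_trans (h _ _) _ => {h}.
  + move=> v; have := err u w dr2 v.
    have TD : T w (u + s) v = T w u v + T w s v.
      by rewrite -[u]scale1r TL mul1r scale1r.
    rewrite (_ : T w (u + s - us) v + _ = - T w us v + (w - ws) * T' w u v) //.
    have := H v; rewrite TB TD.
    move=> h; have -> : T w s v = - T w u v - nu * T' w u v by rewrite -h addrK.
    by ring.
  + by rewrite PB PD Pu Ps P_us addr0 subrr.
  by rewrite [leRHS]mulrDl mul1r mulrA lerDl exprn_ge0.
Qed.

Theorem newton_converges : exists r C : R, [/\ 0 < r, 0 < C & forall u0 w0,
  pair_dist u0 w0 < r -> P u0 = 1 ->
  exists (u s : nat -> V) (w nu : nat -> R[i]),
   [/\ u 0%N = u0 /\ w 0%N = w0,
     forall j, [/\ G (u j), D (w j), newton_eq (u j) (w j) (s j) (nu j) &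
       forall s' nu', newton_eq (u j) (w j) s' nu' -> s' = s j /\ nu' = nu j],
     forall j, u j.+1 = u j + s j /\ w j.+1 = w j + nu j,
     forall j, pair_dist (u j) (w j) <= r / 2 ^+ j &
     forall j, pair_dist (u j.+1) (w j.+1) <= C * pair_dist (u j) (w j) ^+ 2]].
Proof.
have [r2 [C [r20 C0 step]]] := newton_step.
(* With [C * d <= 1 / 2] each step at least halves the distance: the iterates stay in the region of
   [newton_step], and the geometric decay gives convergence, which the quadratic estimate alone
   would not. *)
pose r := Num.min r2 (2 * C)^-1.
have r0 : 0 < r by rewrite lt_min r20 invr_gt0 mulr_gt0.
have rr2 : r <= r2 by rewrite ge_min lexx.
have rC : r <= (2 * C)^-1 by rewrite ge_min lexx orbT.
(* Off the good region the value is a default; the invariant [inv] keeps the iterates inside it. *)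
have /choice[f fP] (p : V * R[i]) : exists q : V * R[i],
    pair_dist p.1 p.2 < r2 -> P p.1 = 1 -> newton_eq p.1 p.2 q.1 q.2.
  have [h1|h1] := boolP (pair_dist p.1 p.2 < r2); last by exists (0, 0).
  have [h2|h2] := eqVneq (P p.1) 1; last first.
    by exists (0, 0) => _ h3; move: h2; rewrite h3 eqxx.
  by have [_ [s [nu H]] _ _] := step _ _ h1 h2; exists (s, nu).
exists r, C; split=> // u0 w0 d0 Pu0.
pose z := fix z n := if n is k.+1 then ((z k).1 + (f (z k)).1, (z k).2 + (f (z k)).2)
                     else (u0, w0).
have inv n : [/\ P (z n).1 = 1, pair_dist (z n).1 (z n).2 < r &
    pair_dist (z n).1 (z n).2 <= r / 2 ^+ n].
  elim: n => [|n [Pn dn en]]; first by rewrite expr0 divr1; split=> //; exact: ltW.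
  have dn2 := lt_le_trans dn rr2.
  have nf := fP _ dn2 Pn; have [_ _ _ /(_ _ _ nf) H] := step _ _ dn2 Pn.
  have q0 : 0 <= pair_dist (z n).1 (z n).2 by rewrite addr_ge0 ?rnorm_ge0 ?normc_ge0.
  have half : pair_dist (z n.+1).1 (z n.+1).2 <= pair_dist (z n).1 (z n).2 / 2.
    apply: le_trans H _; move: dn q0; move: (pair_dist _ _) => q dn q0.
    have : C * q <= 1 / 2.
      have : q <= (2 * C)^-1 by exact: le_trans (ltW dn) rC.
      by rewrite invfM ler_pdivlMr //; lra.
    by rewrite expr2; nra.
  split; first by rewrite /= PD Pn (proj2 nf) addr0.
    by apply: le_lt_trans half _; lra.
  apply: le_trans half _; rewrite exprSr invfM mulrA ler_pM2r //.
exists (fun n => (z n).1), (fun n => (f (z n)).1), (fun n => (z n).2), (fun n => (f (z n)).2).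
have good n : pair_dist (z n).1 (z n).2 < r2 /\ P (z n).1 = 1.
  by have [Pn dn _] := inv n; split=> //; exact: lt_le_trans rr2.
split=> //.
- move=> j; have [dj Pj] := good j; have nf := fP _ dj Pj.
  have [[Gj Dj] _ uniq _] := step _ _ dj Pj.
  by split=> // s' nu'; exact: uniq.
- by move=> j; have [_ _] := inv j.
- move=> j; have [dj Pj] := good j; have nf := fP _ dj Pj.
  by have [_ _ _ /(_ _ _ nf)] := step _ _ dj Pj.
Qed.

End NewtonIteration.

(** * The Poincare inequality on convex cells *)

Section ProductSigmaFinite.
Context d1 d2 (T1 : measurableType d1) (T2 : measurableType d2) (R : realType).
Variable m1 : {sigma_finite_measure set T1 -> \bar R}.
Variable m2 : {sigma_finite_measure set T2 -> \bar R}.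

Lemma product_measure1_sigma_finite : sigma_finite setT (m1 \x m2)%E.
Proof.
have /sigma_finiteP[F [TF ndF Foo]] := sigma_finiteT m1.
have /sigma_finiteP[G [TG ndG Goo]] := sigma_finiteT m2.
exists (fun n => F n `*` G n).
  apply/seteqP; split=> // -[x y] _.
  have [n _ Fx] : (\bigcup_n F n) x by rewrite -TF.
  have [k _ Gy] : (\bigcup_n G n) y by rewrite -TG.
  exists (maxn n k) => //; split => /=.
    by have /subsetPset := ndF _ _ (leq_maxl n k); exact.
  by have /subsetPset := ndG _ _ (leq_maxr n k); exact.
move=> n; have [mF Fn] := Foo n; have [mG Gn] := Goo n.
split; first exact: measurableX.
by rewrite product_measure1E // lte_mul_pinfty // ge0_fin_numE.
Qed.

(** Tonelli's theorem is applied to pairs of points of the plane, and to such a pair together with a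
    parameter, so a product must itself carry the sigma-finite structure. *)
Definition product_sfm : {sigma_finite_measure set (T1 * T2)%type -> \bar R} :=
  HB.pack (m1 \x m2)%E
    (Measure_isSigmaFinite.Build _ _ _ (m1 \x m2)%E product_measure1_sigma_finite).

End ProductSigmaFinite.
Definition leb2_sfm (R : realType) := product_sfm (@lebesgue_measure R) (@lebesgue_measure R).
Definition leb4_sfm (R : realType) := product_sfm (leb2_sfm R) (leb2_sfm R).

(** * Affine substitution in Lebesgue integrals *)

Section AffineSubstitution.
Variable R : realType.
Local Notation leb := (@lebesgue_measure R).
Local Notation plane := (R * R)%type.

Lemma measurable_affine (al be : R) : measurable_fun setT (fun x : R => al * x + be).
Proof. by apply: measurable_funD => //; apply: measurable_funM. Qed.

(** Uniqueness of Lebesgue measure: the rescaled image measure agrees with it on half-open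
    intervals. *)
Lemma lebesgue_measure_affine (al be : R) (A : set R) : 0 < al -> measurable A ->
  (leb A = al%:E * leb ((fun x => al * x + be)%R @^-1` A))%E.
Proof.
move=> al0 mA.
pose phi : R -> measurableTypeR R := fun x => al * x + be.
have mphi : measurable_fun setT phi by exact: measurable_affine.
pose mp := measure_function_pushforward__canonical__measure_function_Measure leb mphi.
transitivity (mscale (NngNum (ltW al0)) mp A); last by [].
apply: lebesgue_measure_unique => //= _ [[a b] _ <-] /=.
rewrite /mscale /= /pushforward /=.
have -> : phi @^-1` `]a, b]%classic = `](a - be) / al, (b - be) / al]%classic.
  apply/seteqP; split=> x /=; rewrite /phi !in_itv /= ltr_pdivrMr // ler_pdivlMr //
    ltrBlDr lerBrDr mulrC //.
rewrite !lebesgue_measure_itv /= !lte_fin ltr_pM2r ?invr_gt0 // ltrD2r.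
case: ltP => ab; last by rewrite mule0.
rewrite -!EFinB -EFinM; congr (_%:E).
by field; rewrite gt_eqF.
Qed.

Lemma ge0_integral_affine (al be : R) (h : R -> \bar R) : 0 < al ->
  measurable_fun setT h -> (forall x, 0 <= h x)%E ->
  (\int[leb]_x h x = al%:E * \int[leb]_x h (al * x + be)%R)%E.
Proof.
move=> al0 mh h0.
pose phi : R -> measurableTypeR R := fun x => al * x + be.
have mphi : measurable_fun setT phi by exact: measurable_affine.
pose mp := measure_function_pushforward__canonical__measure_function_Measure leb mphi.
transitivity (\int[mscale (NngNum (ltW al0)) mp]_x h x)%E.
  by apply: eq_measure_integral => A mA _; exact: lebesgue_measure_affine.
rewrite ge0_integral_mscale //=; congr (_ * _)%E.
by rewrite ge0_integral_pushforward.
Qed.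

Local Notation leb2 := (@leb2 R).

Lemma measurable_affine2 (al be : R * R) :
  measurable_fun setT (fun x : R * R => (al.1 * x.1 + be.1, al.2 * x.2 + be.2)).
Proof.
by apply: measurable_fun_pair; apply: measurable_funD => //; apply: measurable_funM.
Qed.

Lemma ge0_integral_affine2 (al : R) (be : R * R) (h : R * R -> \bar R) : 0 < al ->
  measurable_fun setT h -> (forall x, 0 <= h x)%E ->
  (\int[leb2]_x h x =
    (al ^+ 2)%:E * \int[leb2]_x h (al * x.1 + be.1, al * x.2 + be.2)%R)%E.
Proof.
move=> al0 mh h0.
have mh2 : measurable_fun setT (fun x : R * R => h (al * x.1 + be.1, al * x.2 + be.2)).
  exact: (measurableT_comp mh (measurable_affine2 (al, al) be)).
have E1 := @fubini_tonelli1 _ _ _ _ R leb leb h mh h0.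
have E2 := @fubini_tonelli1 _ _ _ _ R leb leb _ mh2 (fun x => h0 _).
rewrite /leb2 E1 E2 {E1 E2}.
rewrite (@ge0_integral_affine al be.1) //; first last.
- by move=> x; apply: integral_ge0.
- exact: measurable_fun_fubini_tonelli_F.
rewrite expr2 EFinM -muleA; congr (_ * _)%E.
rewrite -ge0_integralZl_EFin //; first last.
- exact: ltW.
- by apply: (@measurable_fun_fubini_tonelli_F _ _ _ _ _ leb _ mh2).
- by move=> x _; apply: integral_ge0.
apply: eq_integral => x _; rewrite /fubini_F /=.
by rewrite (@ge0_integral_affine al be.2) //; exact: measurableT_comp.
Qed.

End AffineSubstitution.

(** * Continuously differentiable functions along segments *)

Section C1Functions.
Variable R : realType.
Local Notation leb := (@lebesgue_measure R).
Local Notation plane := (R * R)%type.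
Implicit Types (f : plane -> R) (x y d k : plane).

Local Notation "'d1' f" := (fun x : plane => 'D_(e1 R) f x) (at level 10, f at level 9).
Local Notation "'d2' f" := (fun x : plane => 'D_(e2 R) f x) (at level 10, f at level 9).

Lemma is_derive_partial1 f (s c : R) : (forall x, derivable f x (e1 R)) ->
  is_derive s 1 (fun s => f (s, c)) ('D_(e1 R) f (s, c)).
Proof.
move=> df; have := df (s, c).
have E : (fun h : R => h^-1 *: ((f \o shift (s, c)) (h *: e1 R) - f (s, c))) =
  (fun h : R => h^-1 *: (((fun s => f (s, c)) \o shift s) (h *: 1) - f (s, c))).
  apply/funext => h /=; congr (_ *: (f _ - _)).
  by apply/pair_equal_spec; split; rewrite /= /GRing.scale /= ?mulr1 // mulr0 add0r.
by rewrite /derivable /derive E => ?; split.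
Qed.

Lemma is_derive_partial2 f (s c : R) : (forall x, derivable f x (e2 R)) ->
  is_derive s 1 (fun s => f (c, s)) ('D_(e2 R) f (c, s)).
Proof.
move=> df; have := df (c, s).
have E : (fun h : R => h^-1 *: ((f \o shift (c, s)) (h *: e2 R) - f (c, s))) =
  (fun h : R => h^-1 *: (((fun s => f (c, s)) \o shift s) (h *: 1) - f (c, s))).
  apply/funext => h /=; congr (_ *: (f _ - _)).
  by apply/pair_equal_spec; split; rewrite /= /GRing.scale /= ?mulr1 // mulr0 add0r.
by rewrite /derivable /derive E => ?; split.
Qed.

Lemma mean_value (g g' : R -> R) (a b : R) : (forall r : R, is_derive r 1 g (g' r)) ->
  exists2 c, `|c - a| <= `|b - a| & g b - g a = g' c * (b - a).
Proof.
move=> dg; have cg : continuous g.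
  by move=> r; apply: differentiable_continuous; apply/derivable1_diffP; have [] := dg r.
have [ab|ba] := leP a b.
  have [|c] := MVT_segment ab (fun r _ => dg r); first exact: continuous_subspaceT.
  rewrite in_itv /= => /andP[ac cb] E; exists c => //.
  by rewrite !ger0_norm ?subr_ge0 // lerD2r.
have [|c] := MVT_segment (ltW ba) (fun r _ => dg r); first exact: continuous_subspaceT.
rewrite in_itv /= => /andP[bc ca] E; exists c.
  by rewrite !ler0_norm ?subr_le0 // ?(ltW ba) // lerN2 lerD2r.
by rewrite -[RHS]opprK -mulrN opprB -E opprB.
Qed.

Lemma continuous_planeP (g : plane -> R) x (e : R) : continuous g -> 0 < e ->
  exists2 del : R, 0 < del & forall y, `|y.1 - x.1| < del -> `|y.2 - x.2| < del ->
    `|g y - g x| <= e.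
Proof.
move=> cg e0; have /cvgrPdist_le/(_ e e0) := cg x.
move=> /nbhs_ballP[del /= del0 H]; exists del => // y h1 h2.
by rewrite distrC; apply: H; split; rewrite /ball /= distrC.
Qed.

(** Two axis-parallel moves, each governed by the one-variable mean value theorem; continuity of the
    partial derivatives controls the intermediate points. *)
Lemma C1_differentiable f x (e : R) : Ck 1 f -> 0 < e ->
  exists2 del : R, 0 < del & forall k, `|k.1| < del -> `|k.2| < del ->
    `|f (x.1 + k.1, x.2 + k.2) - f x - ('D_(e1 R) f x * k.1 + 'D_(e2 R) f x * k.2)|
      <= e * (`|k.1| + `|k.2|).
Proof.
move=> [cf df] e0.
have [df1 [cf1 _]] := df (e1 R) (or_introl erefl).
have [df2 [cf2 _]] := df (e2 R) (or_intror erefl).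
have [u u0 H1] := @continuous_planeP _ x e cf1 e0.
have [w w0 H2] := @continuous_planeP _ x e cf2 e0.
exists (Num.min u w); first by rewrite lt_min u0.
move=> k; rewrite !lt_min => /andP[ku1 kw1] /andP[ku2 kw2].
have [c1 c1k E1] := @mean_value _ _ x.1 (x.1 + k.1)
  (fun s => @is_derive_partial1 f s (x.2 + k.2) df1).
have [c2 c2k E2] := @mean_value _ _ x.2 (x.2 + k.2)
  (fun s => @is_derive_partial2 f s x.1 df2).
rewrite [x.1 + _ - _]addrAC subrr add0r in c1k E1.
rewrite [x.2 + _ - _]addrAC subrr add0r in c2k E2.
have -> : f (x.1 + k.1, x.2 + k.2) - f x - ('D_(e1 R) f x * k.1 + 'D_(e2 R) f x * k.2) =
  ('D_(e1 R) f (c1, x.2 + k.2) - 'D_(e1 R) f x) * k.1 +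
  ('D_(e2 R) f (x.1, c2) - 'D_(e2 R) f x) * k.2.
  have -> : f (x.1 + k.1, x.2 + k.2) - f x =
    (f (x.1 + k.1, x.2 + k.2) - f (x.1, x.2 + k.2)) +
    (f (x.1, x.2 + k.2) - f (x.1, x.2)) by rewrite -surjective_pairing; ring.
  by rewrite E1 E2; ring.
apply: le_trans (ler_normD _ _) _; rewrite mulrDr !normrM.
apply: lerD; rewrite ler_wpM2r //.
  apply: H1 => /=; first exact: le_lt_trans ku1.
  by rewrite addrAC subrr add0r.
apply: H2 => /=; last exact: le_lt_trans kw2.
by rewrite subrr normr0.
Qed.

(** The second argument is a direction: [seg y (x - y)] runs from [y] at 0 to [x] at 1. *)
Definition seg y d (t : R) : plane := (y.1 + t * d.1, y.2 + t * d.2).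

Lemma continuous_seg y d : continuous (seg y d).
Proof.
move=> t; have aff (p q : R) : p + s * q @[s --> t] --> p + t * q.
  by apply: cvgD; [exact: cvg_cst|apply: cvgM; [exact: cvg_id|exact: cvg_cst]].
exact: (cvg_pair (aff _ _) (aff _ _)).
Qed.

Lemma is_derive_seg f y d (t : R) : Ck 1 f ->
  is_derive t 1 (f \o seg y d) ('D_(e1 R) f (seg y d t) * d.1 + 'D_(e2 R) f (seg y d t) * d.2).
Proof.
move=> cf; apply/is_derive1P => e e0.
pose N := `|d.1| + `|d.2|; have N0 : 0 <= N by rewrite addr_ge0.
have eN : 0 < e / (N + 1) by rewrite divr_gt0 // ltr_wpDl.
have [del del0 H] := @C1_differentiable f (seg y d t) _ cf eN.
exists (del / (N + 1)); first by rewrite divr_gt0 // ltr_wpDl.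
move=> h; rewrite ltr_pdivlMr ?ltr_wpDl // => hd.
have hb (c : R) : `|c| <= N -> `|h * c| < del.
  move=> cN; apply: le_lt_trans hd; rewrite normrM ler_wpM2l //; lra.
have := H (h * d.1, h * d.2) (hb _ _) (hb _ _) => /=.
rewrite lerDl lerDr !normr_ge0 => /(_ isT isT).
have -> : f (seg y d (t + h)) = f (y.1 + t * d.1 + h * d.1, y.2 + t * d.2 + h * d.2).
  by rewrite /seg !mulrDl !addrA.
have -> : h * ('D_(e1 R) f (seg y d t) * d.1 + 'D_(e2 R) f (seg y d t) * d.2) =
  'D_(e1 R) f (seg y d t) * (h * d.1) + 'D_(e2 R) f (seg y d t) * (h * d.2) by ring.
move=> /le_trans; apply; rewrite !normrM -mulrDr -/N.
rewrite mulrCA mulrC ler_wpM2r // mulrAC ler_pdivrMr ?ltr_wpDl //; nra.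
Qed.

Definition grad_sq f x : R := 'D_(e1 R) f x ^+ 2 + 'D_(e2 R) f x ^+ 2.

Lemma segment_estimate f x y : Ck 1 f ->
  (((f x - f y) ^+ 2)%:E <= (sqnorm2 (x - y))%:E *
     \int[leb]_(t in `[0%R, 1%R]) (grad_sq f (seg y (x - y) t))%:E)%E.
Proof.
move=> cf; have := cf => -[_ df].
have [df1 [cf1 _]] := df (e1 R) (or_introl erefl).
have [df2 [cf2 _]] := df (e2 R) (or_intror erefl).
pose d := x - y; pose g t := grad_sq f (seg y d t).
have cg : continuous g.
  have csq (h : R -> R) : continuous h -> continuous (fun t => h t ^+ 2).
    by move=> ch t; apply: (continuous_comp (f := h) (g := fun z => z ^+ 2)); [exact: ch|exact: exprn_continuous].
  have cc (h : plane -> R) : continuous h -> continuous (fun t => h (seg y d t)).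
    by move=> ch t; apply: continuous_comp; [exact: continuous_seg|exact: ch].
  by move=> t; apply: cvgD; [exact: (csq _ (cc _ cf1) t)|exact: (csq _ (cc _ cf2) t)].
pose F := primitive (-1) g.
have dF (t : R) : -1 < t -> is_derive t 1 F (g t) by exact: is_derive_primitive.
have -> : (\int[leb]_(t in `[0%R, 1%R]) (grad_sq f (seg y (x - y) t))%:E)%E =
    (F 1 - F 0)%:E.
  rewrite (@continuous_FTC2 _ g F) //; first exact: continuous_subspaceT.
    split.
    - move=> t; rewrite in_itv /= => /andP[t0 _].
      by have [] := dF t (lt_trans (ltrN10 _) t0).
    - apply: cvg_at_right_filter; apply: differentiable_continuous.
      by apply/derivable1_diffP; have [] := dF 0 (ltrN10 _).
    - apply: cvg_at_left_filter; apply: differentiable_continuous.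
      by apply/derivable1_diffP; have [] := dF 1 (lt_trans (ltrN10 _) ltr01).
  move=> t; rewrite in_itv /= => /andP[t0 _].
  by rewrite derive1E; have [_ ->] := dF t (lt_trans (ltrN10 _) t0).
rewrite -EFinM lee_fin.
pose m := f x - f y.
(* Stands in for an integral Cauchy-Schwarz inequality. As [m] is the increment of [f], [K 1 - K 0]
   is the right-hand side minus [m ^+ 2]. By Lagrange's identity the derivative of [K] is a sum of
   two squares, the first being that of [phi' - m]. *)
pose K (t : R) := sqnorm2 d * F t - 2 * m * (f \o seg y d) t + m ^+ 2 * t.
pose phi' t := 'D_(e1 R) f (seg y d t) * d.1 + 'D_(e2 R) f (seg y d t) * d.2.
have dK (t : R) : -1 < t -> is_derive t 1 K (sqnorm2 d * g t - 2 * m * phi' t + m ^+ 2).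
  move=> t1; have h1 := dF t t1; have h2 := is_derive_seg y d t cf.
  have h3 : is_derive t 1 (fun t : R => m ^+ 2 * t) (m ^+ 2).
    have -> : (fun t : R => m ^+ 2 * t) = m ^+ 2 *: id by [].
    by apply: is_derive_eq; rewrite /GRing.scale /= mulr1.
  exact: is_deriveD (is_deriveB (is_deriveZ (sqnorm2 d) h1) (is_deriveZ (2 * m) h2)) h3.
have dK' (t : R) : t \in `]0, 1[ -> is_derive t 1 K (sqnorm2 d * g t - 2 * m * phi' t + m ^+ 2).
  by rewrite in_itv /= => /andP[t0 _]; apply: dK; exact: lt_trans (ltrN10 _) t0.
have [|c] := MVT_segment ler01 dK'.
  apply: continuous_in_subspaceT => t; rewrite inE /= in_itv /= => /andP[t0 _].
  apply: differentiable_continuous; apply/derivable1_diffP.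
  by have [] := dK t (lt_le_trans (ltrN10 _) t0).
move=> _ E.
have K0 : 0 <= K 1 - K 0.
  rewrite E subr0 mulr1.
  have -> : sqnorm2 d * g c - 2 * m * phi' c + m ^+ 2 =
    (phi' c - m) ^+ 2 + ('D_(e1 R) f (seg y d c) * d.2 - 'D_(e2 R) f (seg y d c) * d.1) ^+ 2.
    rewrite /sqnorm2 /g /grad_sq /phi'.
    by move: ('D_(e1 R) f _) ('D_(e2 R) f _) => D1 D2; ring.
  by rewrite addr_ge0 ?sqr_ge0.
have s1 : (f \o seg y d) 1 = f x.
  by rewrite /= /seg /= !mul1r !subrKC -surjective_pairing.
have s0 : (f \o seg y d) 0 = f y.
  by rewrite /= /seg /= !mul0r !addr0 -surjective_pairing.
move: K0; rewrite /K s1 s0 -/d -/m.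
have -> : f x = f y + m by rewrite /m subrKC.
lra.
Qed.

End C1Functions.

(** * Double integrals over a convex cell *)

Section DoubleIntegral.
Variable R : realType.
Local Notation leb := (@lebesgue_measure R).
Local Notation leb2 := (leb2_sfm R).
Local Notation plane := (R * R)%type.
Implicit Types (x y : plane) (t : R).
Variables (K : set plane) (g : plane -> R).
Hypothesis mK : measurable K.
Hypothesis K_convex : forall x y t, K x -> K y -> 0 <= t <= 1 -> K (seg y (x - y) t).
Hypothesis mg : measurable_fun setT g.
Hypothesis g0 : forall x, 0 <= g x.

Let kern (t : R) (z : plane * plane) : R :=
  \1_K z.1 * \1_K z.2 * g (seg z.2 (z.1 - z.2) t).

Let H := (\int[leb2]_z (\1_K z * g z)%:E)%E.

Let ind0 x : 0 <= \1_K x :> R.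
Proof. by rewrite indicE. Qed.

Let H0 : (0 <= H)%E.
Proof. by apply: integral_ge0 => z _; rewrite lee_fin mulr_ge0. Qed.

Let kern0 t z : 0 <= kern t z.
Proof. by rewrite !mulr_ge0. Qed.

Let mind : measurable_fun setT (\1_K : plane -> R).
Proof. exact: measurable_indic. Qed.

Lemma measurable_seg3 :
  measurable_fun setT (fun p : (plane * plane) * R => seg p.1.2 (p.1.1 - p.1.2) p.2).
Proof.
have c1 : measurable_fun setT (fun p : (plane * plane) * R => p.1.1).
  by apply: (measurableT_comp measurable_fst).
have c2 : measurable_fun setT (fun p : (plane * plane) * R => p.1.2).
  by apply: (measurableT_comp measurable_snd).
by apply: measurable_fun_pair; apply: measurable_funD;
  [|apply: measurable_funM => //; apply: measurable_funB
  | |apply: measurable_funM => //; apply: measurable_funB];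
  try exact: (measurableT_comp measurable_fst c1);
  try exact: (measurableT_comp measurable_fst c2);
  try exact: (measurableT_comp measurable_snd c1);
  try exact: (measurableT_comp measurable_snd c2).
Qed.

Let mkern3 : measurable_fun setT (fun p : (plane * plane) * R => kern p.2 p.1).
Proof.
apply: measurable_funM; last exact: (measurableT_comp mg measurable_seg3).
apply: measurable_funM.
  exact: (measurableT_comp mind (measurableT_comp measurable_fst measurable_fst)).
exact: (measurableT_comp mind (measurableT_comp measurable_snd measurable_fst)).
Qed.

Let mkern t : measurable_fun setT (kern t).
Proof.
have mp : measurable_fun setT (fun z : plane * plane => (z, t)).
  by apply: measurable_fun_pair => //; exact: measurable_cst.
exact: (measurableT_comp mkern3 mp).
Qed.

Lemma seg_affine x y t :
  seg y (x - y) t = ((1 - t) * y.1 + t * x.1, (1 - t) * y.2 + t * x.2).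
Proof. by rewrite /seg; congr (_, _) => /=; ring. Qed.

Lemma seg_sym x y t : seg y (x - y) t = seg x (y - x) (1 - t).
Proof. by rewrite /seg; congr (_, _) => /=; ring. Qed.

(** For fixed [x] in [K] the map sending [y] to [(1 - t) y + t x] keeps the convex [K] inside itself
    and scales area by (1 - t)^2, at least 1/4 here; hence the 4. *)
Lemma inner_bound x t : 0 <= t <= 1 / 2 ->
  (\int[leb2]_y (kern t (x, y))%:E <= (\1_K x)%:E * (4%:E * H))%E.
Proof.
move=> /andP[t0 t12].
pose h z := (\1_K z * g z)%:E.
have mh : measurable_fun setT h.
  by apply/measurable_EFinP; exact: measurable_funM.
have h0 z : (0 <= h z)%E by rewrite lee_fin mulr_ge0.
have a0 : 0 < 1 - t by lra.
have := @ge0_integral_affine2 R (1 - t) (t * x.1, t * x.2) h a0 mh h0.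
pose J := (\int[leb2]_y h ((1 - t) * y.1 + t * x.1, (1 - t) * y.2 + t * x.2)%R)%E.
move=> HJ; have {HJ} HJ : (H = ((1 - t) ^+ 2)%:E * J)%E by exact: HJ.
have J0 : (0 <= J)%E by exact: integral_ge0.
have JH : (J <= 4%:E * H)%E.
  rewrite HJ.
  rewrite muleA -EFinM.
  rewrite -[leLHS]mul1e lee_wpmul2r // lee_fin.
  by rewrite expr2; nra.
have ml : measurable_fun setT (fun y => h ((1 - t) * y.1 + t * x.1, (1 - t) * y.2 + t * x.2)).
  exact: (measurableT_comp mh (measurable_affine2 (1 - t, 1 - t) (t * x.1, t * x.2))).
have mk : measurable_fun setT (fun y => (kern t (x, y))%:E).
  have mp : measurable_fun setT (fun y : plane => (x, y)).
    by apply: measurable_fun_pair => //; exact: measurable_cst.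
  by apply/measurable_EFinP; exact: (measurableT_comp (mkern t) mp).
rewrite indicE; have [xK|xK] := boolP (x \in K); last first.
  rewrite mul0e integral0_eq // => y _.
  by rewrite /kern /= indicE (negbTE xK) !mul0r.
rewrite mul1e; apply: le_trans JH; apply: ge0_le_integral => //.
- by move=> y _; rewrite lee_fin.
move=> y _; rewrite /h lee_fin /kern /= -seg_affine.
rewrite [\1_K x]indicE xK mul1r ler_wpM2r //.
rewrite !indicE; case: (boolP (y \in K)) => // yK.
rewrite mem_set //; apply: K_convex; [exact: set_mem|exact: set_mem|].
by apply/andP; split; lra.
Qed.

(** The scaling in [inner_bound] degenerates as [t] approaches 1; for [t > 1 / 2] Tonelli and
    [seg_sym] exchange the two points. *)
Lemma slice_bound t : 0 <= t <= 1 ->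
  (\int[leb2]_x \int[leb2]_y (kern t (x, y))%:E <= leb2 K * (4%:E * H))%E.
Proof.
move=> /andP[t0 t1].
have c40 : (0 <= 4%:E * H)%E by rewrite mule_ge0.
have mk t' : measurable_fun setT (EFin \o kern t') by exact/measurable_EFinP.
have mF t' : measurable_fun setT (fun x => \int[leb2]_y (kern t' (x, y))%:E)%E.
  exact: (@measurable_fun_fubini_tonelli_F _ _ _ _ _ leb2 (EFin \o kern t') (mk t')
    (fun z => kern0 t' z)).
wlog t12 : t t0 t1 / t <= 1 / 2.
  move=> W; have [h|h] := leP t (1 / 2); first exact: W.
  suff -> : (\int[leb2]_x \int[leb2]_y (kern t (x, y))%:E =
      \int[leb2]_x \int[leb2]_y (kern (1 - t) (x, y))%:E)%E by apply: W; lra.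
  transitivity (\int[leb2]_y \int[leb2]_x (kern t (x, y))%:E)%E.
    exact: (@fubini_tonelli _ _ _ _ R leb2 leb2 (EFin \o kern t) (mk t) (kern0 t)).
  apply: eq_integral => y _; apply: eq_integral => x _.
  by rewrite /kern /= -seg_sym [\1_K x * _]mulrC.
have mi : measurable_fun setT (fun x => (\1_K x)%:E : \bar R) by exact/measurable_EFinP.
apply: (@le_trans _ _ (\int[leb2]_x (4%:E * H * (\1_K x)%:E))%E).
  apply: ge0_le_integral => //.
  - by move=> x _; apply: integral_ge0 => y _; rewrite lee_fin.
  - exact: (mF t).
  - exact: (measurable_funeM (4%:E * H)%E mi).
  - by move=> x _; rewrite muleC; apply: inner_bound; rewrite t0.
have -> : (\int[leb2]_x (4%:E * H * (\1_K x)%:E) =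
    4%:E * H * \int[leb2]_x (\1_K x)%:E)%E.
  exact: ge0_integralZl.
by rewrite integral_indic // setIT muleC.
Qed.

(** Tonelli moves the segment parameter to the outside, where [slice_bound] is uniform in [t]. *)
Lemma double_integral_bound (f : plane -> R) (d2 : R) : measurable_fun setT f -> 0 <= d2 ->
  (forall x y, K x -> K y -> (((f x - f y) ^+ 2)%:E <=
     d2%:E * \int[leb]_(t in `[0%R, 1%R]) (g (seg y (x - y) t))%:E)%E) ->
  (\int[leb2]_x \int[leb2]_y (\1_K x * \1_K y * (f x - f y) ^+ 2)%:E <=
    d2%:E * (leb2 K * (4%:E * H)))%E.
Proof.
move=> mf d20 est.
pose F (p : (plane * plane) * R) : \bar R := (\1_`[0%R, 1%R] p.2 * kern p.2 p.1)%:E.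
have mF : measurable_fun setT F.
  apply/measurable_EFinP; apply: measurable_funM => //.
  apply: (measurableT_comp _ measurable_snd); exact: measurable_indic.
have F0 p : (0 <= F p)%E by rewrite lee_fin mulr_ge0 // indicE.
have q0 : measurable_fun setT (fun z : plane * plane =>
    (\1_K z.1 * \1_K z.2 * (f z.1 - f z.2) ^+ 2)%:E).
  apply/measurable_EFinP; apply: measurable_funM.
    by apply: measurable_funM; apply: measurableT_comp.
  by apply: measurable_funX; apply: measurable_funB; apply: measurableT_comp.
have q1 (z : plane * plane) : (0 <= (\1_K z.1 * \1_K z.2 * (f z.1 - f z.2) ^+ 2)%:E)%E.
  by rewrite lee_fin; apply: mulr_ge0; [exact: mulr_ge0|exact: sqr_ge0].
have mI := @measurable_fun_fubini_tonelli_F _ _ _ _ R leb F mF F0.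
have E1 := @fubini_tonelli1 _ _ _ _ R leb2 leb2 _ q0 q1.
rewrite -E1 {E1}.
apply: (@le_trans _ _ (\int[leb4_sfm R]_z (d2%:E * \int[leb]_t F (z, t)))%E).
  apply: ge0_le_integral => //.
  - exact: (measurable_funeM d2%:E mI).
  move=> [x y] _ /=.
  have -> : (\int[leb]_t F ((x, y), t) = \int[leb]_(t in `[0%R, 1%R]) (kern t (x, y))%:E)%E.
    rewrite [RHS]integral_mkcond; apply: eq_integral => t _.
    by rewrite /F patchE indicE /=; case: ifP => ?; rewrite ?mul1r ?mul0r.
  rewrite /kern /= !indicE; have [xK|xK] := boolP (x \in K); last first.
    by rewrite !mul0r mule_ge0 // integral_ge0 // => t _; rewrite mul0r.
  have [yK|yK] := boolP (y \in K); last first.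
    by rewrite !(mulr0, mul0r) mule_ge0 // integral_ge0 // => t _; rewrite !(mulr0, mul0r).
  rewrite !mul1r; apply: le_trans (est x y (set_mem xK) (set_mem yK)) _.
  rewrite le_eqVlt; apply/orP; left; apply/eqP; congr (_ * _)%E.
  by apply: eq_integral => t _; rewrite mul1r.
rewrite ge0_integralZl_EFin //; last by move=> z _; apply: integral_ge0.
apply: lee_wpmul2l; first by rewrite lee_fin.
rewrite (@fubini_tonelli _ _ _ _ R (leb4_sfm R) leb F mF F0).
apply: (@le_trans _ _ (\int[leb]_t (leb2 K * (4%:E * H) * (\1_`[0%R, 1%R] t)%:E))%E).
  apply: ge0_le_integral => //.
  - by move=> t _; apply: integral_ge0.
  - exact: (@measurable_fun_fubini_tonelli_G _ _ _ _ R (leb4_sfm R) F mF F0).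
  - by apply: measurable_funeM; apply/measurable_EFinP; exact: measurable_indic.
  move=> t _; rewrite indicE; have [tI|tI] := boolP (t \in _); last first.
    by rewrite mule0 integral0_eq // => z _; rewrite /F /= indicE (negbTE tI) mul0r.
  have t01 : 0 <= t <= 1 by move: tI; rewrite inE /= in_itv.
  rewrite mule1; apply: (le_trans _ (slice_bound t01)).
  have mk : measurable_fun setT (EFin \o kern t) by exact/measurable_EFinP.
  have E := @fubini_tonelli1 _ _ _ _ R leb2 leb2 (EFin \o kern t) mk (kern0 t).
  apply: (@le_trans _ _ (\int[leb4_sfm R]_z (EFin \o kern t) z)%E); last by rewrite E.
  rewrite le_eqVlt; apply/orP; left; apply/eqP; apply: eq_integral => z _.
  by rewrite /F /= indicE tI mul1r.
have mi : measurable_fun setT (fun t : R => (\1_`[0%R, 1%R] t)%:E : \bar R).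
  by apply/measurable_EFinP; exact: measurable_indic.
have K0 : (0 <= leb2 K * (4%:E * H))%E by rewrite !mule_ge0.
rewrite (ge0_integralZl leb measurableT mi _ K0); last first.
  by move=> t _; rewrite lee_fin indicE.
have E : (\int[leb]_t (\1_`[0%R, 1%R] t)%:E = 1)%E.
  rewrite integral_indic // setIT; transitivity (leb `[0%R, 1%R]%classic) => //.
  by rewrite lebesgue_measure_itv /= lte_fin ltr01 sube0.
by rewrite E mule1.
Qed.

End DoubleIntegral.

(** * The Poincare inequality on one cell *)

Section CellPoincare.
Variable R : realType.
Local Notation leb := (@lebesgue_measure R).
Local Notation leb2 := (@leb2 R).
Local Notation plane := (R * R)%type.
Implicit Types (x y : plane).

Lemma measurable_grad_sq (f : plane -> R) : Ck 1 f -> measurable_fun setT (grad_sq f).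
Proof.
move=> [_ df].
have [_ [cf1 _]] := df (e1 R) (or_introl erefl).
have [_ [cf2 _]] := df (e2 R) (or_intror erefl).
have m1 := continuous_plane_measurable cf1; have m2 := continuous_plane_measurable cf2.
exact: measurable_funD (measurable_funX 2 m1) (measurable_funX 2 m2).
Qed.

Lemma leb2_bounded (K : set plane) (L : R) : measurable K ->
  (forall x, K x -> `|x.1| <= L /\ `|x.2| <= L) -> (leb2 K < +oo)%E.
Proof.
move=> mK KL; pose I : set R := `[- L, L]%classic.
apply: (@le_lt_trans _ _ (leb2 (I `*` I))).
  have mI : measurable (I `*` I) by apply: measurableX; exact: measurable_itv.
  apply: le_measure; rewrite ?inE; [exact: mK|exact: mI|].
  by move=> x /KL[h1 h2]; split; rewrite /I /= in_itv /= -ler_norml.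
have mI1 : measurable (I : set (measurableTypeR R)) by exact: measurable_itv.
rewrite /leb2 (product_measure1E _ _ mI1 mI1).
have h : (leb I < +oo)%E.
  rewrite /I lebesgue_measure_itv /=; case: ifP => _; last exact: ltry.
  by rewrite -EFinB ltry.
have h0 : (0 <= leb I)%E by [].
have hf : leb I \is a fin_num by rewrite (ge0_fin_numE h0); exact: h.
exact: (lte_mul_pinfty h0 hf h).
Qed.

Lemma continuous_bounded_box (f : plane -> R) (L : R) : continuous f ->
  exists B : R, forall x, `|x.1| <= L -> `|x.2| <= L -> `|f x| <= B.
Proof.
move=> cf; pose box : set plane := `[- L, L]%classic `*` `[- L, L]%classic.
have cb : compact box by apply: compact_setX; exact: segment_compact.
have : compact (f @` box).
  by apply: continuous_compact => //; exact: continuous_subspaceT.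
move=> /compact_bounded[M [Mr MP]]; exists (M + 1) => x h1 h2.
apply: (MP (M + 1)); first by rewrite ltrDl.
by exists x => //; split; rewrite /= in_itv /= -ler_norml.
Qed.

Variables (K : set plane) (L : R).
Hypothesis mK : measurable K.
Hypothesis K_bounded : forall x, K x -> `|x.1| <= L /\ `|x.2| <= L.

Let mK' : measurable (K : set (measurableTypeR R * measurableTypeR R)%type).
Proof. exact: mK. Qed.

Lemma bounded_integrable (h : plane -> R) : measurable_fun K h ->
  (exists B : R, forall x, K x -> `|h x| <= B) -> leb2.-integrable K (EFin \o h).
Proof.
move=> mh [B BP]; apply: measurable_bounded_integrable => //.
  exact: (leb2_bounded mK K_bounded).
exists B; split; first exact: num_real.
by move=> C BC x Kx; apply: le_trans (BP x Kx) _; exact: ltW.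
Qed.

Lemma Rintegral_quadratic (f : plane -> R) (a b c : R) : continuous f ->
  \int[leb2]_(x in K) (a + b * f x + c * f x ^+ 2) =
  a * fine (leb2 K) + b * \int[leb2]_(x in K) f x + c * \int[leb2]_(x in K) (f x ^+ 2).
Proof.
move=> cf; have [B BP] := continuous_bounded_box L cf.
have mf : measurable_fun K f by apply: measurable_funTS; exact: continuous_plane_measurable.
have Bf x : K x -> `|f x| <= B by move=> /K_bounded[]; exact: BP.
have i0 (u : R) : leb2.-integrable K (EFin \o (fun=> u)).
  by apply: bounded_integrable; [exact: measurable_cst|exists `|u|].
have i1 (u : R) : leb2.-integrable K (EFin \o (fun x => u * f x)).
  apply: bounded_integrable; first exact: measurable_funM.
  by exists (`|u| * B) => x Kx; rewrite normrM ler_wpM2l // Bf.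
have i2 (u : R) : leb2.-integrable K (EFin \o (fun x => u * f x ^+ 2)).
  apply: bounded_integrable; first by apply: measurable_funM => //; exact: measurable_funX.
  exists (`|u| * B ^+ 2) => x Kx; rewrite normrM ler_wpM2l // normrX.
  by rewrite lerXn2r ?nnegrE // ?Bf // (le_trans _ (Bf x Kx)).
have i01 : leb2.-integrable K (EFin \o (fun x => a + b * f x)).
  by have := integrableD mK' (i0 a) (i1 b).
have j1 : leb2.-integrable K (EFin \o f).
  apply: bounded_integrable => //; by exists B.
have j2 : leb2.-integrable K (EFin \o (fun x => f x ^+ 2)).
  have := i2 1; congr (_.-integrable _ _).
  by apply/funext => x /=; rewrite mul1r.
rewrite (RintegralD mK' i01 (i2 c)) (RintegralD mK' (i0 a) (i1 b)) (Rintegral_cst _ mK').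
by rewrite (RintegralZl _ mK' j1) (RintegralZl _ mK' j2).
Qed.

(** With k the area of [K], expanding the square shows that the double integral of (f x - f y)^2 is
    2 k times the integral of f^2 minus twice the squared integral of f. Dividing its bound, 4 d2 k
    times the gradient integral, by 2 k gives [c = 1 / k] and the factor [2 * d2], small on small
    cells. *)
Lemma cell_poincare : exists2 c : R, 0 <= c & forall (f : plane -> R) (d2 : R),
  (forall x y t, K x -> K y -> 0 <= t <= 1 -> K (seg y (x - y) t)) ->
  Ck 1 f -> 0 <= d2 -> (forall x y, K x -> K y -> sqnorm2 (x - y) <= d2) ->
  (\int[leb2]_(x in K) (f x ^+ 2)%:E <=
   (c * (\int[leb2]_(x in K) f x) ^+ 2)%:E
   + (2 * d2)%:E * \int[leb2]_(x in K) (grad_sq f x)%:E)%E.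
Proof.
pose k := fine (leb2 K); have k0 : 0 <= k by exact: fine_ge0.
have kE : leb2 K = k%:E.
  by rewrite fineK // ge0_fin_numE // (leb2_bounded mK K_bounded).
exists k^-1; first by rewrite invr_ge0.
move=> f d2 convK Cf d20 diam.
have cf : continuous f by case: Cf.
have mf : measurable_fun setT f by exact: continuous_plane_measurable.
have mg := measurable_grad_sq Cf.
have g0 x : 0 <= grad_sq f x by rewrite addr_ge0 ?sqr_ge0.
have mf2 : measurable_fun K (fun x => f x ^+ 2).
  by apply: measurable_funTS; exact: measurable_funX.
have [B BP] := continuous_bounded_box L cf.
have Bf x : K x -> `|f x| <= B by move=> /K_bounded[]; exact: BP.
have if2 : leb2.-integrable K (EFin \o (fun x => f x ^+ 2)).
  apply: bounded_integrable => //; exists (B ^+ 2) => x Kx; rewrite normrX.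
  by rewrite lerXn2r ?nnegrE // ?Bf // (le_trans _ (Bf x Kx)).
pose Q := \int[leb2]_(x in K) (f x ^+ 2); pose l := \int[leb2]_(x in K) f x.
have QE : (\int[leb2]_(x in K) (f x ^+ 2)%:E = Q%:E)%E.
  by rewrite fineK //; exact: integrable_fin_num.
have Q0 : 0 <= Q by apply: Rintegral_ge0 => x _; exact: sqr_ge0.
rewrite QE -/l.
set H := (\int[leb2]_(x in K) (grad_sq f x)%:E)%E.
have H0 : (0 <= H)%E by apply: integral_ge0 => x _; rewrite lee_fin.
(* On a null cell [k^-1] is 0 by convention, but then the left side vanishes too. *)
have [kz|kz] := eqVneq k 0.
  have -> : Q = 0.
    apply/EFin_inj; rewrite -QE; apply: (null_set_integral mK'); last by transitivity (leb2 K) => //; rewrite kE kz.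
    exact: (measurable_int _ if2).
  apply: adde_ge0; last by apply: mule_ge0 => //; rewrite lee_fin mulr_ge0.
  by rewrite lee_fin; apply: mulr_ge0; [rewrite invr_ge0|exact: sqr_ge0].
have kp : 0 < k by rewrite lt_neqAle eq_sym kz.
have est x y : K x -> K y -> (((f x - f y) ^+ 2)%:E <= d2%:E *
    \int[leb]_(t in `[0%R, 1%R]) (grad_sq f (seg y (x - y) t))%:E)%E.
  move=> Kx Ky; apply: le_trans (segment_estimate x y Cf) _.
  by rewrite lee_wpmul2r ?lee_fin ?diam // integral_ge0 // => t _; rewrite lee_fin.
have := double_integral_bound mK convK mg g0 mf d20 est.
have HE : (\int[leb2]_z (\1_K z * grad_sq f z)%:E = H)%E.
  rewrite /H [RHS]integral_mkcond; apply: eq_integral => z _.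
  by rewrite patchE indicE; case: ifP; rewrite ?mul1r ?mul0r.
have -> : (\int[leb2_sfm R]_z (\1_K z * grad_sq f z)%:E = H)%E by exact: HE.
have -> : (leb2_sfm R K = k%:E)%E by exact: kE.
pose J x := f x ^+ 2 * k - 2 * f x * l + Q.
have inner x : (\int[leb2_sfm R]_y (\1_K x * \1_K y * (f x - f y) ^+ 2)%:E = (\1_K x * J x)%:E)%E.
  have E : \int[leb2]_(y in K) ((f x - f y) ^+ 2) = J x.
    transitivity (\int[leb2]_(y in K) (f x ^+ 2 + (- (2 * f x)) * f y + 1 * f y ^+ 2)).
      by apply: eq_Rintegral => y _; ring.
    by rewrite Rintegral_quadratic // /J -/k -/l -/Q; ring.
  rewrite -E EFinM; rewrite fineK; last first.
    apply: integrable_fin_num => //.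
    apply: bounded_integrable.
      by apply: measurable_funTS; apply: measurable_funX; apply: measurable_funB.
    exists ((`|f x| + B) ^+ 2) => y Ky; rewrite normrX.
    have := Bf y Ky => By; have B0 : 0 <= B by exact: le_trans By.
    by rewrite lerXn2r ?nnegrE ?addr_ge0 // (le_trans (ler_normB _ _)) // lerD2l.
  rewrite -ge0_integralZl_EFin //.
  - rewrite [RHS]integral_mkcond; apply: eq_integral => y _.
    rewrite patchE !indicE; case: ifP => yK; last by rewrite !(mulr0, mul0r).
    by rewrite -EFinM mulr1.
  - by move=> y _; rewrite lee_fin sqr_ge0.
  - apply/measurable_EFinP; apply: measurable_funTS; apply: measurable_funX.
    exact: measurable_funB.
have -> : (\int[leb2_sfm R]_x \int[leb2_sfm R]_y (\1_K x * \1_K y * (f x - f y) ^+ 2)%:E =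
   (2 * k * Q - 2 * l ^+ 2)%:E)%E.
  transitivity (\int[leb2_sfm R]_x (\1_K x * J x)%:E)%E.
    by apply: eq_integral => x _; exact: inner.
  transitivity (\int[leb2]_(x in K) (J x)%:E)%E.
    rewrite [RHS]integral_mkcond; apply: eq_integral => x _.
    by rewrite patchE indicE; case: ifP; rewrite ?mul1r ?mul0r.
  have -> : 2 * k * Q - 2 * l ^+ 2 = \int[leb2]_(x in K) J x.
    rewrite /J.
    transitivity (\int[leb2]_(x in K) (Q + (- (2 * l)) * f x + k * f x ^+ 2)); last first.
      by apply: eq_Rintegral => x _; ring.
    by rewrite Rintegral_quadratic // -/k -/l -/Q; ring.
  rewrite fineK //; apply: integrable_fin_num => //; apply: bounded_integrable.
    apply: measurable_funTS; apply: measurable_funD => //; apply: measurable_funB.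
      by apply: measurable_funM => //; exact: measurable_funX.
    by apply: measurable_funM => //; exact: measurable_funM.
  exists (B ^+ 2 * k + 2 * B * `|l| + Q) => x Kx; rewrite /J.
  have Bx := Bf x Kx; have B0 : 0 <= B by exact: le_trans Bx.
  apply: le_trans (ler_normD _ _) _; rewrite (ger0_norm Q0) lerD2r.
  apply: le_trans (ler_normB _ _) _; apply: lerD.
    by rewrite normrM normrX (ger0_norm k0) ler_wpM2r // lerXn2r ?nnegrE.
  by rewrite normrM normrM (@ger0_norm _ 2) // ler_wpM2r // ler_wpM2l.
have [_ df] := Cf.
have [_ [cf1 _]] := df (e1 R) (or_introl erefl).
have [_ [cf2 _]] := df (e2 R) (or_intror erefl).
have [B1 B1P] := continuous_bounded_box L cf1.
have [B2 B2P] := continuous_bounded_box L cf2.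
have ig : leb2.-integrable K (EFin \o grad_sq f).
  apply: bounded_integrable; first exact: measurable_funTS.
  exists (B1 ^+ 2 + B2 ^+ 2) => x /K_bounded[x1 x2].
  have b1 := B1P x x1 x2; have b2 := B2P x x1 x2.
  rewrite ger0_norm // /grad_sq -(real_normK (num_real ('D_(e1 R) f x))).
  rewrite -(real_normK (num_real ('D_(e2 R) f x))).
  have B10 : 0 <= B1 by exact: le_trans b1.
  have B20 : 0 <= B2 by exact: le_trans b2.
  by rewrite lerD // lerXn2r ?nnegrE.
have {HE} : H \is a fin_num by exact: (integrable_fin_num mK' ig).
move: H0; case: H => [h| |] // h0 _.
rewrite -!EFinM -EFinD !lee_fin => ineq.
rewrite lee_fin in h0.
rewrite -(ler_pM2l kp) mulrDr mulrA divff // mul1r; lra.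
Qed.

End CellPoincare.

(** * Geometry of the Wigner-Seitz cell *)

Section WignerSeitz.
Variable R : realType.
Local Notation leb2 := (@leb2 R).
Local Notation plane := (R * R)%type.
Variables (a b : plane).
Implicit Types (x y : plane).
Local Notation Om := (wigner_seitz a b).

(** Expanding the squares makes each condition linear in [x]: the cell is an intersection of
    half-planes, the source of its convexity and of its boundedness. *)
Lemma wigner_seitz_dot x p : Om x -> lattice a b p -> p != 0 ->
  2 * (x.1 * p.1 + x.2 * p.2) < sqnorm2 p.
Proof.
by move=> Ox /Ox /[apply]; rewrite /sqnorm2 /=; lra.
Qed.

Lemma wigner_seitz_convex x y t : Om x -> Om y -> 0 <= t <= 1 -> Om (seg y (x - y) t).
Proof.
move=> Ox Oy /andP[t0 t1] p lp p0.
have hx := wigner_seitz_dot Ox lp p0; have hy := wigner_seitz_dot Oy lp p0.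
suff : 2 * ((seg y (x - y) t).1 * p.1 + (seg y (x - y) t).2 * p.2) < sqnorm2 p.
  by rewrite /sqnorm2 /=; lra.
rewrite seg_affine /=; move: hx hy; move: (sqnorm2 p) => q hx hy.
have [->|t0'] := eqVneq t 0; first by lra.
have tp : 0 < t by rewrite lt_neqAle eq_sym t0'.
nra.
Qed.

(** The half-planes of [a], [- a], [b] and [- b] bound the scalar products of [x] with [a] and [b];
    Cramer's rule, with determinant [d], recovers the coordinates. *)
Lemma wigner_seitz_bounded : a.1 * b.2 - a.2 * b.1 != 0 ->
  exists L : R, forall x, Om x -> `|x.1| <= L /\ `|x.2| <= L.
Proof.
set d := _ - _ => d0.
have a0 : a != 0.
  by apply/eqP => a0; move: d0; rewrite /d a0 /= !mul0r subrr eqxx.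
have b0 : b != 0.
  by apply/eqP => b0; move: d0; rewrite /d b0 /= !mulr0 subrr eqxx.
have dot p x : p = a \/ p = b -> Om x -> `|x.1 * p.1 + x.2 * p.2| <= sqnorm2 p.
  move=> hp Ox.
  have lp : lattice a b p.
    case: hp => ->; first by exists 1, 0; rewrite mulr1z mulr0z addr0.
    by exists 0, 1; rewrite mulr1z mulr0z add0r.
  have ln : lattice a b (- p).
    case: hp => ->; first by exists (-1), 0; rewrite mulrN1z mulr0z addr0.
    by exists 0, (-1); rewrite mulrN1z mulr0z add0r.
  have p0 : p != 0 by case: hp => ->.
  have n0 : - p != 0 by rewrite oppr_eq0.
  have h1 := wigner_seitz_dot Ox lp p0; have h2 := wigner_seitz_dot Ox ln n0.
  have s0 : 0 <= sqnorm2 p by rewrite addr_ge0 ?sqr_ge0.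
  have sN : sqnorm2 (- p) = sqnorm2 p by rewrite /sqnorm2 /= !sqrrN.
  move: h2; rewrite sN /= => h2.
  by rewrite ler_norml; apply/andP; split; lra.
pose s := `|a.1| + `|a.2| + `|b.1| + `|b.2|.
exists ((sqnorm2 a + sqnorm2 b) * s / `|d|) => x Ox.
have ha := dot a x (or_introl erefl) Ox; have hb := dot b x (or_intror erefl) Ox.
have dp : 0 < `|d| by rewrite normr_gt0.
have E1 : x.1 * d = (x.1 * a.1 + x.2 * a.2) * b.2 - (x.1 * b.1 + x.2 * b.2) * a.2.
  by rewrite /d; ring.
have E2 : x.2 * d = (x.1 * b.1 + x.2 * b.2) * a.1 - (x.1 * a.1 + x.2 * a.2) * b.1.
  by rewrite /d; ring.
have na := normr_ge0 a.1; have na' := normr_ge0 a.2.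
have nb := normr_ge0 b.1; have nb' := normr_ge0 b.2.
have sa : 0 <= sqnorm2 a by rewrite addr_ge0 ?sqr_ge0.
have sb : 0 <= sqnorm2 b by rewrite addr_ge0 ?sqr_ge0.
have bnd u v (p q : R) : `|u| <= sqnorm2 a -> `|v| <= sqnorm2 b -> `|p| <= s -> `|q| <= s ->
    `|u * p - v * q| <= (sqnorm2 a + sqnorm2 b) * s.
  move=> hu hv hp hq; apply: le_trans (ler_normB _ _) _; rewrite !normrM mulrDl.
  by rewrite lerD // ler_pM.
have bnd' u v (p q : R) : `|u| <= sqnorm2 a -> `|v| <= sqnorm2 b -> `|p| <= s -> `|q| <= s ->
    `|v * q - u * p| <= (sqnorm2 a + sqnorm2 b) * s.
  by move=> *; rewrite distrC; exact: bnd.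
rewrite !ler_pdivlMr // -!normrM E1 E2.
by split; [apply: bnd|apply: bnd'] => //; rewrite /s; lra.
Qed.

(** Half-open, so that the squares are disjoint and still cover. *)
Definition grid_square (L h : R) (i j : nat) : set plane :=
  [set x | - L + h * i%:R <= x.1 < - L + h * i.+1%:R /\
           - L + h * j%:R <= x.2 < - L + h * j.+1%:R].

Lemma measurable_grid_square L h i j : measurable (grid_square L h i j).
Proof.
rewrite (_ : grid_square L h i j =
  `[- L + h * i%:R, - L + h * i.+1%:R[%classic `*`
  `[- L + h * j%:R, - L + h * j.+1%:R[%classic).
  by apply: measurableX; exact: measurable_itv.
by apply/seteqP; split=> x /=; rewrite !in_itv.
Qed.

Lemma grid_index (L h r : R) (N : nat) : 0 < h -> `|r| <= L -> 2 * L < h * N%:R ->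
  exists2 i : 'I_N, - L + h * i%:R <= r & r < - L + h * i.+1%:R.
Proof.
move=> h0 rL LN; have := ler_norm r; have := ler_norm (- r); rewrite normrN => r1 r2.
have q0 : 0 <= (r + L) / h by rewrite divr_ge0 ?(ltW h0) //; lra.
have /andP[t1 t2] := truncn_itv q0.
set i := Num.truncn ((r + L) / h) in t1 t2.
have h1 : h * i%:R <= r + L by rewrite mulrC -ler_pdivlMr.
have h2 : r + L < h * i.+1%:R by rewrite mulrC -ltr_pdivrMr.
have iN : (i < N)%N.
  rewrite -(ltr_nat R) -(ltr_pM2l h0); apply: le_lt_trans h1 _; lra.
by exists (Ordinal iN) => /=; lra.
Qed.

Lemma poincare_cells (eps : R) : a.1 * b.2 - a.2 * b.1 != 0 -> 0 < eps ->
  exists (I : finType) (K : I -> set plane) (c : I -> R),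
  [/\ forall i, measurable (K i), forall i, K i `<=` Om, forall i, 0 <= c i &
   forall f, Ck 1 f ->
   (\int[leb2]_(x in Om) (f x ^+ 2)%:E <=
     (\sum_i c i * (\int[leb2]_(x in K i) f x) ^+ 2)%:E
     + eps%:E * \int[leb2]_(x in Om) (grad_sq f x)%:E)%E].
Proof.
move=> /wigner_seitz_bounded[L OL] eps0.
(* The pieces will have squared diameter at most [2 * h ^+ 2], which enters [cell_poincare] with a
   further factor 2. *)
have [h [h0 heps]] : exists h : R, 0 < h /\ 2 * (2 * h ^+ 2) <= eps.
  exists (Num.min 1 (eps / 4)); split; first by rewrite lt_min ltr01 divr_gt0.
  set m := Num.min _ _; have m1 : m <= 1 by rewrite ge_min lexx.
  have m2 : m <= eps / 4 by rewrite ge_min lexx orbT.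
  have m0 : 0 < m by rewrite lt_min ltr01 divr_gt0.
  by rewrite expr2; nra.
pose N := (Num.truncn (2 * `|L| / h)).+1.
have LN : 2 * L < h * N%:R.
  have q0 : 0 <= 2 * `|L| / h by rewrite divr_ge0 ?mulr_ge0 // ltW.
  have /andP[_ t2] := truncn_itv q0.
  have t3 : 2 * `|L| < N%:R * h by rewrite -ltr_pdivrMr.
  by rewrite [ltRHS]mulrC; apply: le_lt_trans t3; rewrite ler_pM2l // ler_norm.
pose I : finType := ('I_N * 'I_N)%type.
pose K (i : I) : set plane := Om `&` grid_square L h i.1 i.2.
have mK i : measurable (K i).
  by apply: measurableI; [exact: measurable_wigner_seitz|exact: measurable_grid_square].
have KO i : K i `<=` Om by move=> x [].
have KL i x : K i x -> `|x.1| <= L /\ `|x.2| <= L by move=> /KO /OL.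
have /choice[c cP] (i : I) : exists c : R, 0 <= c /\ forall (f : plane -> R) (d2 : R),
    (forall x y t, K i x -> K i y -> 0 <= t <= 1 -> K i (seg y (x - y) t)) ->
    Ck 1 f -> 0 <= d2 -> (forall x y, K i x -> K i y -> sqnorm2 (x - y) <= d2) ->
    (\int[leb2]_(x in K i) (f x ^+ 2)%:E <=
      (c * (\int[leb2]_(x in K i) f x) ^+ 2)%:E
      + (2 * d2)%:E * \int[leb2]_(x in K i) (grad_sq f x)%:E)%E.
  by have [c c0 H] := cell_poincare (mK i) (KL i); exists c.
exists I, K, c; split=> // [i|f Cf]; first by have [] := cP i.
have Kconv i x y t : K i x -> K i y -> 0 <= t <= 1 -> K i (seg y (x - y) t).
  move=> [Ox [/andP[p1 p2] /andP[p3 p4]]] [Oy [/andP[q1 q2] /andP[q3 q4]]] t01.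
  split; first exact: wigner_seitz_convex.
  have /andP[t0 t1] := t01; rewrite seg_affine /=.
  have cvx (u v l r : R) : l <= u < r -> l <= v < r -> l <= (1 - t) * v + t * u < r.
    move=> /andP[u1 u2] /andP[v1 v2]; apply/andP; split; first by nra.
    have [->|t0'] := eqVneq t 0; first by lra.
    have tp : 0 < t by rewrite lt_neqAle eq_sym t0'.
    by nra.
  by split; apply: cvx; apply/andP.
have diam i x y : K i x -> K i y -> sqnorm2 (x - y) <= 2 * h ^+ 2.
  move=> [_ [/andP[p1 p2] /andP[p3 p4]]] [_ [/andP[q1 q2] /andP[q3 q4]]].
  have sq (u v l : R) (n : nat) : l + h * n%:R <= u -> u < l + h * n.+1%:R ->
      l + h * n%:R <= v -> v < l + h * n.+1%:R -> (u - v) ^+ 2 <= h ^+ 2.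
    rewrite -natr1 mulrDr mulr1 => u1 u2 v1 v2.
    rewrite -(real_normK (num_real (u - v))) lerXn2r ?nnegrE ?(ltW h0) //.
    by rewrite ler_norml; apply/andP; split; lra.
  rewrite /sqnorm2 /= mulr2n mulrDl mul1r.
  by apply: lerD; apply: sq; eassumption.
have OE : \big[setU/set0]_(i <- index_enum I) K i = Om.
  rewrite -bigcup_seq; apply/seteqP; split=> [x [i _ []]//|x Ox].
  have [x1 x2] := OL x Ox.
  have [i i1 i2] := grid_index h0 x1 LN; have [j j1 j2] := grid_index h0 x2 LN.
  exists (i, j); first by rewrite /= mem_index_enum.
  by split=> //; rewrite /grid_square /= i1 i2 j1 j2.
have tK : trivIset [set` index_enum I] K.
  have mono (u : R) (i j : nat) : - L + h * i%:R <= u < - L + h * i.+1%:R ->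
      - L + h * j%:R <= u < - L + h * j.+1%:R -> (i <= j)%N.
    move=> /andP[i1 _] /andP[_ j2].
    rewrite -ltnS -(ltr_nat R) -(ltr_pM2l h0); lra.
  move=> [i i'] [j j'] _ _ [x [[_ [/= p1 p2]] [_ [/= q1 q2]]]].
  congr (_, _); apply/val_inj/eqP; rewrite eqn_leq.
    by rewrite (mono _ _ _ p1 q1) (mono _ _ _ q1 p1).
  by rewrite (mono _ _ _ p2 q2) (mono _ _ _ q2 p2).
have split_int (F : plane -> R) : measurable_fun setT F -> (forall x, 0 <= F x) ->
    (\int[leb2]_(x in Om) (F x)%:E = \sum_i \int[leb2]_(x in K i) (F x)%:E)%E.
  move=> mF F0; rewrite -[in LHS]OE.
  apply: ge0_integral_bigsetU => //; first exact: index_enum_uniq.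
    by apply: measurable_funTS; exact/measurable_EFinP.
  by move=> x _; rewrite lee_fin.
have mf : measurable_fun setT f by case: Cf => cf _; exact: continuous_plane_measurable.
have mg := measurable_grad_sq Cf.
have g0 x : 0 <= grad_sq f x by rewrite addr_ge0 ?sqr_ge0.
rewrite (split_int (fun x => f x ^+ 2)); [|exact: measurable_funX|by move=> x; exact: sqr_ge0].
rewrite (split_int (grad_sq f)) //.
have d20 : 0 <= 2 * h ^+ 2 by rewrite mulr_ge0 // exprn_ge0 // ltW.
rewrite ge0_sume_distrr; last by move=> i _; apply: integral_ge0 => x _; rewrite lee_fin.
rewrite -sumEFin -big_split /=; apply: lee_sum => i _.
have [_ /(_ f (2 * h ^+ 2) (Kconv i) Cf d20 (diam i)) H] := cP i.
apply: le_trans H _; rewrite leeD2l // lee_wpmul2r ?lee_fin //.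
by apply: integral_ge0 => x _; rewrite lee_fin.
Qed.

End WignerSeitz.

(** * Functionals on the periodic Sobolev space *)

Section SquareIntegrable.
Variable R : realType.
Local Notation leb2 := (@leb2 R).
Local Notation plane := (R * R)%type.
Variables (a b : plane).
Implicit Types (x y : plane) (h w : plane -> R).
Local Notation Om := (wigner_seitz a b).

Let mOm : measurable Om.
Proof. exact: measurable_wigner_seitz. Qed.

Let mOm' : measurable (Om : set (measurableTypeR R * measurableTypeR R)%type).
Proof. exact: mOm. Qed.

Definition L2r h : Prop :=
  measurable_fun Om h /\ (\int[leb2]_(x in Om) (h x ^+ 2)%:E < +oo)%E.

Definition ip h w : R := \int[leb2]_(x in Om) (h x * w x).

Definition l2norm h : R := Num.sqrt (ip h h).

Lemma L2r_sqr_integrable h : L2r h -> leb2.-integrable Om (EFin \o (fun x => h x ^+ 2)).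
Proof.
move=> [mh fh]; apply/integrableP; split.
  by apply/measurable_EFinP; exact: measurable_funX.
rewrite (_ : (fun x => _) = (fun x => (h x ^+ 2)%:E)) //.
by apply/funext => x /=; rewrite ger0_norm // sqr_ge0.
Qed.

Lemma L2r_integrable h w : L2r h -> L2r w -> leb2.-integrable Om (EFin \o (fun x => h x * w x)).
Proof.
move=> Lh Lw; have ih := L2r_sqr_integrable Lh; have iw := L2r_sqr_integrable Lw.
apply: (le_integrable mOm' _ _ (integrableD mOm' ih iw)).
  by apply/measurable_EFinP; apply: measurable_funM; [exact: Lh.1|exact: Lw.1].
move=> x _ /=; rewrite lee_fin normrM [leRHS]ger0_norm ?addr_ge0 ?sqr_ge0 //.
rewrite -(real_normK (num_real (h x))) -(real_normK (num_real (w x))).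
have := sqr_ge0 (`|h x| - `|w x|); have := normr_ge0 (h x); have := normr_ge0 (w x).
by rewrite !expr2; nra.
Qed.

Lemma L2r_lin (s t : R) h w : L2r h -> L2r w -> L2r (fun x => s * h x + t * w x).
Proof.
move=> Lh Lw.
have m (u : R) g : L2r g -> measurable_fun Om (fun x => u * g x).
  by move=> [mg _]; apply: measurable_funM.
have mD : measurable_fun Om (fun x => s * h x + t * w x).
  by apply: measurable_funD; exact: m.
split=> //.
have i : leb2.-integrable Om (fun x => (2 * s ^+ 2)%:E * (h x ^+ 2)%:E
    + (2 * t ^+ 2)%:E * (w x ^+ 2)%:E)%E.
  have h1 := integrableZl mOm' (2 * s ^+ 2) (L2r_sqr_integrable Lh).
  have h2 := integrableZl mOm' (2 * t ^+ 2) (L2r_sqr_integrable Lw).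
  exact: (integrableD mOm' h1 h2).
apply: le_lt_trans (integrable_lty mOm' i); apply: ge0_le_integral => //.
- by move=> x _; rewrite lee_fin sqr_ge0.
- by apply/measurable_EFinP; exact: measurable_funX.
- exact: (measurable_int _ i).
move=> x _; rewrite -!EFinM -EFinD lee_fin.
have := sqr_ge0 (s * h x - t * w x); rewrite !expr2; lra.
Qed.

Lemma ip_lin (s t : R) h h' w : L2r h -> L2r h' -> L2r w ->
  ip (fun x => s * h x + t * h' x) w = s * ip h w + t * ip h' w.
Proof.
move=> Lh Lh' Lw; have i1 := L2r_integrable Lh Lw; have i2 := L2r_integrable Lh' Lw.
rewrite /ip; transitivity (\int[leb2]_(x in Om) (s * (h x * w x) + t * (h' x * w x))).
  by apply: eq_Rintegral => x _; ring.
have j (u : R) g : leb2.-integrable Om (EFin \o g) ->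
    leb2.-integrable Om (EFin \o (fun x => u * g x)).
  exact: (integrableZl mOm').
rewrite (RintegralD mOm' (j _ _ i1) (j _ _ i2)).
by rewrite (RintegralZl _ mOm' i1) (RintegralZl _ mOm' i2).
Qed.

Lemma ipC h w : ip h w = ip w h.
Proof. by apply: eq_Rintegral => x _; rewrite mulrC. Qed.

Lemma ip_ge0 h : 0 <= ip h h.
Proof. by apply: Rintegral_ge0 => x _; rewrite -expr2 sqr_ge0. Qed.

Lemma ip_quadratic (t : R) h w : L2r h -> L2r w ->
  0 <= ip h h - 2 * t * ip h w + t ^+ 2 * ip w w.
Proof.
move=> Lh Lw; have Ld := L2r_lin 1 (- t) Lh Lw.
have := ip_ge0 (fun x => 1 * h x + - t * w x).
rewrite ip_lin // [ip h _]ipC [ip w _]ipC !ip_lin // [ip w h]ipC => h0.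
by apply: le_trans h0 _; rewrite le_eqVlt; apply/orP; left; apply/eqP; ring.
Qed.

Lemma cauchy_schwarz h w : L2r h -> L2r w -> `|ip h w| <= l2norm h * l2norm w.
Proof.
move=> Lh Lw; have A0 := ip_ge0 h; have C0 := ip_ge0 w.
have H t := ip_quadratic t Lh Lw.
rewrite /l2norm -sqrtrM // -sqrtr_sqr ler_wsqrtr //.
move: (ip h h) (ip h w) (ip w w) A0 C0 H => A B C A0 C0 H.
have [Cz|Cz] := eqVneq C 0.
  have [->|Bz] := eqVneq B 0; first by rewrite expr0n mulr_ge0.
  (* For [C = 0] the quadratic is the affine function [A - 2 * t * B], which takes the value -1 at
     this [t]. *)
  have := H ((A + 1) / (2 * B)); rewrite Cz mulr0 addr0.
  have -> : 2 * ((A + 1) / (2 * B)) * B = A + 1 by field.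
  by rewrite opprD addrA subrr add0r oppr_ge0 ler10.
have Cp : 0 < C by rewrite lt_neqAle eq_sym Cz.
have := H (B / C).
have -> : A - 2 * (B / C) * B + (B / C) ^+ 2 * C = (A * C - B ^+ 2) / C by field.
by rewrite pmulr_lge0 ?invr_gt0 // subr_ge0.
Qed.

Lemma l2norm_ge0 h : 0 <= l2norm h.
Proof. exact: sqrtr_ge0. Qed.

Lemma sqr_l2norm h : l2norm h ^+ 2 = ip h h.
Proof. by rewrite sqr_sqrtr // ip_ge0. Qed.

Lemma l2normD h w : L2r h -> L2r w -> l2norm (fun x => h x + w x) <= l2norm h + l2norm w.
Proof.
move=> Lh Lw.
have E : (fun x => h x + w x) = (fun x => 1 * h x + 1 * w x).
  by apply/funext => x; rewrite !mul1r.
have Ld := L2r_lin 1 1 Lh Lw.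
have := cauchy_schwarz Lh Lw; have := ler_norm (ip h w) => c1 c2.
have p0 : 0 <= l2norm h + l2norm w by rewrite addr_ge0 ?l2norm_ge0.
rewrite -(@ler_pXn2r _ 2) ?nnegrE ?l2norm_ge0 // sqr_l2norm E.
rewrite ip_lin // [ip h _]ipC [ip w _]ipC !ip_lin // [ip w h]ipC.
rewrite sqrrD !sqr_l2norm; lra.
Qed.

Lemma l2norm_scale_bounded (m : plane -> R) (B : R) h : measurable_fun Om m -> 0 <= B ->
  (forall x, `|m x| <= B) -> L2r h -> L2r (fun x => m x * h x) /\
  l2norm (fun x => m x * h x) <= B * l2norm h.
Proof.
move=> mm B0 mB Lh; have ih := L2r_sqr_integrable Lh.
have pw x : (m x * h x) ^+ 2 <= B ^+ 2 * h x ^+ 2.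
  rewrite exprMn ler_wpM2r ?sqr_ge0 // -(real_normK (num_real (m x))).
  by rewrite lerXn2r ?nnegrE.
have mmh : measurable_fun Om (fun x => m x * h x) by apply: measurable_funM => //; exact: Lh.1.
have iB : leb2.-integrable Om (EFin \o (fun x => B ^+ 2 * h x ^+ 2)).
  exact: (integrableZl mOm' (B ^+ 2) ih).
have Lm : L2r (fun x => m x * h x).
  split=> //; apply: le_lt_trans (integrable_lty mOm' iB); apply: ge0_le_integral => //.
  - by move=> x _; rewrite lee_fin sqr_ge0.
  - by apply/measurable_EFinP; exact: measurable_funX.
  - exact: (measurable_int _ iB).
  by move=> x _; rewrite lee_fin.
split=> //; rewrite -(@ler_pXn2r _ 2) ?nnegrE ?l2norm_ge0 ?mulr_ge0 ?l2norm_ge0 //.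
rewrite exprMn !sqr_l2norm /ip.
have E : \int[leb2]_(x in Om) (B ^+ 2 * h x ^+ 2) = B ^+ 2 * \int[leb2]_(x in Om) (h x * h x).
  by rewrite (RintegralZl _ mOm' ih); congr (_ * _); apply: eq_Rintegral => x _; rewrite expr2.
rewrite -E; apply: (le_Rintegral mOm') => //.
  by have := L2r_sqr_integrable Lm.
by move=> x _; rewrite -expr2.
Qed.

End SquareIntegrable.

(** * Functionals that descend to the periodic Sobolev space *)

Section SobolevFunctionals.
Local Open Scope quotient_scope.
Variable R : realType.
Local Notation normc := (@Normc.normc R).
Local Notation leb2 := (@leb2 R).
Local Notation plane := (R * R)%type.
Variables (a b : plane).
Implicit Types (x y : plane).
Local Notation Om := (wigner_seitz a b).
Local Notation V := (H1per a b).
Local Notation preV := (preH1 a b).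
Implicit Types (U W : preV) (u v : V).

Definition reU U x : R := complex.Re ((pre_jet U).1.1 x).
Definition imU U x : R := complex.Im ((pre_jet U).1.1 x).

Let mOm' : measurable (Om : set (measurableTypeR R * measurableTypeR R)%type).
Proof. exact: measurable_wigner_seitz. Qed.

Lemma jet_sqmod_integrable U : leb2.-integrable Om (EFin \o jet_sqmod (pre_jet U)).
Proof.
have [mU1 mU2 mU3] := preH1_measurable U.
apply/integrableP; split.
  by apply/measurable_EFinP; apply: measurable_jet_sqmod; split.
have [_ _ _ fU _] := preH1P U; move: fU; rewrite /jet_sqnorm.
congr (_ < _)%E; apply: eq_integral => x _ /=.
by rewrite ger0_norm // jet_sqmod_ge0.
Qed.

Lemma preH1_dominates U (h : plane -> R) : measurable_fun Om h ->
  (forall x, h x ^+ 2 <= jet_sqmod (pre_jet U) x) ->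
  L2r a b h /\ l2norm a b h <= preH1_norm U.
Proof.
move=> mh hU; have iU := jet_sqmod_integrable U.
have Lh : L2r a b h.
  split=> //; apply: le_lt_trans (integrable_lty mOm' iU); apply: ge0_le_integral => //.
  - by move=> x _; rewrite lee_fin sqr_ge0.
  - by apply/measurable_EFinP; exact: measurable_funX.
  - exact: (measurable_int _ iU).
  by move=> x _; rewrite lee_fin.
split=> //; rewrite /l2norm /preH1_norm ler_wsqrtr //.
have -> : fine (jet_sqnorm a b (pre_jet U)) = \int[leb2]_(x in Om) jet_sqmod (pre_jet U) x by [].
apply: (le_Rintegral mOm') => //; first exact: L2r_integrable.
by move=> x _; rewrite -expr2.
Qed.

Lemma reU_L2 U : L2r a b (reU U) /\ l2norm a b (reU U) <= preH1_norm U.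
Proof.
have [[mre _] _ _] := preH1_measurable U.
apply: preH1_dominates => // x; rewrite /jet_sqmod /sqmod -!addrA lerDl.
by rewrite !addr_ge0 // sqr_ge0.
Qed.

Lemma imU_L2 U : L2r a b (imU U) /\ l2norm a b (imU U) <= preH1_norm U.
Proof.
have [[_ mim] _ _] := preH1_measurable U.
apply: preH1_dominates => // x; rewrite /jet_sqmod /sqmod.
rewrite [complex.Re _ ^+ 2 + _]addrC -!addrA lerDl.
by rewrite !addr_ge0 // sqr_ge0.
Qed.

Lemma reU_lin c U W x : reU (c *: U + W) x =
  complex.Re c * reU U x + (- complex.Im c) * imU U x + reU W x.
Proof.
have -> : reU (c *: U + W) x = complex.Re (c * (pre_jet U).1.1 x + (pre_jet W).1.1 x) by [].
by rewrite Re_lin /reU /imU; ring.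
Qed.

Lemma imU_lin c U W x : imU (c *: U + W) x =
  complex.Re c * imU U x + complex.Im c * reU U x + imU W x.
Proof.
have -> : imU (c *: U + W) x = complex.Im (c * (pre_jet U).1.1 x + (pre_jet W).1.1 x) by [].
by rewrite Im_lin /reU /imU; ring.
Qed.

Lemma ip_reU_lin c U W w : L2r a b w -> ip a b (reU (c *: U + W)) w =
  complex.Re c * ip a b (reU U) w - complex.Im c * ip a b (imU U) w + ip a b (reU W) w.
Proof.
move=> Lw; have [LU _] := reU_L2 U; have [LU' _] := imU_L2 U; have [LW _] := reU_L2 W.
have -> : reU (c *: U + W) = fun x => 1 * (complex.Re c * reU U x + (- complex.Im c) * imU U x)
    + 1 * reU W x by apply/funext => x; rewrite reU_lin !mul1r.
rewrite ip_lin //; last exact: L2r_lin.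
by rewrite ip_lin // !mul1r mulNr.
Qed.

Lemma ip_imU_lin c U W w : L2r a b w -> ip a b (imU (c *: U + W)) w =
  complex.Re c * ip a b (imU U) w + complex.Im c * ip a b (reU U) w + ip a b (imU W) w.
Proof.
move=> Lw; have [LU _] := reU_L2 U; have [LU' _] := imU_L2 U; have [LW _] := imU_L2 W.
have -> : imU (c *: U + W) = fun x => 1 * (complex.Re c * imU U x + complex.Im c * reU U x)
    + 1 * imU W x by apply/funext => x; rewrite imU_lin !mul1r.
rewrite ip_lin //; last exact: L2r_lin.
by rewrite ip_lin // !mul1r.
Qed.

Lemma rnorm_H1 u : rnorm u = preH1_norm (repr u).
Proof. by []. Qed.

Lemma repr_lin c u v : preH1_norm (repr (c *: u + v) - (c *: repr u + repr v)) = 0.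
Proof.
have -> : c *: u + v = \pi_V (c *: repr u + repr v).
  rewrite -[u in LHS]reprK -[v in LHS]reprK.
  rewrite -[c *: _]/(H1scale _ _) -[_ + _]/(H1add _ _).
  by rewrite H1scaleE H1addE.
exact: repr_cls.
Qed.

(* A functional which is additive on representatives and bounded by the norm
   descends to the quotient, so no almost-everywhere argument is needed. *)
Lemma descend_linear (l : preV -> R[i]) (C : R) :
  (forall c U W, l (c *: U + W) = c * l U + l W) ->
  (forall U, normc (l U) <= C * preH1_norm U) ->
  (forall c u v, l (repr (c *: u + v)) = c * l (repr u) + l (repr v)) /\
  (forall u, normc (l (repr u)) <= C * rnorm u).
Proof.
move=> lL lC; have lB U W : l (U - W) = l U - l W.
  by rewrite addrC -scaleN1r lL mulN1r addrC.
split=> // c u v; rewrite -lL; apply/eqP; rewrite -subr_eq0 -lB; apply/eqP.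
apply: Normc.eq0_normc; apply/le_anti; rewrite normc_ge0 andbT.
by apply: le_trans (lC _) _; rewrite repr_lin mulr0.
Qed.

Lemma descend_rlinear (l : preV -> R) (C : R) :
  (forall (t : R) U W, l (t%:C *: U + W) = t * l U + l W) ->
  (forall U, `|l U| <= C * preH1_norm U) ->
  bounded_rlinear (fun u : V => l (repr u)).
Proof.
move=> lL lC.
have lB U W : l (U - W) = l U - l W.
  have -> : U - W = (-1)%:C *: W + U by rewrite addrC -scaleN1r rmorphN1.
  by rewrite lL mulN1r addrC.
have l0 : l 0 = 0 by have := lB 0 0; rewrite !subrr.
have E (t : R) u v : l (repr (t%:C *: u + v)) = t * l (repr u) + l (repr v).
  rewrite -lL; apply/eqP; rewrite -subr_eq0 -lB -normr_eq0.
  by rewrite eq_le normr_ge0 andbT; apply: le_trans (lC _) _; rewrite repr_lin mulr0.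
have r0 : l (repr (0 : V)) = 0.
  apply/eqP; rewrite -normr_eq0 eq_le normr_ge0 andbT; apply: le_trans (lC _) _.
  by rewrite -rnorm_H1 rnorm0 mulr0.
split; last by exists C => u; exact: lC.
split=> [u v|t u]; last by have := E t u 0; rewrite r0 !addr0.
have -> : u - v = (-1)%:C *: v + u by rewrite addrC -scaleN1r rmorphN1.
by rewrite E mulN1r addrC.
Qed.

Definition L2part U : R := l2norm a b (reU U) + l2norm a b (imU U).
Definition L2size u : R := L2part (repr u).

Lemma L2part_ge0 U : 0 <= L2part U.
Proof. by rewrite addr_ge0 ?l2norm_ge0. Qed.

Lemma L2part_le U : L2part U <= 2 * preH1_norm U.
Proof.
by have [_ h1] := reU_L2 U; have [_ h2] := imU_L2 U; rewrite /L2part; lra.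
Qed.

Lemma L2partD U W : L2part (U + W) <= L2part U + L2part W.
Proof.
have [LU _] := reU_L2 U; have [LU' _] := imU_L2 U.
have [LW _] := reU_L2 W; have [LW' _] := imU_L2 W.
have h1 := l2normD LU LW; have h2 := l2normD LU' LW'.
have -> : L2part (U + W) = l2norm a b (fun x => reU U x + reU W x)
    + l2norm a b (fun x => imU U x + imU W x).
  rewrite /L2part; congr (l2norm _ _ _ + l2norm _ _ _); apply/funext => x.
    by have := reU_lin 1 U W x; rewrite scale1r => ->; rewrite /=; ring.
  by have := imU_lin 1 U W x; rewrite scale1r => ->; rewrite /=; ring.
by rewrite /L2part; lra.
Qed.

Lemma P_ip (v u : V) : P_ v u =
  (ip a b (reU (repr u)) (reU (repr v)) + ip a b (imU (repr u)) (imU (repr v))) +i*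
  (ip a b (imU (repr u)) (reU (repr v)) - ip a b (reU (repr u)) (imU (repr v))).
Proof.
have [LU _] := reU_L2 (repr u); have [LU' _] := imU_L2 (repr u).
have [LW _] := reU_L2 (repr v); have [LW' _] := imU_L2 (repr v).
rewrite /P_ /L2dot /cintegral; congr (_ +i* _).
  rewrite /ip -(RintegralD mOm' (L2r_integrable LU LW) (L2r_integrable LU' LW')).
  apply: eq_Rintegral => x _; rewrite /reU /imU -/(fn u x) -/(fn v x).
  by case: (fn u x) => ? ?; case: (fn v x) => ? ? /=; ring.
rewrite /ip -(RintegralB mOm' (L2r_integrable LU' LW) (L2r_integrable LU LW')).
apply: eq_Rintegral => x _; rewrite /reU /imU -/(fn u x) -/(fn v x).
by case: (fn u x) => ? ?; case: (fn v x) => ? ? /=; ring.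
Qed.

Lemma P_linear (v : V) : (forall c u w, P_ v (c *: u + w) = c * P_ v u + P_ v w) /\
  exists B : R, forall u, normc (P_ v u) <= B * rnorm u.
Proof.
have [LW nW] := reU_L2 (repr v); have [LW' nW'] := imU_L2 (repr v).
pose l U := (ip a b (reU U) (reU (repr v)) + ip a b (imU U) (imU (repr v))) +i*
  (ip a b (imU U) (reU (repr v)) - ip a b (reU U) (imU (repr v))).
have [||lL lB] := @descend_linear l (4 * preH1_norm (repr v)).
- move=> c U W; rewrite /l !ip_reU_lin // !ip_imU_lin //.
  by apply/eqP; rewrite eq_complex; case: c => c1 c2 /=; apply/andP; split; apply/eqP; ring.
- move=> U; apply: le_trans (normc_le_sum _) _ => /=.
  have [LU nU] := reU_L2 U; have [LU' nU'] := imU_L2 U.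
  have cs (h w : plane -> R) : L2r a b h -> L2r a b w -> l2norm a b h <= preH1_norm U ->
      l2norm a b w <= preH1_norm (repr v) ->
      `|ip a b h w| <= preH1_norm (repr v) * preH1_norm U.
    move=> Lh Lw nh nw; apply: le_trans (cauchy_schwarz Lh Lw) _.
    by rewrite mulrC ler_pM ?l2norm_ge0.
  have := ler_normD (ip a b (reU U) (reU (repr v))) (ip a b (imU U) (imU (repr v))).
  have := ler_normB (ip a b (imU U) (reU (repr v))) (ip a b (reU U) (imU (repr v))).
  have := cs _ _ LU LW nU nW; have := cs _ _ LU' LW' nU' nW'.
  have := cs _ _ LU' LW nU' nW; have := cs _ _ LU LW' nU nW'.
  lra.
split; last by exists (4 * preH1_norm (repr v)) => u; rewrite P_ip; exact: lB.
by move=> c u w; rewrite !P_ip; exact: lL.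
Qed.

(** [opB] contains no derivatives, so [u] enters only through its L2 size; this is the gain that
    [rellich] turns into smallness. *)
Lemma opB_bound (alpha1 : R) (eps2 : R -> R) (Om1 Om2 : set plane) (w : R) :
  measurable Om1 -> measurable Om2 ->
  exists2 C : R, 0 <= C & forall u v,
    normc (opB alpha1 eps2 Om1 Om2 w u v) <= C * L2size u * rnorm v.
Proof.
move=> m1 m2; pose m x := alpha1 * \1_Om1 x + eps2 w * \1_Om2 x.
pose B := `|alpha1| + `|eps2 w|; have B0 : 0 <= B by rewrite addr_ge0.
have mm : measurable_fun Om m.
  apply: measurable_funTS; apply: measurable_funD; apply: measurable_funM => //;
    exact: measurable_indic.
have mB x : `|m x| <= B.
  apply: le_trans (ler_normD _ _) _; rewrite !normrM.
  have ind (A : set plane) : `|\1_A x| <= 1 :> R.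
    by rewrite indicE; case: (x \in A); rewrite ?normr1 ?normr0.
  by rewrite /B lerD // ler_piMr.
exists (`|w ^+ 2| * (4 * B)); first by rewrite !mulr_ge0.
move=> u v.
have [LU nU] := reU_L2 (repr u); have [LU' nU'] := imU_L2 (repr u).
have [LW nW] := reU_L2 (repr v); have [LW' nW'] := imU_L2 (repr v).
have [LmU nmU] := l2norm_scale_bounded mm B0 mB LU.
have [LmU' nmU'] := l2norm_scale_bounded mm B0 mB LU'.
rewrite /opB Normc.normcM normc_real -!mulrA ler_wpM2l //.
have -> : cintegral a b (fun x => (alpha1 * \1_Om1 x + eps2 w * \1_Om2 x)%:C * fn u x * (fn v x)^*) =
  (ip a b (fun x => m x * reU (repr u) x) (reU (repr v))
   + ip a b (fun x => m x * imU (repr u) x) (imU (repr v))) +i*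
  (ip a b (fun x => m x * imU (repr u) x) (reU (repr v))
   - ip a b (fun x => m x * reU (repr u) x) (imU (repr v))).
  rewrite /cintegral; congr (_ +i* _).
    rewrite /ip -(RintegralD mOm' (L2r_integrable LmU LW) (L2r_integrable LmU' LW')).
    apply: eq_Rintegral => x _; rewrite -/(m x) /reU /imU -/(fn u x) -/(fn v x).
    by case: (fn u x) => ? ?; case: (fn v x) => ? ? /=; ring.
  rewrite /ip -(RintegralB mOm' (L2r_integrable LmU' LW) (L2r_integrable LmU LW')).
  apply: eq_Rintegral => x _; rewrite -/(m x) /reU /imU -/(fn u x) -/(fn v x).
  by case: (fn u x) => ? ?; case: (fn v x) => ? ? /=; ring.
apply: le_trans (normc_le_sum _) _ => /=.
have cs (h g : plane -> R) (q : R) : L2r a b h -> L2r a b g -> l2norm a b h <= B * q -> 0 <= q ->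
   q <= L2size u -> l2norm a b g <= preH1_norm (repr v) ->
   `|ip a b h g| <= B * (L2size u * rnorm v).
  move=> Lh Lg nh q0 qu ng; apply: le_trans (cauchy_schwarz Lh Lg) _.
  rewrite mulrA ler_pM ?l2norm_ge0 //; apply: le_trans nh _; rewrite ler_wpM2l //.
have q1 : l2norm a b (reU (repr u)) <= L2size u by rewrite lerDl l2norm_ge0.
have q2 : l2norm a b (imU (repr u)) <= L2size u by rewrite lerDr l2norm_ge0.
have := ler_normD (ip a b (fun x => m x * reU (repr u) x) (reU (repr v)))
  (ip a b (fun x => m x * imU (repr u) x) (imU (repr v))).
have := ler_normB (ip a b (fun x => m x * imU (repr u) x) (reU (repr v)))
  (ip a b (fun x => m x * reU (repr u) x) (imU (repr v))).
have := cs _ _ _ LmU LW nmU (l2norm_ge0 _ _ _) q1 nW.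
have := cs _ _ _ LmU' LW' nmU' (l2norm_ge0 _ _ _) q2 nW'.
have := cs _ _ _ LmU' LW nmU' (l2norm_ge0 _ _ _) q2 nW.
have := cs _ _ _ LmU LW' nmU (l2norm_ge0 _ _ _) q1 nW'.
lra.
Qed.

End SobolevFunctionals.

(** * Rellich's theorem in quantitative form *)

Section Rellich.
Local Open Scope quotient_scope.
Variable R : realType.
Local Notation normc := (@Normc.normc R).
Local Notation leb2 := (@leb2 R).
Local Notation plane := (R * R)%type.
Variables (a b : plane).
Hypothesis lattice_basis : a.1 * b.2 - a.2 * b.1 != 0.
Implicit Types (x y : plane).
Local Notation Om := (wigner_seitz a b).
Local Notation V := (H1per a b).
Local Notation preV := (preH1 a b).
Implicit Types (U W : preV) (u v : V).

Let mOm : measurable Om.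
Proof. exact: measurable_wigner_seitz. Qed.

Let mOm' : measurable (Om : set (measurableTypeR R * measurableTypeR R)%type).
Proof. exact: mOm. Qed.

Lemma smooth_dense U (e : R) : 0 < e -> exists f W,
  [/\ smooth f, pre_jet W = jet_of f & preH1_norm (U - W) <= e].
Proof.
move=> e0; have [_ _ _ fU /(_ (e ^+ 2))] := preH1P U.
rewrite exprn_gt0 // => /(_ isT) [f [sf pf Uf]].
have mU := preH1_measurable U; have mf := jmeasurable_jet_of a b sf.
have mD : jmeasurable a b (pre_jet U - jet_of f).
  by rewrite addrC -scaleN1r; exact: jmeasurable_lin.
have mN : jmeasurable a b (-1 *: (pre_jet U - jet_of f)).
  have m0 : jmeasurable a b 0 by split; split; exact: measurable_cst.
  by rewrite -[-1 *: _]addr0; exact: jmeasurable_lin.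
have fH : jet_of f \in H1per_pred a b.
  apply/asboolP; split; try by case: mf.
  (* Finiteness of the norm is inherited from [U] and from the small difference [U - jet_of f]. *)
  - have -> : jet_of f = pre_jet U + -1 *: (pre_jet U - jet_of f).
      by rewrite scaleN1r opprB subrKC.
    have h01 : 0 < (2^-1 : R) < 1 by lra.
    apply: le_lt_trans (jet_sqnorm_young mU mN h01) _.
    rewrite jet_sqnormZ //.
    move: fU Uf (jet_sqnorm_ge0 a b (pre_jet U)) (jet_sqnorm_ge0 a b (pre_jet U - jet_of f)).
    case: (jet_sqnorm a b (pre_jet U)) => [p| |] // _.
    case: (jet_sqnorm a b (pre_jet U - jet_of f)) => [q| |] // _ _ _.
    by rewrite -!EFinM -EFinD ltry.
  - by move=> eps eps0; exists f; split=> //; rewrite subrr jet_sqnorm0 lte_fin.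
exists f, (PreH1 fH); split=> //.
rewrite /preH1_norm.
have -> : pre_jet (U - PreH1 fH) = pre_jet U - jet_of f by [].
move: Uf (jet_sqnorm_ge0 a b (pre_jet U - jet_of f)).
case: (jet_sqnorm a b (pre_jet U - jet_of f)) => [q| |] //=.
rewrite lte_fin => qe _; apply: (@le_trans _ _ (Num.sqrt (e ^+ 2))).
  by rewrite ler_wsqrtr // ltW.
by rewrite sqrtr_sqr ger0_norm // ltW.
Qed.

Lemma indic_L2 (K : set plane) : measurable K -> L2r a b (\1_K : plane -> R).
Proof.
move=> mK; have [L OL] := wigner_seitz_bounded lattice_basis.
have mi : measurable_fun Om (\1_K : plane -> R).
  by apply: measurable_funTS; exact: measurable_indic.
split=> //; apply: (@le_lt_trans _ _ (leb2 Om)); last exact: (leb2_bounded mOm OL).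
rewrite -[leRHS]mul1e -(integral_cst leb2 mOm' 1); apply: ge0_le_integral => //.
- by apply/measurable_EFinP; exact: measurable_funX.
- by move=> x _; rewrite lee_fin indicE; case: (x \in K); rewrite ?expr1n ?expr0n.
Qed.

Lemma integral_cell (K : set plane) (h : plane -> R) : K `<=` Om ->
  \int[leb2]_(x in K) h x = ip a b h \1_K.
Proof.
move=> KO; rewrite /ip -(setIidr KO) Rintegral_mkcondr setIidr //.
apply: eq_Rintegral => x _; rewrite patchE indicE.
by case: ifP => _; rewrite ?mulr1 ?mulr0.
Qed.

Lemma sqrt_sum_le (I : finType) (g : I -> R) (A e n : R) :
  0 <= A -> 0 <= e -> 0 <= n -> A ^+ 2 <= \sum_i g i ^+ 2 + e ^+ 2 * n ^+ 2 ->
  A <= e * n + \sum_i `|g i|.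
Proof.
move=> A0 e0 n0 h.
have s0 : 0 <= \sum_i `|g i| by exact: sumr_ge0.
have en : 0 <= e * n by rewrite mulr_ge0.
have [_ sq] : 0 <= \sum_i `|g i| /\ \sum_i g i ^+ 2 <= (\sum_i `|g i|) ^+ 2.
  elim/big_rec2: _ => [|i y1 y2 _ [y0 IH]]; first by rewrite expr0n.
  split; first by rewrite addr_ge0.
  rewrite sqrrD real_normK ?num_real //.
  have := mulr_ge0 (normr_ge0 (g i)) y0; move: IH; rewrite mulr2n; lra.
rewrite -(@ler_pXn2r _ 2) ?nnegrE ?addr_ge0 //; apply: le_trans h _.
have -> : (e * n + \sum_i `|g i|) ^+ 2 = (\sum_i `|g i|) ^+ 2 + e ^+ 2 * n ^+ 2
  + 2 * (e * n * \sum_i `|g i|) by ring.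
by have := mulr_ge0 en s0; lra.
Qed.

Lemma smooth_cell_bound (I : finType) (K : I -> set plane) (c : I -> R) (e : R) U f
    (h : plane -> R) :
  (forall i, K i `<=` Om) -> (forall i, 0 <= c i) -> 0 <= e ->
  (forall f, Ck 1 f -> (\int[leb2]_(x in Om) (f x ^+ 2)%:E <=
     (\sum_i c i * (\int[leb2]_(x in K i) f x) ^+ 2)%:E
     + (e ^+ 2)%:E * \int[leb2]_(x in Om) (grad_sq f x)%:E)%E) ->
  Ck 1 h -> L2r a b h -> pre_jet U = jet_of f ->
  (forall x, grad_sq h x <= jet_sqmod (pre_jet U) x) ->
  l2norm a b h <= e * preH1_norm U + \sum_i `|Num.sqrt (c i) * ip a b h \1_(K i)|.
Proof.
move=> KO c0 e0 poin Ch Lh Uf gU.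
apply: sqrt_sum_le => //; [exact: l2norm_ge0|exact: preH1_norm_ge0|].
have iU := jet_sqmod_integrable U.
have E2 : (\int[leb2]_(x in Om) (h x ^+ 2)%:E = (l2norm a b h ^+ 2)%:E)%E.
  rewrite sqr_l2norm /ip fineK; last exact: (integrable_fin_num mOm' (L2r_integrable Lh Lh)).
  by apply: eq_integral => x _; rewrite expr2.
have gle : (\int[leb2]_(x in Om) (grad_sq h x)%:E <= (preH1_norm U ^+ 2)%:E)%E.
  rewrite sqr_preH1_norm -preH1_fin; apply: ge0_le_integral => //.
  - by move=> x _; rewrite lee_fin addr_ge0 ?sqr_ge0.
  - by apply/measurable_EFinP; apply: measurable_funTS; exact: measurable_grad_sq.
  - exact: (measurable_int _ iU).
  by move=> x _; rewrite lee_fin.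
have := poin h Ch; rewrite E2 => /le_trans; move/(_ ((\sum_i c i * (\int[leb2]_(x in K i) h x) ^+ 2)%:E
     + (e ^+ 2)%:E * (preH1_norm U ^+ 2)%:E)%E) => H.
have {}H := H (leeD2l _ (lee_wpmul2l _ gle)).
rewrite -EFinM -EFinD lee_fin in H.
rewrite lee_fin sqr_ge0 in H; have {}H := H isT.
apply: le_trans H _; rewrite lerD2r; apply: ler_sum => i _.
by rewrite exprMn sqr_sqrtr // integral_cell.
Qed.

(** Compactness of the embedding into L2, as an inequality. On smooth functions it is
    [poincare_cells] with multiples of the cell integrals as functionals; it passes to all of [V] by
    density, because both sides are continuous in the norm. *)
Lemma rellich (e : R) : 0 < e -> exists ls : seq (V -> R),
  (forall i, (i < size ls)%N -> bounded_rlinear (nth (fun=> 0) ls i)) /\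
  forall u, L2size u <= e * rnorm u + \sum_(l <- ls) `|l u|.
Proof.
move=> e0; pose d := e / 2; have d0 : 0 < d by rewrite divr_gt0.
have [I [K [c [mK KO c0 poin]]]] := poincare_cells lattice_basis (exprn_gt0 2 d0).
have LK i := indic_L2 (mK i).
(* Each cell gives one functional for the real and one for the imaginary part; either part may spend
   [d = e / 2] of the norm. *)
pose G (k : I + I) (U : preV) : R := match k with
  | inl i => Num.sqrt (c i) * ip a b (reU U) \1_(K i)
  | inr i => Num.sqrt (c i) * ip a b (imU U) \1_(K i) end.
have GB k : exists B, 0 <= B /\ forall U, `|G k U| <= B * preH1_norm U.
  have cs i (h : plane -> R) U : L2r a b h /\ l2norm a b h <= preH1_norm U ->
      `|Num.sqrt (c i) * ip a b h \1_(K i)| <=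
      Num.sqrt (c i) * l2norm a b (\1_(K i) : plane -> R) * preH1_norm U.
    move=> [Lh nh]; rewrite normrM ger0_norm ?sqrtr_ge0 // -mulrA ler_wpM2l ?sqrtr_ge0 //.
    by apply: le_trans (cauchy_schwarz Lh (LK i)) _; rewrite mulrC ler_wpM2l ?l2norm_ge0.
  case: k => i; exists (Num.sqrt (c i) * l2norm a b (\1_(K i) : plane -> R));
    (split; first by rewrite mulr_ge0 ?sqrtr_ge0 ?l2norm_ge0) => U; apply: cs.
    exact: reU_L2.
  exact: imU_L2.
have GL k (t : R) U W : G k (t%:C *: U + W) = t * G k U + G k W.
  by case: k => i /=; rewrite ?ip_reU_lin ?ip_imU_lin //=; ring.
pose ls := [seq (fun u : V => G k (repr u)) | k <- enum {: I + I}].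
exists ls; split.
  move=> i; rewrite size_map => ils.
  have [k0 _] : exists k : I + I, True.
    by case: (enum _) ils => // k *; exists k.
  rewrite (nth_map k0) //; set k := nth _ _ _.
  by have [B [_ BP]] := GB k; apply: (descend_rlinear (GL k) BP).
move=> u; rewrite big_map big_enum /=.
have GN k U W : G k (U - W) = G k U - G k W.
  have -> : U - W = (-1)%:C *: W + U by rewrite addrC -scaleN1r rmorphN1.
  by rewrite GL mulN1r addrC.
have [BB BBP] := choice GB.
set U := repr u.
have smooth_case W f : smooth f -> pre_jet W = jet_of f ->
    L2part W <= e * preH1_norm W + \sum_k `|G k W|.
  move=> sf Wf; have [Cre Cim] := sf 1%N.
  have [LW _] := reU_L2 W; have [LW' _] := imU_L2 W.
  have rE : reU W = fun x => complex.Re (f x) by apply/funext => x; rewrite /reU Wf.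
  have iE : imU W = fun x => complex.Im (f x) by apply/funext => x; rewrite /imU Wf.
  have := @smooth_cell_bound I K c d W f (reU W) KO c0 (ltW d0) poin.
  rewrite {1}rE => /(_ Cre LW Wf) h1.
  have := @smooth_cell_bound I K c d W f (imU W) KO c0 (ltW d0) poin.
  rewrite {1}iE => /(_ Cim LW' Wf) h2.
  have jE x : jet_sqmod (pre_jet W) x =
     sqmod (f x) + sqmod (cpartial (e1 R) f x) + sqmod (cpartial (e2 R) f x).
    by rewrite Wf.
  have {}h1 : l2norm a b (reU W) <= d * preH1_norm W
      + \sum_i `|Num.sqrt (c i) * ip a b (reU W) \1_(K i)|.
    apply: h1 => x; rewrite jE rE /grad_sq /sqmod /=.
    have := sqr_ge0 (complex.Re (f x)); have := sqr_ge0 (complex.Im (f x)).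
    have := sqr_ge0 ('D_(e1 R) (fun z => complex.Im (f z)) x).
    have := sqr_ge0 ('D_(e2 R) (fun z => complex.Im (f z)) x).
    lra.
  have {}h2 : l2norm a b (imU W) <= d * preH1_norm W
      + \sum_i `|Num.sqrt (c i) * ip a b (imU W) \1_(K i)|.
    apply: h2 => x; rewrite jE iE /grad_sq /sqmod /=.
    have := sqr_ge0 (complex.Re (f x)); have := sqr_ge0 (complex.Im (f x)).
    have := sqr_ge0 ('D_(e1 R) (fun z => complex.Re (f z)) x).
    have := sqr_ge0 ('D_(e2 R) (fun z => complex.Re (f z)) x).
    lra.
  rewrite big_sumType /= /L2part; have -> : e = d + d by rewrite /d; field.
  rewrite mulrDl; lra.
rewrite /L2size rnorm_H1 -/U.
apply/ler_addgt0Pr => t t0.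
(* The cost of replacing [U] by the smooth [W], per unit of [n]: 2 from [L2part_le], [e] from the
   norm, [BB k] from each functional. *)
pose Q := 2 + e + \sum_k BB k.
have Q0 : 0 < Q.
  by rewrite /Q ltr_pwDl // ?addr_gt0 // sumr_ge0 // => k _; have [] := BBP k.
have [f [W [sf Wf UW]]] := smooth_dense U (divr_gt0 t0 Q0).
set n := preH1_norm (U - W) in UW.
have n0 : 0 <= n by exact: preH1_norm_ge0.
have h1 : L2part U <= L2part W + 2 * n.
  have := L2partD W (U - W); rewrite subrKC => /le_trans; apply.
  by rewrite lerD2l L2part_le.
have h2 := smooth_case W f sf Wf.
have h3 : preH1_norm W <= preH1_norm U + n.
  have := ler_preH1_normD U (W - U); rewrite subrKC => /le_trans; apply.
  by rewrite lerD2l preH1_distC.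
have h4 : \sum_k `|G k W| <= \sum_k `|G k U| + \sum_k BB k * n.
  rewrite -big_split; apply: ler_sum => k _ /=.
  have -> : G k W = G k U - G k (U - W) by rewrite GN subKr.
  apply: le_trans (ler_normB _ _) _; rewrite lerD2l.
  by have [_] := BBP k; apply.
rewrite -mulr_suml in h4.
have h5 : Q * n <= t by rewrite mulrC -ler_pdivlMr.
have h6 : e * preH1_norm W <= e * preH1_norm U + e * n.
  by rewrite -mulrDr ler_pM2l.
move: h5; rewrite /Q !mulrDl; lra.
Qed.

End Rellich.

(** * Simple eigenvalues and the final assembly *)

Section Assembly.
Variable R : realType.
Local Notation normc := (@Normc.normc R).
Variables (a b : plane R).
Local Notation V := (H1per a b).

Lemma W_norm_le (us : V) (ws : R[i]) (u : V) (w : R[i]) :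
  W_norm (u - us) (w - ws) <= pair_dist us ws u w /\
  pair_dist us ws u w <= 2 * W_norm (u - us) (w - ws).
Proof.
rewrite /W_norm /pair_dist -[rnorm _]/(H1norm (u - us)) normcE.
have -> : complex.Re ((normc (w - ws))%:C ^+ 2) = normc (w - ws) ^+ 2.
  by rewrite -rmorphXn.
have := rnorm_ge0 (u - us); rewrite -[rnorm _]/(H1norm (u - us)).
have := normc_ge0 (w - ws); move: (H1norm _) (normc _) => p q q0 p0.
have s0 : 0 <= p ^+ 2 + q ^+ 2 by rewrite addr_ge0 ?sqr_ge0.
split.
  rewrite -(@ler_pXn2r _ 2) ?nnegrE ?sqrtr_ge0 ?addr_ge0 // sqr_sqrtr // sqrrD.
  by have := mulr_ge0 p0 q0; rewrite mulr2n; lra.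
have h1 : p <= Num.sqrt (p ^+ 2 + q ^+ 2).
  by rewrite -{1}(ger0_norm p0) -sqrtr_sqr ler_wsqrtr // lerDl sqr_ge0.
have h2 : q <= Num.sqrt (p ^+ 2 + q ^+ 2).
  by rewrite -{1}(ger0_norm q0) -sqrtr_sqr ler_wsqrtr // lerDr sqr_ge0.
lra.
Qed.

Lemma quadratic_convergence (us : V) (ws : R[i]) (u : nat -> V) (w : nat -> R[i]) (r C : R) :
  0 < r -> 0 < C -> (forall j, pair_dist us ws (u j) (w j) <= r / 2 ^+ j) ->
  (forall j, pair_dist us ws (u j.+1) (w j.+1) <= C * pair_dist us ws (u j) (w j) ^+ 2) ->
  converges_quadratically u w us ws.
Proof.
move=> r0 C0 H1 H2; split.
  apply/cvgrPdist_le => e e0.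
  exists (Num.bound (r / e)) => // j /= jN.
  rewrite sub0r normrN ger0_norm ?sqrtr_ge0 //.
  apply: le_trans (W_norm_le us ws (u j) (w j)).1 _; apply: le_trans (H1 j) _.
  rewrite ler_pdivrMr ?exprn_gt0 // mulrC -ler_pdivrMr //.
  have re0 : 0 <= r / e by rewrite divr_ge0 // ltW.
  have h := archi_boundP re0.
  apply: le_trans (ltW h) _; rewrite -natrX ler_nat.
  by apply: leq_trans jN _; apply/ltnW/ltn_expl.
(* The 4 is the square of the 2 in [W_norm_le]. *)
exists (4 * C) => j; apply: le_trans (W_norm_le _ _ _ _).1 _; apply: le_trans (H2 j) _.
have h := (W_norm_le us ws (u j) (w j)).2.
have -> : 4 * C * W_norm (u j - us) (w j - ws) ^+ 2 =
  C * (2 * W_norm (u j - us) (w j - ws)) ^+ 2 by ring.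
rewrite ler_pM2l // lerXn2r ?nnegrE ?mulr_ge0 ?sqrtr_ge0 //.
by rewrite addr_ge0 ?rnorm_ge0 ?normc_ge0.
Qed.

(* Injectivity of the bordered operator: a kernel element with [nu <> 0] would
   extend [us] to a Jordan chain of length two. *)
Lemma bordered_injective (D : set R[i]) (T T' : R[i] -> V -> V -> R[i]) (P : V -> R[i])
    (us : V) (ws : R[i]) :
  (forall z, D z -> op_derive T z (T' z)) -> (forall z, D z -> bounded_op (T z)) -> D ws ->
  us != 0 -> (forall v, T ws us v = 0) ->
  geometric_multiplicity_one T ws -> algebraic_multiplicity_one D T ws ->
  (forall c u w, P (c *: u + w) = c * P u + P w) -> P us = 1 ->
  forall s nu, (forall v, T ws s v + nu * T' ws us v = 0) -> P s = 0 -> s = 0 /\ nu = 0.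
Proof.
move=> T'_def Tb Dws us0 eig [u0 _ ker0] alg PL Pus s nu H Ps.
have [TL _ _] := Tb _ Dws.
have T0 v : T ws 0 v = 0.
  by have := TL (-1) us us v; rewrite scaleN1r addNr !eig mulr0 addr0.
have TZ c u v : T ws (c *: u) v = c * T ws u v.
  by have := TL c u 0 v; rewrite T0 !addr0.
have P0 : P 0 = 0.
  by have := PL (-1) us us; rewrite scaleN1r addNr mulN1r addNr.
have PZ c u : P (c *: u) = c * P u.
  by have := PL c u 0; rewrite P0 !addr0.
(* For [nu = 0] the vector [s] lies in the kernel, the line spanned by [u0]. As [P us = 1], [P] does
   not vanish on [u0], so [P s = 0] forces [s = 0]. *)
have [nu0|nu0] := eqVneq nu 0.
  split=> //; have : op_ker (T ws) s.
    by move=> v; have := H v; rewrite nu0 mul0r addr0.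
  have : op_ker (T ws) us by [].
  rewrite ker0 => -[c' _ usE] [c _ sE].
  have Pu0 : P u0 != 0.
    by apply/eqP => Pu0; move: Pus; rewrite -usE PZ Pu0 mulr0 => /esym/eqP; rewrite oner_eq0.
  by move: Ps; rewrite -sE PZ => /eqP; rewrite mulf_eq0 (negbTE Pu0) orbF => /eqP ->;
    rewrite scale0r.
pose x n := if n is 0%N then us else nu^-1 *: s.
suff /alg : jordan_chain D T ws 2 x by [].
split=> //; exists (fun l => if l is 0%N then T else T'); split=> //.
  by case=> [|//] _ z Dz; exact: T'_def.
case=> [|[|//]] _ v; first by rewrite big_ord_recl big_ord0 /= eig mulr0 addr0.
rewrite big_ord_recl big_ord_recl big_ord0 /= invr1 !mul1r addr0.
rewrite TZ; have -> : T' ws us v = - (nu^-1 * T ws s v).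
  have /eqP := H v; rewrite addr_eq0 => /eqP ->.
  by rewrite mulrN opprK mulKf.
by rewrite subrr.
Qed.

End Assembly.

Theorem mainTheorem3 (R : realType)
    (* lattice basis, material decomposition of the cell, coefficients *)
    (a b k : plane R) (Om1 Om2 : set (plane R))
    (alpha1 C0 C1 : R) (S : set R) (eps2 : R -> R)
    (lattice_basis : a.1 * b.2 - a.2 * b.1 != 0)
    (mOm1 : measurable Om1) (mOm2 : measurable Om2)
    (Om_cover : Om1 `|` Om2 = wigner_seitz a b)
    (Om_disj : Om1 `&` Om2 = set0)
    (alpha1_gt0 : 0 < alpha1)
    (S_open : open S) (S_conn : connected S)
    (eps2_analytic : real_analytic S eps2)
    (C0_gt0 : 0 < C0)
    (eps2_bounds : forall w, S w -> C0 <= `|eps2 w| <= C1)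
    (eps2_even : forall w, S w -> S (- w) -> eps2 (- w) = eps2 w)
    (* the extension of the operator function, and its derivative *)
    (D : set R[i]) (T T' : R[i] -> H1per a b -> H1per a b -> R[i])
    (D_open : open D) (D_convex : convex_set (M := R[i]^o) D)
    (D_conj : forall z, D z -> D z^*)
    (D_S : forall w, S w -> D w%:C)
    (T_S : forall w, S w -> forall u v,
       T w%:C u v = opA k u v - opB alpha1 eps2 Om1 Om2 w u v)
    (T_holo : holomorphic_op D T)
    (T_sa : self_adjoint D T)
    (T_spec : discrete_spectrum D T)
    (T'_def : forall z, D z -> op_derive T z (T' z))
    (* the eigenpair *)
    (ustar : H1per a b) (wstar : R)
    (wstar_S : S wstar) (ustar_neq0 : ustar != 0)
    (eigenpair : forall v, T wstar%:C ustar v = 0)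
    (geo_mult : geometric_multiplicity_one T wstar%:C)
    (alg_mult : algebraic_multiplicity_one D T wstar%:C)
    (y : H1per a b) (y_ustar : P_ y ustar = 1)
    (G : set (H1per a b))
    (G_open : open G) (G_convex : convex_set (M := H1per a b) G)
    (G_ustar : G ustar) :
  exists r : R, 0 < r /\
    (forall z, D z -> 0 < `|z - wstar%:C| < r%:C -> op_invertible (T z)) /\
    forall (u0 : H1per a b) (w0 : R[i]),
      G u0 -> D w0 -> W_norm (u0 - ustar) (w0 - wstar%:C) < r ->
      P_ y u0 = 1 ->
      (w0 != wstar%:C -> P_ y (op_inv (T w0) (T' w0 u0)) != 0) ->
      exists (u s : nat -> H1per a b) (w nu : nat -> R[i]),
        [/\ u 0%N = u0 /\ w 0%N = w0,
            (* every step is well-defined: the iterate lies in E = G x D and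
               the linear system has exactly one solution *)
            forall j, [/\ G (u j), D (w j),
              newton_system T T' y (u j) (w j) (s j) (nu j) &
              forall s' nu', newton_system T T' y (u j) (w j) s' nu' ->
                s' = s j /\ nu' = nu j],
            forall j, u j.+1 = u j + s j /\ w j.+1 = w j + nu j &
            converges_quadratically u w ustar wstar%:C].
Proof.
set ws := wstar%:C.
have Dws : D ws by exact: D_S.
have [Tb _] := T_holo.
have T0 v : T ws 0 v = 0.
  have [TL _ _] := Tb _ Dws.
  by have := TL (-1) ustar ustar v; rewrite scaleN1r addNr !eigenpair mulr0 addr0.
(* The zero functional has the two preimages 0 and [ustar]; so [ws] is a spectral point, and
   [T_spec] isolates it. *)
have ws_spec : spectrum D T ws.
  split=> // -[surj _].
  have [|u [_ uniq]] := surj (fun=> 0).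
    split; first by move=> c v w; rewrite mulr0 addr0.
    by exists 0 => v; rewrite normr0 mul0r.
  have e1 : u = ustar by apply: uniq; apply/funext.
  have e2 : u = 0 by apply: uniq; apply/funext => v; exact: T0.
  by move: ustar_neq0; rewrite -e1 e2 eqxx.
have [_ [r1 r10 iso] _] := T_spec _ ws_spec.
have T_inv z : D z -> 0 < Normc.normc (z - ws) < r1 -> op_invertible (T z).
  move=> Dz /andP[z0 zr]; apply: contrapT => Tz.
  have zws : z = ws by apply: iso; [split|rewrite normcE ltcR].
  by move: z0; rewrite zws subrr Normc.normc0 ltxx.
(* A real point, because [T] is tied to [opA] and [opB] on [S] only; close to [ws] but different
   from it, it lies outside the spectrum. *)
have [w1 [w1S w1ne w1r]] : exists w1 : R, [/\ S w1, w1 != wstar & `|w1 - wstar| < r1].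
  have /nbhs_ballP[e /= e0 eS] : nbhs wstar S by apply: open_nbhs_nbhs; split.
  pose d := Num.min e r1 / 2.
  have m0 : 0 < Num.min e r1 by rewrite lt_min e0.
  have d0 : 0 < d by rewrite divr_gt0.
  have dm : d < Num.min e r1 by rewrite /d; lra.
  exists (wstar + d); split.
  - apply: eS; rewrite /ball /= opprD addNKr normrN ger0_norm ?(ltW d0) //.
    by apply: lt_le_trans dm _; rewrite ge_min lexx.
  - by rewrite -subr_eq0 addrAC subrr add0r gt_eqF.
  - rewrite addrAC subrr add0r ger0_norm ?(ltW d0) //.
    by apply: lt_le_trans dm _; rewrite ge_min lexx orbT.
have Dz0 := D_S _ w1S.
have Tz0 : op_invertible (T w1%:C).
  apply: T_inv => //; rewrite -rmorphB normc_real w1r andbT.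
  by rewrite normr_gt0 subr_eq0.
have Vc := op_invertible_complete (Tb _ Dz0) Tz0.
have [_ [M MP]] := Tz0.
have [B0 B00 B0P] := opB_bound a b alpha1 eps2 wstar mOm1 mOm2.
have [B1 B10 B1P] := opB_bound a b alpha1 eps2 w1 mOm1 mOm2.
pose B := B0 + B1; have BB : 0 <= B by rewrite addr_ge0.
pose m := `|M|; have m0 : 0 <= m by exact: normr_ge0.
(* This weight times [m * B] is at most 1/2, so in [peetre] the L2 term costs at most half the norm
   of [u], besides the functionals. *)
have e0 : 0 < (2 * (m * B + 1))^-1.
  by rewrite invr_gt0 mulr_gt0 // ltr_wpDl // mulr_ge0.
have [ls [lsP lsN]] := rellich lattice_basis e0.
have peetre u K : 0 <= K -> (forall v, Normc.normc (T ws u v) <= K * rnorm v) ->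
    rnorm u <= 2 * m * (1 + B) * (K + \sum_(l <- ls) `|l u|).
  move=> K0 H; set Sg := \sum_(l <- ls) _.
  have Sg0 : 0 <= Sg by exact: sumr_ge0.
  have N0 : 0 <= L2size u by exact: L2part_ge0.
  have KN : 0 <= K + B * L2size u by rewrite addr_ge0 // mulr_ge0.
  have h : rnorm u <= m * (K + B * L2size u).
    have := MP u _ KN; rewrite rnormE lecR => h.
    apply: le_trans (h _) _; last by rewrite ler_wpM2r // ler_norm.
    move=> v; rewrite dual_boundE.
    have -> : T w1%:C u v = T ws u v + opB alpha1 eps2 Om1 Om2 wstar u v
        - opB alpha1 eps2 Om1 Om2 w1 u v.
      by rewrite (T_S _ wstar_S) (T_S _ w1S); ring.
    apply: le_trans (normcD _ _) _; rewrite normcN.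
    apply: le_trans (lerD (normcD _ _) (lexx _)) _.
    apply: le_trans (lerD (lerD (H v) (B0P u v)) (B1P u v)) _.
    by rewrite /B !mulrDl addrA.
  have hN := lsN u; rewrite -/Sg in hN.
  have q0 : 0 <= m * B by rewrite mulr_ge0.
  have u0 := rnorm_ge0 u.
  have h2 : m * B * L2size u <= rnorm u / 2 + m * B * Sg.
    apply: le_trans (ler_wpM2l q0 hN) _; rewrite mulrDr lerD2r.
    have -> : m * B * ((2 * (m * B + 1))^-1 * rnorm u) =
       (rnorm u / 2) * (m * B / (m * B + 1)) by field; rewrite gt_eqF // ltr_wpDl.
    rewrite ler_piMr ?divr_ge0 // ler_pdivrMr ?ltr_wpDl // mul1r; lra.
  have h3 : 0 <= m * Sg by rewrite mulr_ge0.
  have h4 : 0 <= m * B * K by rewrite mulr_ge0.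
  have : rnorm u / 2 <= m * K + m * B * Sg by move: h; rewrite mulrDr mulrA; lra.
  lra.
have [PL PB] := P_linear y.
have inj := bordered_injective T'_def Tb Dws ustar_neq0 eigenpair geo_mult alg_mult PL y_ustar.
have gdual : in_dual (T' ws ustar).
  have [[_ T'anti [M' M'P]] _] := T'_def _ Dws.
  split; first exact: T'anti.
  exists (M' * rnorm ustar) => v; have := M'P ustar v.
  by rewrite op_boundE dual_boundE.
have [C [Cpos lb]] := bordered_lower_bound Vc (Tb _ Dws) gdual PL PB lsP peetre inj.
have [r [C' [r0 C'0 newton]]] := newton_converges D_open T'_def Tb Dws eigenpair PL y_ustar
  G_open G_ustar Cpos r10 lb T_inv.
(* [r1] serves the invertibility of [T], and [r / 2] accounts for [pair_dist] being at most twice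
   [W_norm]. *)
pose r' := Num.min r1 (r / 2).
have r'0 : 0 < r' by rewrite lt_min r10 divr_gt0.
exists r'; split=> //; split.
  move=> z Dz /andP[z0 zr]; apply: T_inv => //; apply/andP; split.
    by rewrite -ltcR -normcE.
  by move: zr; rewrite normcE ltcR => /lt_le_trans; apply; rewrite ge_min lexx.
move=> u0 w0 _ _ d0 Pu0 _.
have dist0 : pair_dist ustar ws u0 w0 < r.
  apply: le_lt_trans (W_norm_le _ _ _ _).2 _.
  have : W_norm (u0 - ustar) (w0 - ws) < r / 2.
    by apply: lt_le_trans d0 _; rewrite ge_min lexx orbT.
  lra.
have [u [s [w [nu [init steps next decay quad]]]]] := newton u0 w0 dist0 Pu0.
exists u, s, w, nu; split=> //.
exact: (quadratic_convergence r0 C'0 decay quad).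
Qed.
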